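(* Let $(X,d)$, $\tilde d$, $(P_x)_{x\in X}$, $P$ and $P^*$ be as in the context. Suppose that there exists a positive Radon measure $v$ on $X$ such that the following three conditions hold. (i) (Local volume doubling) There are constants $D,R_1>0$ such that $v(B_{2r}(x))\le D\,v(B_r(x))$ for all $x\in X$ and $r\in(0,R_1)$. (ii) ($(1,p_0)$-local Poincaré inequality) There is $p_0\ge 1$ such that for every $R>0$ there are constants $\lambda\ge 1$ and $C_P>0$ such that, for any $f\in L^1_{\mathrm{loc}}(v)$ and any upper gradient $g$ of $f$, $$\int_{B_r(x)}|f-f_{x,r}|\,dv\le C_P\, r\left\{\int_{B_{\lambda r}(x)}g^{p_0}\,dv\right\}^{1/p_0}$$ for every $x\in X$ and $r\in(0,R)$, where $f_{x,r}:=v(B_r(x))^{-1}\int_{B_r(x)}f\,dv$. (iii) For every $x\in X$, $P_x$ is absolutely continuous with respect to $v$, $P_x(dy)=P_x(y)\,v(dy)$, and the density $P_x(y)$ is continuous with respect to $x$. Then, for any $p\in[1,\infty]$, the following two statements are equivalent. (a) For all $\mu,\nu\in\mathscr P(X)$, $$d^{\,W}_p(P^*\mu,P^*\nu)\le \tilde d^{\,W}_p(\mu,\nu).$$ (b) When $p>1$: for all $f\in C_{b,L}(X)$ and all $x\in X$, $$|\nabla_{\tilde d}Pf|(x)\le \left\{P\left(|\nabla_d f|^q\right)(x)\right\}^{1/q},$$ where $q$ is the Hölder conjugate of $p$, i.e. $1/p+1/q=1$. When $p=1$: for all $f\in C_{b,L}(X)$, $$\|\nabla_{\tilde d}Pf\|_\infty\le\|\nabla_d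 f\|_\infty .$$
   Context: Setting. $(X,d)$ is a complete, separable, proper, length metric space: $d(x,y)$ is the infimum of the lengths of curves joining $x$ and $y$, and all closed balls of finite radius are compact. The topology of $X$ is that of $d$; $B_r(x)$ denotes the metric ball with respect to $d$ of radius $r$ centred at $x$. $\tilde d$ is a continuous distance function on $X$, possibly different from $d$, such that any $x,y\in X$ are joined by a $\tilde d$-minimal geodesic, i.e. a curve in $X$ whose length with respect to $\tilde d$ equals $\tilde d(x,y)$. $\mathscr P(X)$ is the space of Borel probability measures on $X$ with the topology of weak convergence. $(P_x)_{x\in X}$ is a family in $\mathscr P(X)$ such that $x\mapsto P_x$ is continuous from $X$ to $\mathscr P(X)$. It defines a bounded linear operator $P$ on the space $C_b(X)$ of bounded continuous functions (with the supremum norm) by $Pf(x):=\int_X f(y)\,P_x(dy)$; the same formula is used for bounded measurable $f$. $P^*$ is the adjoint operator of $P$; it maps $\mathscr P(X)$ into itself, by $P^*\mu(A)=\int_X P_x(A)\,\mu(dx)$. Wasserstein distances. For $\mu,\nu\in\mathscr P(X)$, $\Pi(\mu,\nu)$ is the set of couplings, i.e. probability measures on $X\times X$ with first marginal $\mu$ and second marginal $\nu$. For measurable $\rho:X\times X\to[0,\infty)$ and $p\in[1,\infty]$, $\rho^{\,W}_p(\mu,\nu):=\inf\{\|\rho\|_{L^p(\pi)}:\pi\in\Pi(\mu,\nu)\}\in[0,\infty]$; this is used with $\rho=d$ and $\rho=\tilde d$. No moment restriction is imposed, so the value $+\infty$ is allowed. Functions and gradients. $C_{b,L}(X)$ is the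 set of bounded functions on $X$ that are Lipschitz continuous with respect to $d$. For measurable $f$ and $x\in X$, $|\nabla_d f|(x):=\lim_{r\downarrow0}\sup_{0<d(x,y)\le r}\left|\frac{f(x)-f(y)}{d(x,y)}\right|$ and $\|\nabla_d f\|_\infty:=\sup_{x\in X}|\nabla_d f|(x)$; $|\nabla_{\tilde d}f|$ and $\|\nabla_{\tilde d}f\|_\infty$ are defined in the same way with $\tilde d$ in place of $d$. A measurable function $g$ is an upper gradient of a measurable function $f$ if for every rectifiable curve $\gamma:[0,l]\to X$ parametrized by arc length (with respect to $d$), $|f(\gamma(l))-f(\gamma(0))|\le\int_0^l g(\gamma(s))\,ds$. *)

(* Defs.v *)
From HB Require Import structures.
From mathcomp Require Import all_boot all_order all_algebra.
From mathcomp Require Import all_classical all_reals all_analysis.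
From mathcomp Require Import measurable_realfun.

Set Implicit Arguments.
Unset Strict Implicit.
Unset Printing Implicit Defensive.

Import Order.TTheory GRing.Theory Num.Theory.
Import numFieldNormedType.Exports.

Local Open Scope classical_set_scope.
Local Open Scope ring_scope.

HB.mixin Record isBorel d T & Topological T & Measurable d T := {
  borel_measurableE : (measurable : set (set T)) = <<s (open : set (set T)) >>
}.

#[short(type="completeBorelMetricType")]
HB.structure Definition CompleteBorelMetric d (R : realType) :=
  { T of Metric R T & Complete T & Measurable d T & isBorel d T }.

Section curves.
Context {R : realType} {X : metricType R}.
Implicit Types (rho : X -> X -> R) (gamma : R -> X) (x y : X) (s t l : R).

(* The analogue of [realfun.variation] for a curve: the partition
   s < p_0 < ... < p_k = t of [s, t] is given by the list p, and only the
   values of gamma on [s, t] matter. *)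
Definition curve_variation rho s t gamma (p : seq R) : R :=
  \sum_(0 <= i < size p)
    rho (gamma (nth t (s :: p) i)) (gamma (nth t (s :: p) i.+1)).

Definition curve_length rho s t gamma : \bar R :=
  ereal_sup [set (curve_variation rho s t gamma p)%:E
            | p in [set p | itv_partition s t p]].

Definition joins gamma x y : Prop :=
  [/\ {within `[0, 1], continuous gamma}, gamma 0 = x & gamma 1 = y].

Definition arclength_parametrized l gamma : Prop :=
  [/\ 0 <= l, {within `[0, l], continuous gamma} &
      forall s t, 0 <= s -> s <= t -> t <= l ->
        curve_length (@mdist R X) s t gamma = (t - s)%:E].

End curves.

Section spaces.
Context {R : realType} (X : metricType R).

Definition separable_space : Prop :=
  exists2 A : set X, countable A & dense A.

Definition proper_space : Prop :=
  forall (x : X) (r : R), compact [set y | mdist x y <= r].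

Definition length_space : Prop :=
  forall x y : X, (mdist x y)%:E =
    ereal_inf [set curve_length (@mdist R X) 0 1 gamma
              | gamma in [set gamma | joins gamma x y]].

Definition is_distance (rho : X -> X -> R) : Prop :=
  [/\ forall x y, 0 <= rho x y,
      forall x y, rho x y = 0 <-> x = y,
      forall x y, rho x y = rho y x &
      forall x y z, rho x z <= rho x y + rho y z].

(* Curves are continuous for the topology of X, i.e., that of [mdist], even
   when their length is measured by another distance. *)
Definition geodesic_distance (rho : X -> X -> R) : Prop :=
  forall x y : X, exists2 gamma,
    joins gamma x y & curve_length rho 0 1 gamma = (rho x y)%:E.

End spaces.

Section gradients.
Context {R : realType} {X : metricType R}.
Implicit Types (rho : X -> X -> R) (f : X -> R).
Local Open Scope ereal_scope.

(* 0 is adjoined so that the supremum of the empty family is 0, not -oo. *)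
Definition difference_quotient_sup rho f (x : X) (r : R) : \bar R :=
  ereal_sup ([set 0] `|`
    [set (`|(f x - f y) / rho x y|%R)%:E | y in [set y | 0 < rho x y <= r]%R]).

Definition grad rho f (x : X) : \bar R :=
  lim (difference_quotient_sup rho f x r @[r --> 0%R^'+]).

Definition grad_norm rho f : \bar R := ereal_sup (range (grad rho f)).

Definition bounded_lipschitz f : Prop :=
  [bounded f x | x in [set: X]] /\
  exists L : R, forall x y, (`|f x - f y| <= L * mdist x y)%R.

End gradients.

Section measures.
Context {disp : measure_display} {R : realType}.
Context {X : completeBorelMetricType disp R}.
Local Open Scope ereal_scope.

Definition radon (v : {measure set X -> \bar R}) : Prop :=
  (forall K : set X, compact K -> v K < +oo) /\
  (forall A : set X, measurable A ->
     v A = ereal_sup [set v K | K in [set K | compact K /\ K `<=` A]]).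

Definition locally_L1 (v : {measure set X -> \bar R}) (f : X -> R) : Prop :=
  measurable_fun [set: X] f /\
  forall K : set X, compact K -> v.-integrable K (EFin \o f).

(* As usual, an upper gradient takes its values in [0, +oo]. *)
Definition upper_gradient (f : X -> R) (g : X -> \bar R) : Prop :=
  [/\ measurable_fun [set: X] f, measurable_fun [set: X] g,
      forall x, 0 <= g x &
      forall (l : R) (gamma : R -> X), arclength_parametrized l gamma ->
        (`|f (gamma l) - f (gamma 0)|%R)%:E
          <= \int[lebesgue_measure]_(s in `[0%R, l]) g (gamma s)].

Definition local_volume_doubling (v : {measure set X -> \bar R}) : Prop :=
  exists D R1 : R, [/\ (0 < D)%R, (0 < R1)%R &
    forall (x : X) (r : R), (0 < r < R1)%R ->
      v (ball x (2 * r)%R) <= D%:E * v (ball x r)].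

Definition ball_average (v : {measure set X -> \bar R}) (f : X -> R)
    (x : X) (r : R) : R :=
  ((fine (v (ball x r)))^-1 * \int[v]_(y in ball x r) f y)%R.

Definition local_poincare (v : {measure set X -> \bar R}) : Prop :=
  exists2 p0 : R, (1 <= p0)%R &
  forall R0 : R, (0 < R0)%R ->
  exists lam CP : R, [/\ (1 <= lam)%R, (0 < CP)%R &
    forall (f : X -> R) (g : X -> \bar R),
      locally_L1 v f -> upper_gradient f g ->
      forall (x : X) (r : R), (0 < r < R0)%R ->
        \int[v]_(y in ball x r) (`|f y - ball_average v f x r|%R)%:E
          <= (CP * r)%:E *
             (\int[v]_(y in ball x (lam * r)%R) (g y `^ p0)) `^ p0^-1].

(* The filter F on P(X) converges weakly to mu. *)
Definition weak_cvg (F : set_system (probability X R)) (mu : probability X R) :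
    Prop :=
  forall f : X -> R, continuous f -> [bounded f x | x in [set: X]] ->
    (\int[nu]_y f y)%R @[nu --> F] --> (\int[mu]_y f y)%R.

Definition weakly_continuous (P : X -> probability X R) : Prop :=
  forall x : X, weak_cvg (P x' @[x' --> x]) (P x).

Definition continuous_density (v : {measure set X -> \bar R})
    (P : X -> probability X R) : Prop :=
  (forall x, P x `<< v) /\
  exists rho : X -> X -> R,
    [/\ forall x, measurable_fun [set: X] (rho x),
        forall x y, (0 <= rho x y)%R,
        forall x (A : set X), measurable A ->
          P x A = \int[v]_(y in A) (rho x y)%:E &
        forall y, continuous (rho ^~ y)].

Definition Pop (P : X -> probability X R) (f : X -> R) (x : X) : R :=
  (\int[P x]_y f y)%R.

Definition Pstar (P : X -> probability X R) (mu : probability X R) :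
    set X -> \bar R :=
  fun A => \int[mu]_x P x A.

(* Stated for set functions so that it applies to [Pstar P mu] as it is. *)
Definition coupling (mu nu : set X -> \bar R) (pi : probability (X * X)%type R) :
    Prop :=
  forall A : set X, measurable A ->
    pi (A `*` [set: X]) = mu A /\ pi ([set: X] `*` A) = nu A.

Definition wasserstein (rho : X -> X -> R) (p : \bar R)
    (mu nu : set X -> \bar R) : \bar R :=
  ereal_inf [set 'N[pi]_p[(fun z => (rho z.1 z.2)%:E)]
            | pi in [set pi : probability (X * X)%type R | coupling mu nu pi]].

Definition wasserstein_control (dt : X -> X -> R) (P : X -> probability X R)
    (p : \bar R) : Prop :=
  forall mu nu : probability X R,
    wasserstein (@mdist R X) p (Pstar P mu) (Pstar P nu)
      <= wasserstein dt p mu nu.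

Definition gradient_estimate (dt : X -> X -> R) (P : X -> probability X R)
    (p : \bar R) : Prop :=
  (1 < p -> let q := fine (hoelder_conjugate p) in
     forall f : X -> R, bounded_lipschitz f -> forall x : X,
       grad dt (Pop P f) x
         <= (\int[P x]_y (grad (@mdist R X) f y `^ q)) `^ q^-1) /\
  (p = 1 -> forall f : X -> R, bounded_lipschitz f ->
     grad_norm dt (Pop P f) <= grad_norm (@mdist R X) f).

End measures.

(* Main.v *)
(* Controls to gradients: a plan between [P x] and [P y] whose cost is almost
   [dt x y] exists by the control for Dirac masses. Integrating
   [|f z - f w| <= G z * d z w] against it, where [G] is the Lipschitz constant of
   [f] at a small scale, and using Hoelder's inequality bounds the gradient of
   [Pop P f]; then the scale tends to 0.

   Gradients to controls: by Kantorovich duality it suffices to show that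
   [0 <= phi z + psi w + t * d z w ^ p] for all [z] and [w] implies the same
   inequality for [Pop P phi], [Pop P psi] and [dt]. One follows
   [P (Q_s psi)], where [Q_s] is the Hopf-Lax semigroup, along a [dt]-geodesic.
   The decrease in time of [Q_s psi] at [z] dominates the [q]-th power of its
   local Lipschitz constant at [z], because both are controlled by the distance
   of [z] to the almost optimal points of the Hopf-Lax formula; this and Young's
   inequality bound the growth along the geodesic. Since the densities are
   continuous in [x], [P] is strongly Feller, so that the local Lipschitz constant
   can be integrated against kernels with a moving base point. For [p = +oo] one
   lets the exponent tend to infinity in the dual inequality.

   The duality is obtained from the Hahn-Banach theorem, which gives a finitely
   additive plan; its values on the products of the cells of a countable partition
   into small sets are the weights of a genuine plan with almost the same cost. *)

Require Import Defs.
From HB Require Import structures.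
From mathcomp Require Import all_boot all_order all_algebra.
From mathcomp Require Import all_classical all_reals all_analysis.
From mathcomp Require Import measurable_realfun giry ess_sup_inf.
From mathcomp Require Import lra ring.

Set Implicit Arguments.
Unset Strict Implicit.
Unset Printing Implicit Defensive.

Import Order.TTheory GRing.Theory Num.Theory.
Import numFieldNormedType.Exports.

Local Open Scope classical_set_scope.
Local Open Scope ring_scope.

(** * The Hahn-Banach theorem *)

(** Plans that are optimal only up to an arbitrary error suffice, because the Wasserstein distance
    is an infimum. This is why duality can be run with a cost that is neither bounded nor
    continuous: for [p = +oo] the cost is the indicator of [m' < mdist z w]. The multiplier [t] in
    the dual inequality is what lets a functional on bounded functions deal with an unbounded cost.
    Nothing is differentiated along the geodesic. The Hopf-Lax function has no usable minimizers or
    derivatives here, but its difference quotients in time are continuous in space, being built from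
    two Lipschitz functions. So finite increments are estimated up to an arbitrarily small error per
    unit of time, and a continuous induction adds them up. The Hopf-Lax function degenerates at time
    0, so the motion starts at a small positive time and runs slightly faster than the distance
    divided by 1; the excess disappears at the end. In the other direction, pairs of points that a
    plan moves far apart escape the local Lipschitz constant. Their contribution is of order
    [dt x y ^ p], negligible against [dt x y] when [p > 1]. *)

Section hahn_banach.
Context {R : realType} {V : lmodType R}.
Implicit Types B : set V.

Definition linear_subset B :=
  [/\ B 0, forall x y, B x -> B y -> B (x + y) & forall a x, B x -> B (a *: x)].

Definition sublinear_on B (p : V -> R) :=
  (forall x y, B x -> B y -> p (x + y) <= p x + p y) /\
  (forall a x, 0 < a -> B x -> p (a *: x) <= a * p x).

Lemma sublinear_onZ B p a x : linear_subset B -> sublinear_on B p ->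
  0 < a -> B x -> p (a *: x) = a * p x.
Proof.
move=> [B0 BD BZ] [pD pZ] a0 Bx; apply/eqP; rewrite eq_le pZ//=.
have := pZ a^-1 (a *: x) _ (BZ _ _ Bx).
rewrite invr_gt0 => /(_ a0); rewrite scalerA mulVf ?gt_eqF// scale1r.
by rewrite -ler_pdivlMl ?invr_gt0// invrK.
Qed.

Lemma sublinear_on0 B p : linear_subset B -> sublinear_on B p -> p 0 = 0.
Proof.
move=> sB sp; have [B0 _ _] := sB.
have := sublinear_onZ sB sp (@ltr0n R 2) B0.
by rewrite scaler0; lra.
Qed.

Lemma sublinear_on_geN B p x : linear_subset B -> sublinear_on B p -> B x ->
  - p (- x) <= p x.
Proof.
move=> sB sp Bx; have [_ _ BZ] := sB; have [pD _] := sp.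
have BNx : B (- x) by rewrite -scaleN1r; exact: BZ.
have := pD _ _ Bx BNx; rewrite subrr (sublinear_on0 sB sp); lra.
Qed.

(* A sublinear functional that is minimal below [q] is linear, since it
   coincides with the sublinear functional x |-> inf_t p (x + t y) - t p y. *)
Lemma hahn_banach B q : linear_subset B -> sublinear_on B q ->
  exists L : V -> R,
    [/\ forall x y, B x -> B y -> L (x + y) = L x + L y,
        forall a x, 0 < a -> B x -> L (a *: x) = a * L x &
        forall x, B x -> L x <= q x].
Proof.
move=> sB sq; have [B0 BD BZ] := sB.
have BN x : B x -> B (- x) by rewrite -scaleN1r; exact: BZ.
(* The functionals vanish off [B], so that those that agree on [B] are equal, as antisymmetry
   requires. The order [ge] is reversed: a maximal element for Zorn's lemma is a minimal
   functional. *)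
pose T := {p : V -> R | [/\ sublinear_on B p, forall x, B x -> p x <= q x &
                          forall x, ~ B x -> p x = 0]}.
pose ge (p1 p2 : T) := `[< forall x, B x -> sval p2 x <= sval p1 x >].
pose res (p : V -> R) x := if `[< B x >] then p x else 0.
have resE p x : B x -> res p x = p x by move=> Bx; rewrite /res asboolT.
have resN p x : ~ B x -> res p x = 0 by move=> Bx; rewrite /res asboolF.
have ressub p : sublinear_on B p -> sublinear_on B (res p).
  move=> [pD pZ]; split=> [x y Bx By|a x a0 Bx]; rewrite !resE//.
  - exact: pD.
  - exact: BD.
  - exact: pZ.
  - exact: BZ.
have q_sub : [/\ sublinear_on B (res q), forall x, B x -> res q x <= q x &
                 forall x, ~ B x -> res q x = 0].
  by split=> [|x Bx|x Bx]; [exact: ressub|rewrite resE|exact: resN].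
(* This lower bound, common to all members of [T], keeps the infimum of a chain finite. *)
have low p : sublinear_on B p -> (forall x, B x -> p x <= q x) ->
    forall x, B x -> - q (- x) <= p x.
  move=> sp pq x Bx; apply: le_trans (sublinear_on_geN sB sp Bx).
  by rewrite lerN2 pq//; exact: BN.
have [| | |A totA|m mmin] := @Zorn T ge.
- by move=> p; apply/asboolP.
- move=> p1 p2 p3 /asboolP h12 /asboolP h23; apply/asboolP => x Bx.
  by rewrite (le_trans (h23 _ Bx)) ?h12.
- move=> [f Pf] [g Pg] /asboolP /= h12 /asboolP /= h21.
  have fg : f = g.
    apply/funext => x; have [Bx|nBx] := pselect (B x).
      by apply/eqP; rewrite eq_le h12 ?h21.
    by case: (Pf) (Pg) => [_ _ f0] [_ _ g0]; rewrite f0 ?g0.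
  by subst g; congr exist; exact: Prop_irrelevance.
- have [->|/set0P[p0 Ap0]] := eqVneq A set0.
    by exists (exist _ (res q) q_sub : T).
  pose pinf x := inf [set sval p x | p in A].
  have hinf x : B x -> has_inf [set sval p x | p in A].
    move=> Bx; split; first by exists (sval p0 x), p0.
    exists (- q (- x)) => _ [p Ap <-]; case: p {Ap} => p [sp pq _] /=.
    exact: low.
  have pinf_le x (p : T) : B x -> A p -> pinf x <= sval p x.
    move=> Bx Ap; apply: ge_inf; first exact: (hinf x Bx).2.
    by exists p.
  have pinf_ge x r : B x -> (forall p, A p -> r <= sval p x) -> r <= pinf x.
    move=> Bx h; apply: lb_le_inf; first exact: (hinf x Bx).1.
    by move=> _ [p Ap <-]; exact: h.
  have pinf_sub : sublinear_on B pinf.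
    split=> [x y Bx By|a x a0 Bx].
      rewrite -lerBlDr; apply: (pinf_ge) => // p1 Ap1.
      rewrite lerBlDr -lerBlDl; apply: (pinf_ge) => // p2 Ap2.
      rewrite lerBlDl.
      (* Of two members of the chain, the smaller one can be used for both summands. *)
      have [/asboolP h|/asboolP h] := totA _ _ Ap1 Ap2.
        apply: (le_trans (pinf_le _ _ (BD _ _ Bx By) Ap2)).
        have := h x Bx; case: (p2) {h} => f [[fD _] _ _] /= h.
        by rewrite (le_trans (fD _ _ Bx By))// lerD2r.
      apply: (le_trans (pinf_le _ _ (BD _ _ Bx By) Ap1)).
      have := h y By; case: (p1) {h} => f [[fD _] _ _] /= h.
      by rewrite (le_trans (fD _ _ Bx By))// lerD2l.
    rewrite -ler_pdivrMl//; apply: (pinf_ge) => // p Ap.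
    rewrite ler_pdivrMl//.
    apply: (le_trans (pinf_le _ _ (BZ a _ Bx) Ap)).
    by case: (p) => f [[_ fZ] _ _] /=; exact: fZ.
  have pinf_T : [/\ sublinear_on B (res pinf),
      forall x, B x -> res pinf x <= q x & forall x, ~ B x -> res pinf x = 0].
    split=> [|x Bx|x Bx]; [exact: ressub| |exact: resN].
    rewrite resE//; apply: (le_trans (pinf_le _ _ Bx Ap0)).
    by case: (p0) => f [_ fq _] /=; exact: fq.
  exists (exist _ (res pinf) pinf_T : T) => p Ap; apply/asboolP => x Bx /=.
  by rewrite resE//; exact: pinf_le.
- have [pm [pmE sm mq m0]] : exists p, [/\ p = sval m, sublinear_on B p,
      forall x, B x -> p x <= q x & forall x, ~ B x -> p x = 0].
    by case: (m) => f [? ? ?]; exists f.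
  have [mD mZ] := sm.
  exists pm; split=> //; last first.
    by move=> a x a0 Bx; exact: (sublinear_onZ sB sm).
  move=> x0 y Bx0 By; apply/eqP; rewrite eq_le mD//=.
  pose py x := inf [set pm (x + t *: y) - t * pm y | t in [set t | 0 <= t]].
  have hinf x : B x ->
      has_inf [set pm (x + t *: y) - t * pm y | t in [set t : R | 0 <= t]].
    move=> Bx; split.
      by exists (pm (x + 0 *: y) - 0 * pm y), 0 => //=; rewrite lexx.
    exists (- pm (- x)) => _ [t /= t0 <-].
    have Bty : B (t *: y) by exact: BZ.
    have -> : t * pm y = pm (t *: y).
      move: t0; rewrite le_eqVlt => /predU1P[<-|t0].
        by rewrite mul0r scale0r (sublinear_on0 sB sm).
      by rewrite (sublinear_onZ sB sm).
    have := mD _ _ (BD _ _ Bx Bty) (BN _ Bx).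
    by rewrite addrAC subrr add0r; lra.
  have py_le x t : B x -> 0 <= t -> py x <= pm (x + t *: y) - t * pm y.
    move=> Bx t0; apply: ge_inf; first exact: (hinf x Bx).2.
    by exists t.
  have py_ge x r : B x ->
      (forall t, 0 <= t -> r <= pm (x + t *: y) - t * pm y) -> r <= py x.
    move=> Bx h; apply: lb_le_inf; first exact: (hinf x Bx).1.
    by move=> _ [t t0 <-]; exact: h.
  have py_m x : B x -> py x <= pm x.
    by move=> Bx; have := py_le x 0 Bx (lexx 0);
       rewrite scale0r addr0 mul0r subr0.
  have py_sub : sublinear_on B py.
    split=> [x z Bx Bz|a x a0 Bx].
      rewrite -lerBlDr; apply: (py_ge) => // t t0.
      rewrite lerBlDr -lerBlDl; apply: (py_ge) => // u u0.
      rewrite lerBlDl.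
      apply: (le_trans (py_le _ (t + u) (BD _ _ Bx Bz) (addr_ge0 t0 u0))).
      have := mD _ _ (BD _ _ Bx (BZ t _ By)) (BD _ _ Bz (BZ u _ By)).
      by rewrite addrACA -scalerDl mulrDl; lra.
    rewrite -ler_pdivrMl//; apply: (py_ge) => // t t0; rewrite ler_pdivrMl//.
    apply: (le_trans (py_le _ (a * t) (BZ a _ Bx) (mulr_ge0 (ltW a0) t0))).
    rewrite -scalerA -scalerDr (sublinear_onZ sB sm)//.
      by rewrite mulrBr mulrA.
    by apply: BD => //; exact: BZ.
  have py_T : [/\ sublinear_on B (res py),
      forall x, B x -> res py x <= q x & forall x, ~ B x -> res py x = 0].
    split=> [|x Bx|x Bx]; [exact: ressub| |exact: resN].
    by rewrite resE// (le_trans (py_m _ Bx)) ?mq.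
  have := mmin (exist _ (res py) py_T : T).
  have -> : ge m (exist _ (res py) py_T : T).
    by apply/asboolP => x Bx /=; rewrite resE// -pmE; exact: py_m.
  move=> /(_ isT) /(congr1 sval) /= epy.
  have : py x0 = pm x0 by rewrite -resE// epy -pmE.
  (* By minimality [py] is [pm], and the value [t = 1] in the infimum defining [py] gives the
     missing superadditivity. *)
  have := py_le x0 1 Bx0 ler01; rewrite scale1r mul1r; lra.
Qed.

End hahn_banach.

(** * Kantorovich duality *)

Section bounded_measurable.
Context {d} {T : measurableType d} {R : realType}.
Implicit Types (f g : T -> R) (mu : probability T R).

Definition bounded_measurable f :=
  measurable_fun [set: T] f /\ exists M : R, forall x, `|f x| <= M.

(* [probability_setT] does not rewrite terms in which [mu] is coerced to a
   measure. *)
Lemma probability_measure_setT mu :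
  ((mu : {measure set T -> \bar R}) [set: T] = 1)%E.
Proof. exact: probability_setT. Qed.

Lemma bounded_measurable_integrable mu f :
  bounded_measurable f -> mu.-integrable [set: T] (EFin \o f).
Proof.
move=> [mf [M fM]]; apply: measurable_bounded_integrable => //.
  by rewrite probability_measure_setT ltry.
exists M; split; first by rewrite num_real.
by move=> x Mx y _ /=; rewrite (le_trans (fM _))// ltW.
Qed.

Lemma bounded_measurable_cst (c : R) : bounded_measurable (cst c).
Proof. by split; [exact: measurable_cst|exists `|c|]. Qed.

Lemma bounded_measurableD f g : bounded_measurable f -> bounded_measurable g ->
  bounded_measurable (fun x => f x + g x).
Proof.
move=> [mf [M fM]] [mg [N gN]]; split; first exact: measurable_funD.
by exists (M + N) => x; rewrite (le_trans (ler_normD _ _))// lerD.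
Qed.

Lemma bounded_measurableZ (c : R) f : bounded_measurable f ->
  bounded_measurable (fun x => c * f x).
Proof.
move=> [mf [M fM]]; split; first by apply: measurable_funM => //; exact: measurable_cst.
by exists (`|c| * M) => x; rewrite normrM ler_wpM2l.
Qed.

Lemma bounded_measurableN f : bounded_measurable f ->
  bounded_measurable (fun x => - f x).
Proof.
move=> /(bounded_measurableZ (-1)); congr bounded_measurable.
by apply/funext => x; rewrite mulN1r.
Qed.

Lemma bounded_measurableB f g : bounded_measurable f -> bounded_measurable g ->
  bounded_measurable (fun x => f x - g x).
Proof. by move=> hf /bounded_measurableN; exact: bounded_measurableD. Qed.

Lemma bounded_measurable_indic (A : set T) : measurable A ->
  bounded_measurable (\1_A : T -> R).
Proof.
move=> mA; split; first exact: measurable_indic.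
by exists 1 => x; rewrite indicE; case: (_ \in _); rewrite ?normr1 ?normr0.
Qed.

Lemma bounded_integralD mu f g : bounded_measurable f -> bounded_measurable g ->
  \int[mu]_x (f x + g x) = \int[mu]_x f x + \int[mu]_x g x.
Proof. by move=> hf hg; rewrite RintegralD//; exact: bounded_measurable_integrable. Qed.

Lemma bounded_integralB mu f g : bounded_measurable f -> bounded_measurable g ->
  \int[mu]_x (f x - g x) = \int[mu]_x f x - \int[mu]_x g x.
Proof. by move=> hf hg; rewrite RintegralB//; exact: bounded_measurable_integrable. Qed.

Lemma bounded_integralZ mu (c : R) f : bounded_measurable f ->
  \int[mu]_x (c * f x) = c * \int[mu]_x f x.
Proof. by move=> hf; rewrite RintegralZl//; exact: bounded_measurable_integrable. Qed.

Lemma probability_Rintegral_cst mu (c : R) : \int[mu]_x c = c.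
Proof. by rewrite Rintegral_cst// probability_measure_setT mulr1. Qed.

Lemma le_bounded_integral mu f g : bounded_measurable f -> bounded_measurable g ->
  (forall x, f x <= g x) -> \int[mu]_x f x <= \int[mu]_x g x.
Proof.
by move=> hf hg fg; apply: le_Rintegral => //; exact: bounded_measurable_integrable.
Qed.

Lemma bounded_integral_indic mu (A : set T) : measurable A ->
  \int[mu]_x (\1_A x : R) = fine (mu A).
Proof. by move=> mA; rewrite /Rintegral integral_indic// setIT. Qed.

Lemma bounded_integral_EFin mu f : bounded_measurable f ->
  (\int[mu]_x f x)%:E = (\int[mu]_x (f x)%:E)%E.
Proof.
move=> hf; rewrite /Rintegral fineK//; apply: integrable_fin_num => //.
exact: bounded_measurable_integrable.
Qed.

Lemma bounded_integral_le_norm mu f (M : R) : bounded_measurable f ->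
  (forall x, `|f x| <= M) -> `|\int[mu]_x f x| <= M.
Proof.
move=> hf fM; rewrite ler_norml -(probability_Rintegral_cst mu (- M)).
rewrite -{2}(probability_Rintegral_cst mu M).
apply/andP; split; apply: le_bounded_integral => //;
  try exact: bounded_measurable_cst.
  by move=> x; have := fM x; rewrite ler_norml => /andP[].
by move=> x; have := fM x; rewrite ler_norml => /andP[].
Qed.

End bounded_measurable.

Section transport_functional.
Context {d} {T : measurableType d} {R : realType}.
Variables (mu nu : probability T R) (c : T -> T -> R) (C : R).
Hypothesis dual : forall (phi psi : T -> R) (t : R),
  bounded_measurable phi -> bounded_measurable psi -> 0 <= t ->
  (forall x y, 0 <= phi x + psi y + t * c x y) ->
  0 <= \int[mu]_x phi x + \int[nu]_x psi x + t * C.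

Let bounded : set (T * T -> R^o) := [set h | exists M : R, forall z, `|h z| <= M].

(** The cost [c] may be unbounded, so no functional is evaluated at it. It only enters the
    majorants, with a multiplier [t], and is charged at the price [C]. *)
Let majorants (h : T * T -> R) : set R :=
  [set r | exists phi psi t, [/\ bounded_measurable phi, bounded_measurable psi,
     0 <= t, forall z, h z <= phi z.1 + psi z.2 + t * c z.1 z.2 &
     r = \int[mu]_x phi x + \int[nu]_x psi x + t * C]].

(** The lower bound [- M] is the hypothesis [dual] for [phi + M], [psi] and [t], where [M] bounds
    [h]. *)
Let majorants_inf h : bounded h -> has_inf (majorants h).
Proof.
move=> [M hM]; split.
  exists (\int[mu]_x (cst M) x + \int[nu]_x (cst 0) x + 0 * C).
  exists (cst M), (cst 0), 0; split => //; try exact: bounded_measurable_cst.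
  move=> z /=; rewrite mul0r !addr0.
  by have := hM z; rewrite ler_norml => /andP[].
exists (- M) => _ [phi [psi [t [bphi bpsi t0 hle ->]]]].
have bM := @bounded_measurable_cst _ T R M.
have := dual (bounded_measurableD bphi bM) bpsi t0.
rewrite (bounded_integralD _ bphi bM) probability_Rintegral_cst.
have : forall x y, 0 <= phi x + M + psi y + t * c x y.
  move=> x y; have := hle (x, y); have := hM (x, y).
  by rewrite ler_norml /= => /andP[]; lra.
by move=> h0 /(_ h0); lra.
Qed.

(* [L] is a finitely additive transport plan with cost at most [C]: it is given
   by the Hahn-Banach theorem below the infimum of the majorants. *)
Lemma transport_functional : exists L : (T * T -> R) -> R,
  [/\ forall (g h : T * T -> R), (exists M : R, forall z, `|g z| <= M) ->
        (exists M : R, forall z, `|h z| <= M) ->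
        L (fun z => g z + h z) = L g + L h,
      forall (a : R) (h : T * T -> R), 0 < a -> (exists M : R, forall z, `|h z| <= M) ->
        L (fun z => a * h z) = a * L h &
      forall (h : T * T -> R) (phi psi : T -> R) (t : R),
        (exists M : R, forall z, `|h z| <= M) ->
        bounded_measurable phi -> bounded_measurable psi -> 0 <= t ->
        (forall z, h z <= phi z.1 + psi z.2 + t * c z.1 z.2) ->
        L h <= \int[mu]_x phi x + \int[nu]_x psi x + t * C].
Proof.
have sB : linear_subset bounded.
  split=> [|g h [M gM] [N hN]|a h [M hM]].
  - by exists 0 => z; rewrite normr0.
  - by exists (M + N) => z; rewrite (le_trans (ler_normD _ _))// lerD.
  - by exists (`|a| * M) => z; rewrite normrM ler_wpM2l.
have [B0 BD BZ] := sB.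
pose q (h : T * T -> R^o) := inf (majorants h).
have q_le h r : bounded h -> majorants h r -> q h <= r.
  by move=> bh hr; apply: ge_inf => //; exact: (majorants_inf bh).2.
have q_ge h r : bounded h -> (forall s, majorants h s -> r <= s) -> r <= q h.
  by move=> bh hr; apply: lb_le_inf => //; exact: (majorants_inf bh).1.
have sq : sublinear_on bounded q.
  split=> [g h bg bh|a h a0 bh].
    rewrite -lerBlDr; apply: (q_ge) => // _ [phi [psi [t [bphi bpsi t0 le1 ->]]]].
    rewrite lerBlDr -lerBlDl.
    apply: (q_ge) => // _ [phi' [psi' [t' [bphi' bpsi' t0' le2 ->]]]].
    rewrite lerBlDl; apply: q_le; first exact: BD.
    exists (fun x => phi x + phi' x), (fun x => psi x + psi' x), (t + t').
    split; [exact: bounded_measurableD|exact: bounded_measurableD|exact: addr_ge0| |].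
      move=> z; have := lerD (le1 z) (le2 z).
      by congr (_ <= _); ring.
    by rewrite !bounded_integralD//; lra.
  rewrite -ler_pdivrMl//; apply: (q_ge) => // _ [phi [psi [t [bphi bpsi t0 le1 ->]]]].
  rewrite ler_pdivrMl//; apply: q_le; first exact: BZ.
  exists (fun x => a * phi x), (fun x => a * psi x), (a * t).
  split; [exact: bounded_measurableZ|exact: bounded_measurableZ| | |].
  - by rewrite mulr_ge0// ltW.
  - by move=> z; rewrite -mulrA -!mulrDr; apply: ler_wpM2l; [exact: ltW|exact: le1].
  - by rewrite !bounded_integralZ//; lra.
have [L [LD LZ Lq]] := hahn_banach sB sq.
exists L; split=> [g h|a h|h phi psi t bh bphi bpsi t0 hle].
- exact: LD.
- exact: LZ.
- by apply: (le_trans (Lq _ bh)); apply: q_le => //; exists phi, psi, t.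
Qed.

End transport_functional.

(** * Genuine plans with prescribed masses on products of cells *)

Section plan_of_matrix.
Context {d} {T : measurableType d} {R : realType}.
Variables (mu nu : probability T R) (A : nat -> set T).
Hypothesis mA : forall i, measurable (A i).
Hypothesis tA : trivIset setT A.
Hypothesis UA : \bigcup_i A i = [set: T].
Variable w : nat -> nat -> R.
Hypothesis w_ge0 : forall i j, 0 <= w i j.
Hypothesis w_row : forall i, (\sum_(j <oo) (w i j)%:E)%E = mu (A i).
Hypothesis w_col : forall j, (\sum_(i <oo) (w i j)%:E)%E = nu (A j).
Local Open Scope ereal_scope.

Let m i : R := fine (mu (A i)).
Let n j : R := fine (nu (A j)).

Let mE i : mu (A i) = (m i)%:E.
Proof. by rewrite fineK// fin_num_measure. Qed.

Let nE j : nu (A j) = (n j)%:E.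
Proof. by rewrite fineK// fin_num_measure. Qed.

Let m_ge0 i : (0 <= m i)%R. Proof. by rewrite fine_ge0. Qed.
Let n_ge0 i : (0 <= n i)%R. Proof. by rewrite fine_ge0. Qed.

Let w_le_m i j : (w i j <= m i)%R.
Proof.
rewrite -lee_fin -mE -w_row; apply: le_trans (nneseries_lim_ge j.+1 _).
  by rewrite big_nat_recr//= leeDr// sume_ge0// => k _; rewrite lee_fin.
by move=> k _; rewrite lee_fin.
Qed.

Let w_le_n i j : (w i j <= n j)%R.
Proof.
rewrite -lee_fin -nE -w_col; apply: le_trans (nneseries_lim_ge i.+1 _).
  by rewrite big_nat_recr//= leeDr// sume_ge0// => k _; rewrite lee_fin.
by move=> k _; rewrite lee_fin.
Qed.

(* Since [x / 0 = 0], null cells get the weight 0. *)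
Let r i j : R := (w i j / (m i * n j))%R.

Let r_ge0 i j : (0 <= r i j)%R.
Proof. by rewrite divr_ge0// mulr_ge0. Qed.

(** If one of the two cells is null, the row or the column sum forces [w i j = 0], so the weight 0
    given to null cells is the right one. *)
Let rE i j : (r i j * (m i * n j) = w i j)%R.
Proof.
rewrite /r; have [mn0|mn0] := eqVneq (m i * n j)%R 0%R; last by rewrite divfK.
rewrite mn0 mulr0; apply/esym/eqP; rewrite eq_le w_ge0 andbT.
by move/eqP: mn0; rewrite mulf_eq0 => /orP[] /eqP <-.
Qed.

Let mAA i j : measurable (A i `*` A j).
Proof. exact: measurableX. Qed.

Let plan_block i j : {measure set (T * T) -> \bar R} :=
  mscale (NngNum (r_ge0 i j)) (mrestr (mu \x nu) (mAA i j)).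

Let plan_row i : {measure set (T * T) -> \bar R} := mseries (plan_block i) 0.

Let plan : {measure set (T * T) -> \bar R} := mseries plan_row 0.

Let planE S : plan S =
  \sum_(i <oo) \sum_(j <oo) (r i j)%:E * (mu \x nu) (S `&` A i `*` A j).
Proof. by []. Qed.

Let mu_partition S : measurable S -> \sum_(i <oo) mu (S `&` A i) = mu S.
Proof.
move=> mS; rewrite -measure_semi_bigcup//.
- by rewrite -setI_bigcupr UA setIT.
- by move=> i; exact: measurableI.
- exact: trivIset_setIl.
- by rewrite -setI_bigcupr UA setIT.
Qed.

Let nu_partition S : measurable S -> \sum_(i <oo) nu (S `&` A i) = nu S.
Proof.
move=> mS; rewrite -measure_semi_bigcup//.
- by rewrite -setI_bigcupr UA setIT.
- by move=> i; exact: measurableI.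
- exact: trivIset_setIl.
- by rewrite -setI_bigcupr UA setIT.
Qed.

Let plan_fst S : measurable S -> plan (S `*` [set: T]) = mu S.
Proof.
move=> mS; rewrite planE -mu_partition//; apply: eq_eseriesr => i _.
have mSAi : measurable (S `&` A i) by exact: measurableI.
have SAi : mu (S `&` A i) = (fine (mu (S `&` A i)))%:E.
  by rewrite fineK// fin_num_measure.
have SAm : (fine (mu (S `&` A i)) <= m i)%R.
  by rewrite fine_le ?fin_num_measure// le_measure ?inE.
(* The mass of [S] in the cell is written as a fraction of the mass of the cell, which is then
   expanded as the sum of its row. *)
have -> : mu (S `&` A i) = (fine (mu (S `&` A i)) / m i)%:E * mu (A i).
  rewrite mE -EFinM.
  have [m0|m0] := eqVneq (m i) 0%R; last by rewrite divfK.
  rewrite m0 mulr0 SAi; congr EFin.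
  by apply/eqP; rewrite eq_le fine_ge0// andbT -m0.
rewrite -w_row -nneseriesZl; last by move=> j _; rewrite lee_fin.
apply: eq_eseriesr => j _.
rewrite -setXI setTI product_measure1E//= SAi nE.
rewrite -!EFinM; congr EFin => /=.
rewrite -rE; have [m0|m0] := eqVneq (m i) 0%R.
  have -> : fine (mu (S `&` A i)) = 0%R.
    by apply/eqP; rewrite eq_le fine_ge0// andbT -m0.
  by rewrite !mul0r mulr0.
by field.
Qed.

Let plan_snd S : measurable S -> plan ([set: T] `*` S) = nu S.
Proof.
move=> mS; rewrite planE -nu_partition// nneseries_interchange; last first.
  by move=> i j; rewrite mule_ge0// lee_fin.
apply: eq_eseriesr => j _.
have mSAi : measurable (S `&` A j) by exact: measurableI.
have SAi : nu (S `&` A j) = (fine (nu (S `&` A j)))%:E.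
  by rewrite fineK// fin_num_measure.
have SAm : (fine (nu (S `&` A j)) <= n j)%R.
  by rewrite fine_le ?fin_num_measure// le_measure ?inE.
have -> : nu (S `&` A j) = (fine (nu (S `&` A j)) / n j)%:E * nu (A j).
  rewrite nE -EFinM.
  have [n0|n0] := eqVneq (n j) 0%R; last by rewrite divfK.
  rewrite n0 mulr0 SAi; congr EFin.
  by apply/eqP; rewrite eq_le fine_ge0// andbT -n0.
rewrite -w_col -nneseriesZl; last by move=> i _; rewrite lee_fin.
apply: eq_eseriesr => i _.
rewrite -setXI setTI product_measure1E//= SAi mE.
rewrite -!EFinM; congr EFin => /=.
rewrite -rE; have [n0|n0] := eqVneq (n j) 0%R.
  have -> : fine (nu (S `&` A j)) = 0%R.
    by apply/eqP; rewrite eq_le fine_ge0// andbT -n0.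
  by rewrite !(mul0r, mulr0).
by field.
Qed.

Let plan_setT : plan [set: T * T] = 1.
Proof. by rewrite -setXTT plan_fst// probability_measure_setT. Qed.

(** On the product of the cells [A i] and [A j], the plan is the product measure rescaled to the
    mass [w i j]. Within a cell the marginals are thus proportional to [mu] and [nu], and the row
    and column sums fix the factors. *)
Lemma plan_of_matrix : exists pi : probability (T * T)%type R,
  (forall S, measurable S ->
     pi (S `*` [set: T]) = mu S /\ pi ([set: T] `*` S) = nu S) /\
  (forall (h : T * T -> \bar R) (a : nat -> nat -> R),
     measurable_fun [set: T * T] h -> (forall z, 0 <= h z) ->
     (forall i j, 0 <= a i j)%R ->
     (forall i j x y, A i x -> A j y -> h (x, y) <= (a i j)%:E) ->
     \int[pi]_z h z <= \sum_(i <oo) \sum_(j <oo) (w i j * a i j)%:E).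
Proof.
pose pi : probability (T * T)%type R := HB.pack (plan : set (T * T) -> \bar R)
  (Measure.on plan) (Measure_isProbability.Build _ _ _ plan plan_setT).
exists pi; split=> [S mS|h a mh h0 a0 ha].
  by split; [exact: plan_fst|exact: plan_snd].
have -> : \int[pi]_z h z = \int[plan]_z h z by [].
rewrite /plan ge0_integral_measure_series//; apply: lee_nneseries => [i _ _|i _].
  exact: integral_ge0.
rewrite /plan_row ge0_integral_measure_series//.
apply: lee_nneseries => [j _ _|j _]; first exact: integral_ge0.
rewrite /plan_block ge0_integral_mscale//=.
pose mr : {measure set (T * T) -> \bar R} := mrestr (mu \x nu) (mAA i j).
(* The block does not charge the complement of its cell, so a bound of [h] on the cell is enough. *)
have mrC : mr (~` (A i `*` A j)) = 0.
  by rewrite /mr /= /mrestr setICl measure0.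
have -> : \int[mr]_z h z = \int[mr]_(z in A i `*` A j) h z.
  rewrite (ge0_negligible_integral _ _ _ _ mrC)//; last exact: measurableC.
  by rewrite setTD setCK.
have : \int[mr]_(z in A i `*` A j) h z <= \int[mr]_(z in A i `*` A j) (a i j)%:E.
  apply: ge0_le_integral => //.
  - exact: measurable_funTS.
  - by move=> [x y] [/= Ax Ay]; exact: ha.
have mrE : mr (A i `*` A j) = (m i * n j)%:E.
  by rewrite /mr /= /mrestr setIid product_measure1E//= mE nE -EFinM.
rewrite integral_cst// mrE.
move=> /(lee_wpmul2l _) => /(_ (r i j)%:E); rewrite lee_fin => /(_ (r_ge0 i j)).
move=> /le_trans; apply; rewrite -!EFinM lee_fin -rE.
by rewrite -subr_ge0 [X in (0 <= X)%R](_ : _ = 0%R)//; ring.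
Qed.

End plan_of_matrix.

(** * Finitely additive plans and their masses on products of cells *)

Section plan_functional.
Context {d} {T : measurableType d} {R : realType}.

Definition bounded_fun {S : Type} (h : S -> R) := exists M : R, forall z, `|h z| <= M.

(** A finitely additive coupling, tested on all bounded functions, measurable or not. Countable
    additivity is present only through the two marginals. *)
Record plan_functional (mu nu : probability T R) (L : (T * T -> R) -> R) : Prop :=
  PlanFunctional {
    plan_functionalD : forall g h, bounded_fun g -> bounded_fun h ->
      L (fun z => g z + h z) = L g + L h ;
    plan_functionalZ : forall a h, 0 <= a -> bounded_fun h ->
      L (fun z => a * h z) = a * L h ;
    plan_functional_ge0 : forall h, bounded_fun h -> (forall z, 0 <= h z) -> 0 <= L h ;
    plan_functional_fst : forall phi, bounded_measurable phi ->
      L (fun z => phi z.1) = \int[mu]_x phi x ;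
    plan_functional_snd : forall psi, bounded_measurable psi ->
      L (fun z => psi z.2) = \int[nu]_x psi x
  }.

Lemma plan_functional_sym mu nu L : plan_functional mu nu L ->
  plan_functional nu mu (fun h => L (fun z => h (z.2, z.1))).
Proof.
move=> [LD LZ L0 L1 L2].
have sw h : bounded_fun h -> bounded_fun (fun z : T * T => h (z.2, z.1)).
  by move=> [M hM]; exists M => z; exact: hM.
split=> [g h bg bh|a h a0 bh|h bh h0|phi bphi|psi bpsi].
- by rewrite LD//; exact: sw.
- by rewrite LZ//; exact: sw.
- by rewrite L0//; exact: sw.
- exact: L2.
- exact: L1.
Qed.

Lemma bounded_funD {S} (g h : S -> R) : bounded_fun g -> bounded_fun h ->
  bounded_fun (fun z => g z + h z).
Proof.
move=> [M gM] [N hN]; exists (M + N) => z.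
by rewrite (le_trans (ler_normD _ _))// lerD.
Qed.

Lemma bounded_funZ {S} (a : R) (h : S -> R) : bounded_fun h ->
  bounded_fun (fun z => a * h z).
Proof. by move=> [M hM]; exists (`|a| * M) => z; rewrite normrM ler_wpM2l. Qed.

Lemma bounded_fun_sum {S} (h : nat -> S -> R) n : (forall k, bounded_fun (h k)) ->
  bounded_fun (fun z => \sum_(0 <= k < n) h k z).
Proof.
move=> bh; elim: n => [|n IH].
  by exists 0 => z; rewrite big_geq// normr0.
have [M hM] := bounded_funD IH (bh n).
by exists M => z; rewrite big_nat_recr//=.
Qed.

Section facts.
Variables (mu nu : probability T R) (L : (T * T -> R) -> R).
Hypothesis pL : plan_functional mu nu L.

Let LD := plan_functionalD pL.
Let LZ := plan_functionalZ pL.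
Let L0 := plan_functional_ge0 pL.

Lemma plan_functional_le g h : bounded_fun g -> bounded_fun h ->
  (forall z, g z <= h z) -> L g <= L h.
Proof.
move=> bg bh gh; have bN : bounded_fun (fun z => -1 * g z) by exact: bounded_funZ.
have -> : h = (fun z => g z + (h z + -1 * g z)).
  by apply/funext => z; ring.
rewrite LD//; last exact: bounded_funD.
rewrite lerDl; apply: L0; first exact: bounded_funD.
by move=> z; have := gh z; lra.
Qed.

Lemma plan_functional_sum (h : nat -> T * T -> R) n :
  (forall k, bounded_fun (h k)) ->
  L (fun z => \sum_(0 <= k < n) h k z) = \sum_(0 <= k < n) L (h k).
Proof.
move=> bh; elim: n => [|n IH].
  have b0 : bounded_fun (fun _ : T * T => 0 : R) by exists 0 => z; rewrite normr0.
  have -> : (fun z => \sum_(0 <= k < 0) h k z) = (fun z => 0 * (fun=> 0 : R) z).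
    by apply/funext => z; rewrite big_geq// mul0r.
  by rewrite LZ// mul0r big_geq.
rewrite big_nat_recr//= -IH -LD//; last exact: bounded_fun_sum.
by congr L; apply/funext => z; rewrite big_nat_recr.
Qed.

End facts.

Variable A : nat -> set T.
Hypothesis mA : forall i, measurable (A i).
Hypothesis tA : trivIset setT A.
Hypothesis UA : \bigcup_i A i = [set: T].

Definition cell_indic i j (z : T * T) : R := \1_(A i) z.1 * \1_(A j) z.2.

Lemma bounded_cell_indic i j : bounded_fun (cell_indic i j).
Proof.
exists 1 => z; rewrite /cell_indic !indicE.
by do 2 case: (_ \in _); rewrite ?mulr1 ?mulr0 ?normr1 ?normr0.
Qed.

Lemma cell_index (y : T) : exists k : nat, forall j, (\1_(A j) y : R) = (j == k)%:R.
Proof.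
have [k _ Aky] : (\bigcup_i A i) y by rewrite UA.
exists k => j; rewrite indicE; have [->|jk] := eqVneq j k.
  by rewrite mem_set.
rewrite memNset// => Ajy; move/trivIsetP : tA => /(_ j k Logic.I Logic.I jk).
by apply/eqP/set0P; exists y.
Qed.

Lemma sum_cell_index (a : nat -> R) (k n : nat) :
  \sum_(0 <= j < n) a j * (j == k)%:R = a k * (k < n)%:R.
Proof.
elim: n => [|n IH]; first by rewrite big_geq// ltn0 mulr0.
rewrite big_nat_recr//= IH ltnS; have [->|kn] := eqVneq n k.
  by rewrite ltnn leqnn mulr0 add0r mulr1.
by rewrite mulr0 addr0 (leq_eqVlt k n) [k == n]eq_sym (negbTE kn).
Qed.

(** Finite additivity alone would allow mass to be lost in a countable sum. But the part of row [i]
    outside the first [n] columns has at most the [nu]-mass outside the first [n] cells, which tends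
    to 0 because [nu] is countably additive. *)
Lemma plan_functional_row mu nu L i : plan_functional mu nu L ->
  (\sum_(j <oo) (L (cell_indic i j))%:E)%E = mu (A i).
Proof.
move=> pL; apply/cvg_lim => //.
have -> : mu (A i) = (fine (mu (A i)))%:E by rewrite fineK// fin_num_measure.
under eq_fun do rewrite sumEFin.
apply: cvg_EFin; first exact: nearW.
rewrite (_ : fine \o _ = fun n => \sum_(0 <= j < n) L (cell_indic i j)); last first.
  by apply/funext.
have bi : bounded_measurable (\1_(A i) : T -> R) by exact: bounded_measurable_indic.
have bfi : bounded_fun (fun z : T * T => \1_(A i) z.1 : R).
  by case: bi => _ [M hM]; exists M => z; exact: hM.
have LAi : L (fun z => \1_(A i) z.1) = fine (mu (A i)).
  by rewrite (plan_functional_fst pL)// bounded_integral_indic.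
pose s n (y : T) : R := \sum_(0 <= j < n) \1_(A j) y.
have s01 n y : 0 <= s n y <= 1.
  have [k kE] := cell_index y; rewrite /s.
  rewrite (eq_bigr (fun j => 1 * (j == k)%:R)); last by move=> j _; rewrite kE mul1r.
  by rewrite sum_cell_index mul1r; case: (_ < _)%N; rewrite ?lexx ler01.
have bs n : bounded_measurable (s n).
  rewrite /s; elim: n => [|n IH].
    rewrite (_ : (fun y => _) = cst 0); first exact: bounded_measurable_cst.
    by apply/funext => y; rewrite big_geq.
  rewrite (_ : (fun y => _) = fun y => \sum_(0 <= j < n) \1_(A j) y + \1_(A n) y).
    by apply: bounded_measurableD => //; exact: bounded_measurable_indic.
  by apply/funext => y; rewrite big_nat_recr.
have int_s n : \int[nu]_y s n y = \sum_(0 <= j < n) fine (nu (A j)).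
  elim: n => [|n IH].
    rewrite big_geq// -(probability_Rintegral_cst nu 0); apply: eq_Rintegral => y _.
    by rewrite /s big_geq.
  rewrite big_nat_recr//= -IH -bounded_integral_indic// -bounded_integralD//.
    by apply: eq_Rintegral => y _; rewrite /s big_nat_recr.
  exact: bounded_measurable_indic.
have bfs n : bounded_fun (fun z : T * T => \1_(A i) z.1 * s n z.2).
  exists 1 => z; have /andP[s0 s1] := s01 n z.2.
  rewrite normrM (ger0_norm s0) indicE.
  by case: (_ \in _); rewrite ?normr1 ?normr0 ?mul1r ?mul0r.
have Ls n : L (fun z => \1_(A i) z.1 * s n z.2) = \sum_(0 <= j < n) L (cell_indic i j).
  rewrite -(plan_functional_sum pL) => [|j]; last exact: bounded_cell_indic.
  by congr L; apply/funext => z; rewrite /s mulr_sumr.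
have cvg_nu : (\sum_(0 <= j < n) fine (nu (A j))) @[n --> \oo] --> (1 : R).
  have : (\sum_(0 <= j < n) nu (A j))%E @[n --> \oo] --> nu (\bigcup_j A j).
    by apply: measure_semi_sigma_additive => //; rewrite UA.
  rewrite UA probability_measure_setT.
  under eq_fun do under eq_bigr do rewrite -(@fineK _ (nu _)) ?fin_num_measure//.
  under eq_fun do rewrite sumEFin.
  by move/fine_cvg.
apply: (@squeeze_cvgr _ _ _ _
  (fun n => fine (mu (A i)) - (1 - \sum_(0 <= j < n) fine (nu (A j))))
  (cst (fine (mu (A i))))); last 2 first.
- rewrite -[X in _ --> X]subr0; apply: cvgB; first exact: cvg_cst.
  by rewrite -[X in _ --> X](subrr 1); apply: cvgB => //; exact: cvg_cst.
- exact: cvg_cst.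
apply: nearW => n; rewrite -Ls; apply/andP; split; last first.
  rewrite -LAi /=; apply: (plan_functional_le pL) => // z.
  by have /andP[s0 s1] := s01 n z.2; rewrite ler_piMr// indicE; case: (_ \in _).
rewrite -int_s -(probability_Rintegral_cst nu 1) -bounded_integralB//; last first.
  exact: bounded_measurable_cst.
have b1s : bounded_measurable (fun y => 1 - s n y).
  by apply: bounded_measurableB => //; exact: bounded_measurable_cst.
have bf1s : bounded_fun (fun z : T * T => 1 - s n z.2).
  by case: b1s => _ [M hM]; exists M => z; exact: hM.
rewrite lerBlDr -LAi -(plan_functional_snd pL)// -(plan_functionalD pL)//.
apply: (plan_functional_le pL) => //; first exact: bounded_funD.
move=> z; have /andP[s0 s1] := s01 n z.2; rewrite indicE.
by case: (_ \in _) => /=; lra.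
Qed.

Lemma plan_functional_ge_sum mu nu L (a : nat -> nat -> R) (C : R) :
  plan_functional mu nu L -> (forall i j, 0 <= a i j) ->
  (forall n, L (fun z => \sum_(0 <= i < n) \sum_(0 <= j < n)
     a i j * cell_indic i j z) <= C) ->
  (\sum_(i <oo) \sum_(j <oo) (L (cell_indic i j) * a i j)%:E <= C%:E)%E.
Proof.
move=> pL a0 hC.
have w0 i j : 0 <= L (cell_indic i j).
  apply: (plan_functional_ge0 pL); first exact: bounded_cell_indic.
  by move=> z; rewrite /cell_indic !indicE mulr_ge0.
have wa0 i j : (0 <= (L (cell_indic i j) * a i j)%:E)%E by rewrite lee_fin mulr_ge0.
have bca i j : bounded_fun (fun z => a i j * cell_indic i j z).
  by apply: bounded_funZ; exact: bounded_cell_indic.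
apply: lime_le.
  by apply: is_cvg_nneseries => i _ _; exact: nneseries_ge0.
apply: nearW => n; rewrite -nneseries_sum_nat//.
apply: lime_le.
  by apply: is_cvg_nneseries => i _ _; exact: sume_ge0.
apply: nearW => m.
(* Partial sums of the iterated series run over rectangles. The terms are nonnegative, so the
   rectangle can be enlarged to a square, where the hypothesis applies. *)
apply: (@le_trans _ _ (\sum_(0 <= j < maxn n m) \sum_(0 <= i < maxn n m)
    (L (cell_indic i j) * a i j)%:E)%E).
  rewrite [leRHS](@big_cat_nat _ _ _ m)//= ?leq_maxr//.
  apply: le_trans (leeDl _ _); last by apply: sume_ge0 => j _; exact: sume_ge0.
  apply: lee_sum => j _.
  rewrite [leRHS](@big_cat_nat _ _ _ n)//= ?leq_maxl//.
  by rewrite leeDl// sume_ge0.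
set N := maxn n m; rewrite exchange_big /=.
under eq_bigr do rewrite sumEFin.
rewrite sumEFin lee_fin; apply: le_trans (hC N).
rewrite (plan_functional_sum pL); last by move=> i; exact: bounded_fun_sum.
apply: ler_sum => i _; rewrite (plan_functional_sum pL)//.
apply: ler_sum => j _; rewrite (plan_functionalZ pL)//; last exact: bounded_cell_indic.
by rewrite mulrC.
Qed.

End plan_functional.

(** * Measurability on products of separable spaces, and almost optimal plans *)

Section borel_metric.
Context {disp : measure_display} {R : realType}.
Context {X : completeBorelMetricType disp R}.

Lemma borel_open_measurable (U : set X) : open U -> measurable U.
Proof. by move=> oU; rewrite borel_measurableE; exact: sub_sigma_algebra. Qed.

Lemma nbhs_mdistP (x : X) (A : set X) :
  nbhs x A <-> exists2 e : R, 0 < e & forall y, mdist x y < e -> A y.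
Proof.
split=> [/nbhs_ballP[e /= e0 eA]|[e e0 eA]].
  by exists e => // y xy; apply: eA; rewrite ballEmdist.
by apply/nbhs_ballP; exists e => //= y; rewrite ballEmdist /=; exact: eA.
Qed.

Lemma mball_open (x : X) (e : R) : open [set y | mdist x y < e].
Proof.
rewrite openE => y /= xy; apply/nbhs_mdistP; exists (e - mdist x y).
  by rewrite subr_gt0.
by move=> z yz /=; apply: le_lt_trans (metric_triangle _ y _) _; lra.
Qed.

Lemma lower_semicontinuous_borel_measurable (f : X -> \bar R) :
  (forall a : \bar R, open [set x | (a < f x)%E]) -> measurable_fun [set: X] f.
Proof.
move=> of_; apply: (measurability _ (ErealGenOInfty.measurableE R)).
move=> /= _ [_ [a ->]] <-; apply: measurableI => //; apply: borel_open_measurable.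
by rewrite preimage_itvoy; exact: of_.
Qed.

Lemma continuous_borel_measurable (f : X -> R) : continuous f ->
  measurable_fun [set: X] f.
Proof.
move=> cf; apply: (measurability _ (RGenOpens.measurableE R)).
move=> /= _ [_ [a [b ->]] <-]; apply: measurableI => //.
apply: borel_open_measurable; apply: open_comp; last exact: interval_open.
by move=> x _; exact: cf.
Qed.

Lemma dense_sequence (x0 : X) : separable_space X ->
  exists a : nat -> X, forall x (e : R), 0 < e -> exists k, mdist x (a k) < e.
Proof.
move=> [A cA dA]; have [f finj] := countable_injP _ cA.
pose a n := xget x0 [set x | A x /\ f x = n].
exists a => x e e0.
have [y [/= xy Ay]] : [set y | mdist x y < e] `&` A !=set0.
  apply: dA; last exact: mball_open.
  by exists x => /=; rewrite mdistxx.
exists (f y); have [Az fz] : [set x | A x /\ f x = f y] (a (f y)).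
  by apply: (xgetPex x0); exists y.
by rewrite (finj _ _ (mem_set Az) (mem_set Ay) fz).
Qed.

Lemma small_partition (x0 : X) (e : R) : separable_space X -> 0 < e ->
  exists A : nat -> set X, [/\ forall i, measurable (A i), trivIset setT A,
    \bigcup_i A i = [set: X] &
    forall i x y, A i x -> A i y -> mdist x y < e].
Proof.
move=> sX e0; have [a da] := dense_sequence x0 sX.
pose B i := [set x | mdist (a i) x < e / 2].
have mB i : measurable (B i) by exact/borel_open_measurable/mball_open.
exists (seqDU B); split.
- exact: seqDU_measurable.
- exact: trivIset_seqDU.
- rewrite -seqDU_bigcup_eq; apply/seteqP; split => // x _.
  have [k xk] := da x _ (divr_gt0 e0 (@ltr0n R 2)).
  by exists k => //; rewrite /B /= metric_sym.
- move=> i x y sx sy.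
  have Bx : B i x by exact: subset_seqDU sx.
  have By : B i y by exact: subset_seqDU sy.
  apply: le_lt_trans (metric_triangle _ (a i) _) _.
  by rewrite [ltRHS]splitr ltrD// metric_sym.
Qed.

(** Measurability on [X * X] refers to the product sigma-algebra. By separability an open set is the
    countable union of the products of balls that it contains, with centres in a dense sequence and
    radii [n.+1%:R^-1]. *)
Lemma open_product_measurable (x0 : X) (U : set (X * X)) : separable_space X ->
  open U -> measurable U.
Proof.
move=> sX oU; have [a da] := dense_sequence x0 sX.
pose B n k : set X := [set x | mdist (a k) x < n.+1%:R^-1].
have mB n k : measurable (B n k) by exact/borel_open_measurable/mball_open.
pose C n k l := if `[< B n k `*` B n l `<=` U >] then B n k `*` B n l else set0.
have mC n k l : measurable (C n k l).
  by rewrite /C; case: ifPn => // _; exact: measurableX.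
have -> : U = \bigcup_n \bigcup_k \bigcup_l C n k l.
  apply/seteqP; split=> [[x y] Uxy|z [n _ [k _ [l _]]]]; last first.
    by rewrite /C; case: ifPn => // /asboolP; exact.
  have [e /= e0 eU] : exists2 e : R, 0 < e & ball (x, y) e `<=` U.
    by have /nbhs_ballP[e e0 eU] := open_nbhs_nbhs (conj oU Uxy); exists e.
  have [n ne] : exists n, n.+1%:R^-1 + n.+1%:R^-1 < e.
    have [n _ nP] := near_infty_natSinv_lt (PosNum (divr_gt0 e0 (@ltr0n R 2))).
    exists n; have := nP n (leqnn n) => /=; rewrite [e in X in _ -> X]splitr.
    by move=> h; exact: ltrD.
  have n0 : 0 < n.+1%:R^-1 :> R by rewrite invr_gt0.
  have [k xk] := da x _ n0.
  have [l yl] := da y _ n0.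
  exists n => //; exists k => //; exists l => //; rewrite /C ifT.
    by split; rewrite /B /= metric_sym.
  apply/asboolP => -[x' y'] [/= xx' yy']; apply: eU.
  split => /=; rewrite ballEmdist /=; apply: lt_trans ne.
    by apply: le_lt_trans (metric_triangle _ (a k) _) (ltrD xk xx').
  by apply: le_lt_trans (metric_triangle _ (a l) _) (ltrD yl yy').
by do 3 (apply: bigcupT_measurable => ?).
Qed.

Lemma continuous_product_measurable (x0 : X) (f : X * X -> R) :
  separable_space X -> continuous f -> measurable_fun [set: X * X] f.
Proof.
move=> sX cf; apply: (measurability _ (RGenOpens.measurableE R)).
move=> /= _ [_ [a [b ->]] <-]; apply: measurableI => //.
apply: (open_product_measurable x0 sX); apply: open_comp; last exact: interval_open.
by move=> x _; exact: cf.
Qed.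

Lemma continuous_mdist : continuous (fun z : X * X => mdist z.1 z.2).
Proof.
move=> [x y]; apply/cvgrPdist_lt => e e0 /=.
have e2 : 0 < e / 2 by rewrite divr_gt0.
exists (ball x (e / 2), ball y (e / 2)) => /=.
  by split; exact: nbhsx_ballx.
move=> [x' y'] [/=]; rewrite !ballEmdist /= => xx' yy'.
have h1 := metric_triangle x x' y; have h2 := metric_triangle x' y' y.
have h3 := metric_triangle x' x y'; have h4 := metric_triangle x y y'.
rewrite (metric_sym x' x) in h3; rewrite (metric_sym y' y) in h2.
rewrite [e]splitr ltr_norml; lra.
Qed.

(** The plan only remembers the masses of products of cells of mesh [e]. Its cost is therefore
    bounded for the integrands [h] that stay below [c] after any displacement smaller than [e],
    which suits discontinuous costs too. *)
Lemma kantorovich_coupling (mu nu : probability X R) (c : X -> X -> R) (C e : R) :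
  separable_space X ->
  (forall x y, 0 <= c x y) -> 0 <= C ->
  (forall (phi psi : X -> R) (t : R),
    bounded_measurable phi -> bounded_measurable psi -> 0 <= t ->
    (forall x y, 0 <= phi x + psi y + t * c x y) ->
    0 <= \int[mu]_x phi x + \int[nu]_x psi x + t * C) ->
  0 < e ->
  exists pi : probability (X * X)%type R, coupling mu nu pi /\
    forall h : X * X -> \bar R, measurable_fun [set: X * X] h ->
      (forall z, (0 <= h z)%E) ->
      (forall x y x' y', mdist x x' < e -> mdist y y' < e ->
         (h (x, y) <= (c x' y')%:E)%E) ->
      (\int[pi]_z h z <= C%:E)%E.
Proof.
move=> sX c0 C0 dual e0.
have [x0 _] : [set: X] !=set0.
  apply/set0P/eqP => X0; have := probability_setT mu; rewrite X0 measure0.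
  by move/eqP; rewrite eq_sym onee_eq0.
have [A [mA tA UA dA]] := small_partition x0 sX e0.
have [L [LD LZ Lle]] := transport_functional dual.
have b0 := @bounded_measurable_cst _ X R 0.
have L00 : L (fun=> 0) = 0.
  have := @LZ 2 (fun=> 0) (ltr0Sn R 1); rewrite mulr0; move=> h.
  have : exists M : R, forall z : X * X, `|(fun=> 0 : R) z| <= M.
    by exists 0 => z; rewrite normr0.
  by move/h; lra.
have bN (h : X * X -> R) : bounded_fun h -> bounded_fun (fun z => - h z).
  by move=> [M hM]; exists M => z; rewrite normrN.
have LN h : bounded_fun h -> L (fun z => - h z) = - L h.
  move=> bh; have := LD _ _ bh (bN _ bh).
  have -> : (fun z => h z + - h z) = fun=> 0 by apply/funext => z; exact: subrr.
  by rewrite L00; lra.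
have pL : plan_functional mu nu L.
  split=> [g h|a h|h bh h0|phi bphi|psi bpsi].
  - exact: LD.
  - rewrite le_eqVlt => /predU1P[<-|a0] bh; last exact: LZ.
    rewrite mul0r -[RHS]L00; congr L; apply/funext => z; exact: mul0r.
  - have := Lle _ _ _ 0 (bN _ bh) b0 b0 (lexx 0).
    rewrite LN// !probability_Rintegral_cst mul0r !addr0 oppr_le0; apply.
    by move=> z; rewrite mul0r !addr0 oppr_le0.
  - have bf : bounded_fun (fun z : X * X => phi z.1).
      by case: bphi => _ [M hM]; exists M => z; exact: hM.
    apply/eqP; rewrite eq_le; apply/andP; split.
      have := Lle _ _ _ 0 bf bphi b0 (lexx 0).
      rewrite probability_Rintegral_cst mul0r !addr0; apply => z.
      by rewrite mul0r !addr0.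
    have := Lle _ _ _ 0 (bN _ bf) (bounded_measurableN bphi) b0 (lexx 0).
    have -> : \int[mu]_x (- phi x) = - \int[mu]_x phi x.
      rewrite -mulN1r -bounded_integralZ//; apply: eq_Rintegral => x _.
      by rewrite mulN1r.
    rewrite LN// probability_Rintegral_cst mul0r !addr0 lerN2; apply => z.
    by rewrite mul0r !addr0.
  - have bf : bounded_fun (fun z : X * X => psi z.2).
      by case: bpsi => _ [M hM]; exists M => z; exact: hM.
    apply/eqP; rewrite eq_le; apply/andP; split.
      have := Lle _ _ _ 0 bf b0 bpsi (lexx 0).
      rewrite probability_Rintegral_cst mul0r addr0 add0r; apply => z.
      by rewrite mul0r addr0 add0r.
    have := Lle _ _ _ 0 (bN _ bf) b0 (bounded_measurableN bpsi) (lexx 0).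
    have -> : \int[nu]_x (- psi x) = - \int[nu]_x psi x.
      rewrite -mulN1r -bounded_integralZ//; apply: eq_Rintegral => x _.
      by rewrite mulN1r.
    rewrite LN// probability_Rintegral_cst mul0r addr0 add0r lerN2; apply => z.
    by rewrite mul0r addr0 add0r.
have w0 i j : 0 <= L (cell_indic A i j).
  apply: (plan_functional_ge0 pL); first exact: bounded_cell_indic.
  by move=> z; rewrite /cell_indic !indicE mulr_ge0.
have row i : (\sum_(j <oo) (L (cell_indic A i j))%:E)%E = mu (A i).
  exact: (plan_functional_row mA tA UA i pL).
have col j : (\sum_(i <oo) (L (cell_indic A i j))%:E)%E = nu (A j).
  rewrite -(plan_functional_row mA tA UA j (plan_functional_sym pL)).
  apply: eq_eseriesr => i _; congr (L _)%:E; apply/funext => z.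
  by rewrite /cell_indic mulrC.
have [pi [piM piI]] := plan_of_matrix mA tA UA w0 row col.
exists pi; split=> // h mh h0 hc.
(* As an infimum, [a] is a step function below [c], so the functional charges it at most [C] (take
   zero potentials and [t = 1]); as the mesh is [e], it is above [h]. For an empty cell the infimum
   is 0 by convention. *)
pose a i j := inf [set r | exists x y, [/\ A i x, A j y & r = c x y]].
have a0 i j : 0 <= a i j.
  rewrite /a; set S := [set r | _]; have [->|/set0P S0] := eqVneq S set0.
    by rewrite inf0.
  by apply: lb_le_inf => // _ [x [y [_ _ ->]]].
apply: (le_trans (piI h a mh h0 a0 _)).
  move=> i j x y Aix Ajy.
  have hx : h (x, y) \is a fin_num.
    rewrite ge0_fin_numE//; apply: le_lt_trans (hc x y x y _ _) (ltry _);
    by rewrite mdistxx.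
  rewrite -(fineK hx) lee_fin; apply: lb_le_inf; first by exists (c x y), x, y.
  move=> _ [x' [y' [Aix' Ajy' ->]]]; rewrite -lee_fin fineK//.
  by apply: hc; [exact: (dA i)|exact: (dA j)].
apply: (plan_functional_ge_sum pL a0) => n.
have := Lle (fun z => \sum_(0 <= i < n) \sum_(0 <= j < n) a i j * cell_indic A i j z)
  (cst 0) (cst 0) 1 _ b0 b0 ler01.
rewrite !probability_Rintegral_cst !add0r mul1r; apply.
  do 2 (apply: bounded_fun_sum => ?); apply: bounded_funZ.
  exact: bounded_cell_indic.
move=> z /=; rewrite add0r mul1r.
have [k kE] := cell_index (R := R) tA UA z.1.
have [l lE] := cell_index (R := R) tA UA z.2.
have Ak : A k z.1.
  apply: contrapT => nA; have := kE k; rewrite indicE memNset// eqxx.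
  by move/eqP; rewrite eq_sym oner_eq0.
have Al : A l z.2.
  apply: contrapT => nA; have := lE l; rewrite indicE memNset// eqxx.
  by move/eqP; rewrite eq_sym oner_eq0.
under eq_bigr do under eq_bigr do rewrite /cell_indic kE lE mulrCA mulrC.
under eq_bigr do rewrite -mulr_suml sum_cell_index.
rewrite (sum_cell_index (fun i => a i l * (l < n)%:R)).
have al : a k l <= c z.1 z.2.
  apply: ge_inf; last by exists z.1, z.2.
  by exists 0 => _ [x [y [_ _ ->]]].
do 2 case: (_ < n)%N; rewrite ?mulr1 ?mulr0//.
Qed.

End borel_metric.

(** * The strong Feller property *)

Section strong_feller.
Context {disp : measure_display} {R : realType}.
Context {X : completeBorelMetricType disp R}.

(** A reduction to sequences, for which dominated convergence is available. *)
Lemma metric_seq_cvg (g : X -> R) (x : X) (l : R) :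
  (forall u : nat -> X, (forall n, mdist x (u n) < n.+1%:R^-1) ->
     g (u n) @[n --> \oo] --> l) ->
  g y @[y --> x] --> l.
Proof.
move=> hu; apply/cvgrPdist_lt => e e0; apply: contrapT => nh.
have ex n : exists y, mdist x y < n.+1%:R^-1 /\ e <= `|l - g y|.
  apply: contrapT => /forallNP h; apply: nh; apply/nbhs_mdistP.
  exists n.+1%:R^-1; first by rewrite invr_gt0.
  move=> y xy; rewrite ltNge; apply/negP => ley.
  by apply: (h y).
have [u uP] := choice ex.
have /cvgrPdist_lt/(_ e e0)[N _ /(_ N (leqnn N))] := hu u (fun n => (uP n).1).
by rewrite /= ltNge (uP N).2.
Qed.

Lemma seq_mdist_cvg (x : X) (u : nat -> X) :
  (forall n, mdist x (u n) < n.+1%:R^-1) -> u n @[n --> \oo] --> x.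
Proof.
move=> hu A /nbhs_mdistP[e e0 eA].
have [N _ NP] := near_infty_natSinv_lt (PosNum e0).
exists N => // n Nn; apply: eA; apply: (lt_trans (hu n)).
exact: NP.
Qed.

Section density_measure.
Context {d} {T : measurableType d} (v : {measure set T -> \bar R}).

Lemma density_measure (g : T -> \bar R) :
  measurable_fun [set: T] g -> (forall y, 0 <= g y)%E ->
  exists k : {measure set T -> \bar R},
    forall A, measurable A -> k A = (\int[v]_(y in A) g y)%E.
Proof.
move=> mg g0; pose k A := (\int[v]_(y in A) g y)%E.
have k0 : k set0 = 0%E by exact: integral_set0.
have kge0 A : (0 <= k A)%E by exact: integral_ge0.
have kadd : semi_sigma_additive k by exact: semi_sigma_additive_nng_induced.
pose km : {measure set T -> \bar R} := HB.pack k
  (isMeasure.Build _ _ _ k k0 kge0 kadd).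
by exists km.
Qed.

End density_measure.

Variables (v : {measure set X -> \bar R}) (P : X -> probability X R).
Hypothesis cd : continuous_density v P.

(* By continuity of the densities, [P x'] tends to [P x] in total variation. *)
Lemma strong_feller (h : X -> R) : bounded_measurable h -> continuous (Pop P h).
Proof.
move: cd => [_ [rho [mrho rho0 Prho crho]]].
(* As in Scheffé's lemma: unlike the absolute difference, the positive part is dominated by the
   fixed integrable function [rho x], and it suffices because both densities have mass 1. *)
pose g x x' y : R := Num.max (rho x y - rho x' y) 0.
have g0 x x' y : 0 <= g x x' y by rewrite /g le_max lexx orbT.
have mg x x' : measurable_fun [set: X] (g x x').
  by apply: measurable_maxr; [exact: measurable_funB|exact: measurable_cst].
have mEg x x' : measurable_fun [set: X] (EFin \o g x x').
  exact/measurable_EFinP.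
have mErho x : measurable_fun [set: X] (EFin \o rho x) by exact/measurable_EFinP.
have grho x x' y : g x x' y <= rho x y.
  by rewrite /g ge_max rho0 andbT lerBlDr lerDl.
have rho1 x : (\int[v]_y (rho x y)%:E = 1)%E by rewrite -Prho// probability_setT.
pose delta x x' := (\int[v]_y (g x x' y)%:E)%E.
have delta1 x x' : (delta x x' <= 1)%E.
  rewrite -(rho1 x); apply: ge0_le_integral => //.
  - by move=> y _; rewrite lee_fin.
  - exact: (mEg x x').
  - exact: (mErho x).
  - by move=> y _; rewrite lee_fin.
have deltaE x x' : delta x x' = (fine (delta x x'))%:E.
  rewrite fineK// ge0_fin_numE; first exact: le_lt_trans (delta1 x x') (ltry _).
  by apply: integral_ge0 => y _; rewrite lee_fin.
have eadd x x' A : measurable A -> (P x A + \int[v]_(y in A) (g x' x y)%:E =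
    \int[v]_(y in A) (Num.max (rho x y) (rho x' y))%:E)%E.
  move=> mA; rewrite Prho// -ge0_integralD//.
  - apply: eq_integral => y _; rewrite -EFinD; congr EFin.
    by rewrite /g addr_maxr addr0 addrCA subrr addr0 maxC.
  - by move=> y _; rewrite lee_fin.
  - exact: measurable_funTS (mErho x).
  - by move=> y _; rewrite lee_fin.
  - exact: measurable_funTS (mEg x' x).
have dle x x' (f : X -> R) M : bounded_measurable f -> (forall y, 0 <= f y <= M) ->
    Pop P f x - Pop P f x' <= M * fine (delta x x').
  move=> bf f0M.
  have [k kE] := density_measure v (mEg x x') (fun y => g0 x x' y).
  have [k' k'E] := density_measure v (mEg x' x) (fun y => g0 x' x y).
  have mf : measurable_fun [set: X] (EFin \o f) by case: bf => /measurable_EFinP.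
  have f0 y : (0 <= (f y)%:E)%E by rewrite lee_fin; case/andP: (f0M y).
  (* Both sides integrate [f] against the maximum of the two densities; this avoids subtracting
     measures. *)
  have e1 : (\int[P x]_y (f y)%:E + \int[k']_y (f y)%:E =
             \int[P x']_y (f y)%:E + \int[k]_y (f y)%:E)%E.
    rewrite -!ge0_integral_measure_add//; apply: eq_measure_integral => A mA _.
    transitivity (P x A + k' A)%E; first exact: measure_addE.
    transitivity (P x' A + k A)%E; last exact/esym/measure_addE.
    rewrite kE// k'E// !eadd//.
    by apply: eq_integral => y _; rewrite maxC.
  have e2 : (\int[k]_y (f y)%:E <= (M * fine (delta x x'))%:E)%E.
    rewrite EFinM -deltaE.
    have -> : delta x x' = k setT by rewrite kE.
    rewrite -integral_cst//; apply: ge0_le_integral => //.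
    by move=> y _; rewrite lee_fin; case/andP: (f0M y).
  rewrite lerBlDl -lee_fin EFinD /Pop !bounded_integral_EFin//.
  apply: (@le_trans _ _ (\int[P x']_y (f y)%:E + \int[k]_y (f y)%:E)%E).
    by rewrite -e1 leeDl// integral_ge0.
  by rewrite leeD2l.
move=> [mh [M hM]] x; have bh : bounded_measurable h by split=> //; exists M.
have bM := @bounded_measurable_cst _ X R M.
have hMabs y : - M <= h y <= M by rewrite -ler_norml.
apply: metric_seq_cvg => u ux.
have du : delta x (u n) @[n --> \oo] --> 0%E.
  have -> : 0%E = (\int[v]_y (cst 0%E) y)%E by rewrite integral0.
  apply: (@dominated_cvg _ _ _ v _ measurableT
    (fun n y => (g x (u n) y)%:E) (cst 0%E) (EFin \o rho x)) => //=.
  - by move=> n; exact: mEg.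
  - move=> y _; apply: cvg_EFin; first exact: nearW.
    have ru : rho (u n) y @[n --> \oo] --> rho x y.
      exact: (continuous_cvg _ (crho y x) (seq_mdist_cvg ux)).
    apply: (@squeeze_cvgr _ _ _ _ (cst 0) (fun n => `|rho x y - rho (u n) y|)).
    + by apply: nearW => n /=; rewrite g0 /g ge_max ler_norm normr_ge0.
    + exact: cvg_cst.
    + rewrite -[X in _ --> X](normr0 R) -(subrr (rho x y)).
      by apply: cvg_norm; apply: cvgB => //; exact: cvg_cst.
  - apply/integrableP; split; first exact: mErho.
    under eq_integral do rewrite gee0_abs ?lee_fin//.
    by rewrite rho1 ltry.
  - by move=> n y _; rewrite lee_fin ger0_norm.
have du' : fine (delta x (u n)) @[n --> \oo] --> (0 : R) by exact: fine_cvg.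
apply/cvgrPdist_le => e e0.
have M0 : 0 <= M by exact: le_trans (hM x).
have e' : 0 < e / (2 * M + 1) by rewrite divr_gt0// ltr_wpDl// mulr_ge0.
have /cvgrPdist_lt/(_ _ e')[N _ NP] := du'.
exists N => // n /(NP n); rewrite sub0r normrN => dn.
have dn0 : 0 <= fine (delta x (u n)).
  by rewrite fine_ge0// integral_ge0// => y _; rewrite lee_fin.
rewrite ger0_norm// in dn.
(* The two nonnegative functions [h + M] and [M - h] give the two signs with the same
   [delta x (u n)]. *)
have h1 := dle x (u n) (fun y => h y + M) (2 * M) (bounded_measurableD bh bM).
have h2 := dle x (u n) (fun y => M - h y) (2 * M) (bounded_measurableB bM bh).
rewrite /Pop !bounded_integralD// !probability_Rintegral_cst in h1.
rewrite /Pop !bounded_integralB// !probability_Rintegral_cst in h2.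
have {}h1 := h1 ltac:(move=> y; have /andP[? ?] := hMabs y; apply/andP; split; lra).
have {}h2 := h2 ltac:(move=> y; have /andP[? ?] := hMabs y; apply/andP; split; lra).
have le : 2 * M * fine (delta x (u n)) <= e.
  apply: (@le_trans _ _ ((2 * M + 1) * (e / (2 * M + 1)))).
    by rewrite ler_pM// ?mulr_ge0// ?ltW// ltrDl.
  by rewrite mulrCA divff ?mulr1// gt_eqF// ltr_wpDl// mulr_ge0.
by rewrite /Pop ler_norml; lra.
Qed.

Lemma transition_measurable (A : set X) : measurable A ->
  measurable_fun [set: X] (fun x => P x A).
Proof.
move=> mA.
have cf := strong_feller (bounded_measurable_indic (R := R) mA).
apply: (eq_measurable_fun (fun x => (Pop P \1_A x)%:E)); last first.
  exact/measurable_EFinP/continuous_borel_measurable.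
by move=> x _; rewrite /Pop bounded_integral_indic// fineK// fin_num_measure.
Qed.

Lemma Pop_bounded_measurable (h : X -> R) : bounded_measurable h ->
  bounded_measurable (Pop P h).
Proof.
move=> bh; split; first exact/continuous_borel_measurable/strong_feller.
by have [_ [M hM]] := bh; exists M => x; exact: bounded_integral_le_norm.
Qed.

(** [Pstar P mu] is only a set function. The bind of the Giry monad provides a measure that agrees
    with it on measurable sets, together with the change of order of integration. *)
Lemma Pstar_probability (mu : probability X R) : exists Q : probability X R,
  (forall A, measurable A -> Q A = Pstar P mu A) /\
  (forall h, bounded_measurable h -> \int[Q]_x h x = \int[mu]_x Pop P h x).
Proof.
pose f x : giry X R := P x.
have mf : measurable_fun [set: X] f.
  apply: measurable_giry_codensity => // B mB; exact: transition_measurable.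
pose Q0 := giry_bind (mu : giry X R) mf.
have Q0E (h : X -> \bar R) : measurable_fun [set: X] h -> (forall x, 0 <= h x)%E ->
    (\int[Q0]_x h x = \int[mu]_x \int[P x]_y h y)%E.
  by move=> mh h0; exact: (giry_int_bind (mu : giry X R) mf mh h0).
have Q0A A : measurable A -> Q0 A = Pstar P mu A.
  move=> mA; transitivity (\int[Q0]_x (\1_A x)%:E)%E.
    by rewrite integral_indic// setIT.
  rewrite (Q0E (fun x => (\1_A x)%:E)).
  - by apply: eq_integral => x _; rewrite integral_indic// setIT.
  - exact/measurable_EFinP.
  - by move=> x; rewrite lee_fin.
have Q01 : Q0 setT = 1%E.
  rewrite Q0A// /Pstar; under eq_integral do rewrite probability_setT.
  by rewrite integral_cst// mul1e probability_measure_setT.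
pose Q : probability X R := HB.pack (Q0 : set X -> \bar R)
  (Measure.on Q0) (Measure_isProbability.Build _ _ _ Q0 Q01).
exists Q; split=> // h bh; have [mh [M hM]] := bh.
have bM := @bounded_measurable_cst _ X R M.
have bhM := bounded_measurableD bh bM.
(* The formula for the bind concerns nonnegative functions; adding [M] brings [h] into that
   class. *)
suff : \int[Q]_x (h x + M) = \int[mu]_x Pop P (fun x => h x + M) x.
  rewrite bounded_integralD// probability_Rintegral_cst.
  under [in RHS]eq_Rintegral do rewrite /Pop bounded_integralD// probability_Rintegral_cst.
  rewrite bounded_integralD//; last exact: Pop_bounded_measurable.
  by rewrite probability_Rintegral_cst; lra.
apply: EFin_inj; rewrite !bounded_integral_EFin//; last exact: Pop_bounded_measurable.
have -> : (\int[Q]_x (h x + M)%:E = \int[Q0]_x (h x + M)%:E)%E by [].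
rewrite Q0E.
- by apply: eq_integral => x _; rewrite /Pop bounded_integral_EFin.
- by case: bhM => /measurable_EFinP.
- by move=> x; rewrite lee_fin; have := hM x; rewrite ler_norml; lra.
Qed.

End strong_feller.

(** * Local Lipschitz constants *)

Section grad_basics.
Context {R : realType} {X : metricType R}.
Variables (rho : X -> X -> R).
Hypothesis rho_dist : is_distance rho.
Implicit Types (f : X -> R) (x : X).
Local Open Scope ereal_scope.

Lemma difference_quotient_sup_ge0 f x r : 0 <= difference_quotient_sup rho f x r.
Proof. by apply: ereal_sup_ubound; left. Qed.

Lemma difference_quotient_sup_le f x r (K : \bar R) : 0 <= K ->
  (forall y, (0 < rho x y <= r)%R -> (`|(f x - f y) / rho x y|%R)%:E <= K) ->
  difference_quotient_sup rho f x r <= K.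
Proof.
move=> K0 h; apply: ge_ereal_sup => _ [->//|[y /= yr <-]].
exact: h.
Qed.

Lemma le_difference_quotient_sup f x r y : (0 < rho x y <= r)%R ->
  (`|(f x - f y) / rho x y|%R)%:E <= difference_quotient_sup rho f x r.
Proof. by move=> yr; apply: ereal_sup_ubound; right; exists y. Qed.

Lemma nondecreasing_difference_quotient_sup f x :
  {homo difference_quotient_sup rho f x : r s / (r <= s)%R >-> r <= s}.
Proof.
move=> r s rs; apply: difference_quotient_sup_le => [|y /andP[y0 yr]].
  exact: difference_quotient_sup_ge0.
by apply: le_difference_quotient_sup; rewrite y0 (le_trans yr).
Qed.

(** The supremum is nondecreasing in the radius, so its limit at 0 from the right exists and is the
    infimum. *)
Lemma gradE f x : grad rho f x =
  ereal_inf [set difference_quotient_sup rho f x r | r in [set r | (0 < r)%R]].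
Proof.
apply/cvg_lim => //.
rewrite (_ : [set r : R | (0 < r)%R] = [set` `]0%R, +oo[]); last first.
  by apply/seteqP; split=> r /=; rewrite in_itv /= andbT.
apply: (@nondecreasing_at_right_cvge R _ 0%R (BInfty R false)) => //.
by move=> r s _ _; exact: nondecreasing_difference_quotient_sup.
Qed.

Lemma grad_ge0 f x : 0 <= grad rho f x.
Proof.
rewrite gradE; apply: le_ereal_inf_tmp => _ [r _ <-].
exact: difference_quotient_sup_ge0.
Qed.

Lemma grad_le_quotient f x r : (0 < r)%R ->
  grad rho f x <= difference_quotient_sup rho f x r.
Proof. by move=> r0; rewrite gradE; apply: ereal_inf_lbound; exists r. Qed.

Lemma grad_le f x (K r : R) : (0 < r)%R -> (0 <= K)%R ->
  (forall y, (rho x y <= r)%R -> (`|f x - f y| <= K * rho x y)%R) ->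
  grad rho f x <= K%:E.
Proof.
move=> r0 K0 h; apply: le_trans (grad_le_quotient f x r0) _.
apply: difference_quotient_sup_le => [|y /andP[y0 yr]]; first by rewrite lee_fin.
by rewrite lee_fin normrM normfV (gtr0_norm y0) ler_pdivrMr// h.
Qed.

Lemma quotient_le_bound f x (r : R) (K : R) y : (rho x y <= r)%R ->
  difference_quotient_sup rho f x r <= K%:E -> (`|f x - f y| <= K * rho x y)%R.
Proof.
have [rho0 rhoE _ _] := rho_dist => yr hK.
have := rho0 x y; rewrite le_eqVlt => /predU1P[/esym e0|y0].
  by rewrite e0 mulr0; have /rhoE -> := e0; rewrite subrr normr0.
have := le_trans (le_difference_quotient_sup f (introT andP (conj y0 yr))) hK.
by rewrite lee_fin normrM normfV (gtr0_norm y0) ler_pdivrMr.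
Qed.

Lemma grad_lt f x (K : R) : grad rho f x < K%:E ->
  exists2 r : R, (0 < r)%R &
    forall y, (rho x y <= r)%R -> (`|f x - f y| <= K * rho x y)%R.
Proof.
rewrite gradE => /ereal_inf_lt[_ [r /= r0 <-] hK].
by exists r => // y yr; apply: quotient_le_bound yr (ltW hK).
Qed.

End grad_basics.

Section grad_measurable.
Context {disp : measure_display} {R : realType}.
Context {X : completeBorelMetricType disp R}.
Implicit Types (f : X -> R) (x : X).
Local Open Scope ereal_scope.

Lemma mdist_distance : is_distance (@mdist R X).
Proof.
split; [exact: mdist_ge0| |exact: metric_sym|].
- by move=> x y; split=> [|->]; [exact: mdist_positivity|exact: mdistxx].
- by move=> x y z; exact: metric_triangle.
Qed.

(* Unlike [difference_quotient_sup], whose supremum runs over a closed ball,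
   this is lower semicontinuous in [x]. *)
Definition open_quotient_sup f (r : R) x : \bar R :=
  ereal_sup ([set 0] `|` [set (`|(f x - f y) / mdist x y|%R)%:E |
    y in [set y | 0 < mdist x y < r]%R]).

Lemma open_quotient_sup_ge0 f r x : 0 <= open_quotient_sup f r x.
Proof. by apply: ereal_sup_ubound; left. Qed.

Lemma open_quotient_sup_le f r x : open_quotient_sup f r x <=
  difference_quotient_sup (@mdist R X) f x r.
Proof.
apply: ereal_sup_le => _ [->|[y /= /andP[y0 yr] <-]]; first by left.
by right; exists y => //=; rewrite y0 ltW.
Qed.

Lemma difference_quotient_sup_le_open f r s x : (r < s)%R ->
  difference_quotient_sup (@mdist R X) f x r <= open_quotient_sup f s x.
Proof.
move=> rs; apply: ereal_sup_le => _ [->|[y /= /andP[y0 yr] <-]]; first by left.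
by right; exists y => //=; rewrite y0 (le_lt_trans yr).
Qed.

Lemma continuous_mdistl (x0 : X) : continuous (fun y => mdist y x0).
Proof.
move=> y; apply/cvgrPdist_lt => e e0; apply/nbhs_mdistP; exists e => // z yz.
have h1 := metric_triangle y z x0; have h2 := metric_triangle z y x0.
rewrite (metric_sym z y) in h2; rewrite /= ltr_norml; lra.
Qed.

(** For a fixed competitor [y], the strict constraints on the distance are open conditions on the
    base point and the quotient is continuous there. Hence the superlevel sets are open. *)
Lemma open_quotient_sup_measurable f r : continuous f ->
  measurable_fun [set: X] (open_quotient_sup f r).
Proof.
move=> cf; apply: lower_semicontinuous_borel_measurable => a.
rewrite openE => x /= ax.
have [_ [->|[y /= /andP[y0 yr] <-]] ay] := ereal_sup_gt ax.
  by apply: nearW => z; apply: lt_le_trans ay _; exact: open_quotient_sup_ge0.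
have cd := @continuous_mdistl y x.
have cq : `|(f z - f y) / mdist z y|%R @[z --> x] --> `|(f x - f y) / mdist x y|%R.
  apply: cvg_norm; apply: cvgM; first by apply: cvgB; [exact: cf|exact: cvg_cst].
  by apply: cvgV => //; rewrite gt_eqF.
have n1 : \forall z \near x, a < (`|(f z - f y) / mdist z y|%R)%:E.
  case: a ay {ax} => [a|//|]; rewrite ?lte_fin => ay.
    by move/cvgr_gt : cq => /(_ _ ay).
  by apply: nearW => z; rewrite ltNyr.
have n2 : \forall z \near x, (0 < mdist z y)%R by move/cvgr_gt : cd => /(_ _ y0).
have n3 : \forall z \near x, (mdist z y < r)%R by move/cvgr_lt : cd => /(_ _ yr).
near=> z; apply: (@lt_le_trans _ _ (`|(f z - f y) / mdist z y|%R)%:E).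
  by near: z.
apply: ereal_sup_ubound; right; exists y => //=; apply/andP; split; by near: z.
Unshelve. all: end_near. Qed.

(** The supremum over an open ball lies between those over the closed balls of half the radius and
    of the same radius. *)
Lemma open_quotient_sup_cvg f x :
  open_quotient_sup f n.+1%:R^-1 x @[n --> \oo] --> grad (@mdist R X) f x.
Proof.
have -> : grad (@mdist R X) f x =
    ereal_inf (range (fun n => open_quotient_sup f n.+1%:R^-1 x)).
  rewrite gradE; apply/eqP; rewrite eq_le; apply/andP; split.
    apply: le_ereal_inf_tmp => _ [n _ <-].
    apply: (@le_trans _ _ (difference_quotient_sup (@mdist R X) f x (n.+1%:R^-1 / 2))).
      by apply: ereal_inf_lbound; exists (n.+1%:R^-1 / 2)%R => //=; rewrite divr_gt0// invr_gt0.
    apply: difference_quotient_sup_le_open.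
    by rewrite ltr_pdivrMr// mulr_natr mulr2n ltrDl invr_gt0.
  apply: le_ereal_inf_tmp => _ [r /= r0 <-].
  have [n _ nP] := near_infty_natSinv_lt (PosNum r0).
  apply: (@le_trans _ _ (open_quotient_sup f n.+1%:R^-1 x)).
    by apply: ereal_inf_lbound; exists n.
  apply: le_trans (open_quotient_sup_le _ _ _) _.
  by apply: nondecreasing_difference_quotient_sup; exact/ltW/nP/leqnn.
apply: ereal_nonincreasing_cvgn => m n mn.
apply: ereal_sup_le => _ [->|[y /= /andP[y0 yr] <-]]; first by left.
right; exists y => //=; rewrite y0 (lt_le_trans yr)// lef_pV2 ?posrE//.
by rewrite ler_nat.
Qed.

Lemma grad_measurable f : continuous f ->
  measurable_fun [set: X] (grad (@mdist R X) f).
Proof.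
move=> cf; apply: (emeasurable_fun_cvg (fun n => open_quotient_sup f n.+1%:R^-1)).
  by move=> n; exact: open_quotient_sup_measurable.
by move=> x _; exact: open_quotient_sup_cvg.
Qed.

Lemma lipschitz_continuous f (L : R) :
  (forall x y, (`|f x - f y| <= L * mdist x y)%R) -> continuous f.
Proof.
move=> fL x; apply/cvgrPdist_lt => e e0; apply/nbhs_mdistP.
have L0 : (0 < `|L| + 1)%R by rewrite ltr_wpDl.
exists (e / (`|L| + 1))%R; first by rewrite divr_gt0.
move=> y /=; rewrite ltr_pdivlMr// => xy; apply: le_lt_trans (fL x y) _.
apply: le_lt_trans xy; rewrite mulrC ler_wpM2l ?mdist_ge0//.
by rewrite (le_trans (ler_norm _))// lerDl.
Qed.

Lemma grad_le_lipschitz f (L : R) x : (0 <= L)%R ->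
  (forall x y, (`|f x - f y| <= L * mdist x y)%R) ->
  grad (@mdist R X) f x <= L%:E.
Proof. by move=> L0 fL; apply: (@grad_le _ _ _ _ _ _ 1%R) => // y _. Qed.

End grad_measurable.

(** * The Hopf-Lax formula *)

Section powR_inequalities.
Context {R : realType}.
Implicit Types (a b e p r x y : R).

(** [d] is found by inverting the power; this handles [x = 0] and all exponents [a > 0] at once. *)
Lemma powR_upper_cont x a e : 0 <= x -> 0 < a -> 0 < e ->
  exists2 d, 0 < d & forall y, 0 <= y -> y <= x + d -> y `^ a <= x `^ a + e.
Proof.
move=> x0 a0 e0; pose z := (x `^ a + e) `^ a^-1.
have xa0 : 0 <= x `^ a by exact: powR_ge0.
have zE : z `^ a = x `^ a + e.
  by rewrite /z -powRrM mulVf ?gt_eqF// powRr1// addr_ge0// ltW.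
have xz : x < z.
  have -> : x = (x `^ a) `^ a^-1 by rewrite -powRrM divff ?gt_eqF// powRr1.
  by apply: gt0_ltr_powR; rewrite ?invr_gt0// ?nnegrE ?addr_ge0 ?(ltW e0)// ltrDl.
exists (z - x); first by rewrite subr_gt0.
move=> y y0; rewrite addrC subrK -zE => yz.
by apply: ge0_ler_powR; rewrite ?nnegrE// ?(ltW a0)// (le_trans y0).
Qed.

Lemma young p q a b : 1 < p -> p^-1 + q^-1 = 1 -> 0 <= a -> 0 <= b ->
  a * b <= a `^ p / p + b `^ q / q.
Proof.
move=> p1 pq a0 b0.
have p0 : 0 < p by exact: lt_trans p1.
have q0 : 0 < q.
  rewrite -invr_gt0; have -> : q^-1 = 1 - p^-1 by rewrite -pq addrC addKr.
  by rewrite subr_gt0 invf_lt1.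
exact: conjugate_powR.
Qed.

(** The graph of the convex function u^p / p lies above its tangent at [a]. This is Young's
    inequality for [b] and a^(p-1). *)
Lemma powR_tangent p a b : 1 < p -> 0 <= b -> 0 <= a ->
  a `^ p / p - b `^ p / p <= (a - b) * a `^ (p - 1).
Proof.
move=> p1 b0 a0; have p0 : 0 < p by exact: lt_trans p1.
have p10 : p - 1 != 0 by rewrite subr_eq0 gt_eqF.
have pq : p^-1 + (p / (p - 1))^-1 = 1.
  by rewrite invf_div -{1}[p^-1]mul1r -mulrDl addrC subrK divff// gt_eqF.
have := young p1 pq b0 (powR_ge0 a (p - 1)).
rewrite -powRrM mulrCA divff// mulr1 mulrBl mulr_powRB1//.
have -> : a `^ p / (p / (p - 1)) = a `^ p - a `^ p / p.
  by field; rewrite p10 gt_eqF.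
lra.
Qed.

(** The tangent at 1 of the convex function r^(1-p), from exp u >= 1 + u and ln r <= r - 1. *)
Lemma powR_inv_tangent p r : 1 < p -> 0 < r ->
  (p - 1) * (1 - r) <= r `^ (1 - p) - 1.
Proof.
move=> p1 r0; rewrite /powR gt_eqF//.
have h1 := expR_ge1Dx ((1 - p) * ln r).
have h2 : ln r <= r - 1 by rewrite -[X in ln X](subrK 1) addrC le_ln1Dx// ltrBrDl subrr.
have : 0 <= (p - 1) * (r - 1 - ln r) by rewrite mulr_ge0 ?subr_ge0// ltW.
lra.
Qed.

Lemma powR_diff_le p b d : 1 < p -> 0 <= b -> 0 <= d ->
  (b + d) `^ p / p - b `^ p / p <= d * (b + d) `^ (p - 1).
Proof.
move=> p1 b0 d0; apply: le_trans (powR_tangent p1 b0 (addr_ge0 b0 d0)) _.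
by rewrite addrAC subrr add0r.
Qed.

End powR_inequalities.

Section hopf_lax.
Context {R : realType} {X : metricType R}.
Variables (p B : R) (psi : X -> R).
Hypothesis p_gt1 : 1 < p.
Hypothesis psiB : forall w, `|psi w| <= B.

Let p_gt0 : 0 < p. Proof. exact: lt_trans p_gt1. Qed.

Let p1_ge0 : 0 <= p - 1. Proof. by rewrite subr_ge0 ltW. Qed.

Definition pcost (z w : X) : R := mdist z w `^ p / p.

(** The parameter multiplies the cost: a larger [t] corresponds to a shorter classical time, and the
    function is nondecreasing in [t]. *)
Definition hopf_lax (t : R) (z : X) : R :=
  inf [set psi w + t * pcost z w | w in [set: X]].

Lemma pcost_ge0 z w : 0 <= pcost z w.
Proof. by rewrite divr_ge0 ?powR_ge0// ltW. Qed.

Lemma pcostxx z : pcost z z = 0.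
Proof. by rewrite /pcost mdistxx powR0 ?mul0r// gt_eqF. Qed.

Let psi_ge w : - B <= psi w. Proof. by have := psiB w; rewrite ler_norml => /andP[]. Qed.
Let psi_le w : psi w <= B. Proof. by have := psiB w; rewrite ler_norml => /andP[]. Qed.

Let hl_has_inf t z : 0 <= t -> has_inf [set psi w + t * pcost z w | w in [set: X]].
Proof.
move=> t0; split; first by exists (psi z + t * pcost z z), z.
exists (- B) => _ [w _ <-]; rewrite (le_trans (psi_ge w))// lerDl.
by rewrite mulr_ge0// pcost_ge0.
Qed.

Lemma hopf_lax_le t z w : 0 <= t -> hopf_lax t z <= psi w + t * pcost z w.
Proof. by move=> t0; apply: ge_inf; [exact: (hl_has_inf z t0).2|exists w]. Qed.

Lemma hopf_lax_ge t z r : 0 <= t -> (forall w, r <= psi w + t * pcost z w) ->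
  r <= hopf_lax t z.
Proof.
move=> t0 h; apply: lb_le_inf; first exact: (hl_has_inf z t0).1.
by move=> _ [w _ <-]; exact: h.
Qed.

Lemma hopf_lax_near t z e : 0 <= t -> 0 < e ->
  exists w, psi w + t * pcost z w < hopf_lax t z + e.
Proof.
move=> t0 e0; have [_ [w _ <-] h] := inf_adherent e0 (hl_has_inf z t0).
by exists w.
Qed.

Lemma hopf_lax_le_psi t z : 0 <= t -> hopf_lax t z <= psi z.
Proof. by move=> t0; have := hopf_lax_le z z t0; rewrite pcostxx mulr0 addr0. Qed.

Lemma hopf_lax_bound t z : 0 <= t -> `|hopf_lax t z| <= B.
Proof.
move=> t0; rewrite ler_norml (le_trans (hopf_lax_le_psi z t0))// andbT.
apply: hopf_lax_ge => // w; rewrite (le_trans (psi_ge w))// lerDl.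
by rewrite mulr_ge0// pcost_ge0.
Qed.

Lemma hopf_lax_mono s t z : 0 <= s -> s <= t -> hopf_lax s z <= hopf_lax t z.
Proof.
move=> s0 st; apply: hopf_lax_ge => [|w]; first exact: le_trans st.
apply: le_trans (hopf_lax_le z w s0) _.
by rewrite lerD2l ler_wpM2r// pcost_ge0.
Qed.

(** An almost optimal point at [s] costs little more than [2 * B / s], because [psi] oscillates by
    at most [2 * B]. It is then a competitor at [t]. *)
Lemma hopf_lax_time s t z : 0 < s -> s <= t ->
  hopf_lax t z - hopf_lax s z <= (t - s) * (2 * B / s).
Proof.
move=> s0 st; apply/ler_addgt0Pr => e e0.
have t0 : 0 < t by exact: lt_le_trans st.
(* The error made at [s] is amplified by the factor [t / s] at [t]. *)
pose e' := e / (t / s).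
have e'0 : 0 < e' by rewrite !divr_gt0.
have [w hw] := hopf_lax_near z (ltW s0) e'0.
have h1 := hopf_lax_le z w (ltW t0).
have h2 := hopf_lax_le_psi z (ltW s0).
have c1 : pcost z w <= (2 * B + e') / s.
  rewrite ler_pdivlMr//; have := psi_ge w; have := psi_le z.
  by move: h2 hw; lra.
have : (t - s) * pcost z w <= (t - s) * ((2 * B + e') / s).
  by rewrite ler_wpM2l ?subr_ge0.
have -> : (t - s) * ((2 * B + e') / s) = (t - s) * (2 * B / s) + (t / s * e' - e').
  by field; rewrite gt_eqF.
have -> : t / s * e' = e by rewrite /e' mulrC divfK// mulf_neq0 ?invr_neq0 ?gt_eqF.
lra.
Qed.

Definition hopf_lax_rate (s t : R) (z : X) : R :=
  (hopf_lax t z - hopf_lax s z) / (t - s).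

Lemma hopf_lax_rate_ge0 s t z : 0 <= s -> s < t -> 0 <= hopf_lax_rate s t z.
Proof.
move=> s0 st; rewrite divr_ge0 ?subr_ge0 ?(ltW st)//.
by apply: hopf_lax_mono => //; exact: ltW.
Qed.

(* No minimizer is needed in the Hopf-Lax formula: almost optimal points are
   controlled by a difference quotient in time, which is continuous in [z]. *)
Lemma hopf_lax_near_cost s t z w e : 0 <= s -> s < t ->
  psi w + t * pcost z w < hopf_lax t z + e ->
  pcost z w <= hopf_lax_rate s t z + e / (t - s).
Proof.
move=> s0 st hw; have h := hopf_lax_le z w s0.
rewrite /hopf_lax_rate -mulrDl ler_pdivlMr ?subr_gt0//; lra.
Qed.

(** An almost optimal point for [z] competes at [z']. Its distance to [z] is at most the [p]-th root
    that appears here, and convexity of the cost bounds the price of the displacement. *)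
Lemma hopf_lax_space s t z z' eta : 0 <= s -> s < t -> 0 < eta ->
  hopf_lax t z' - hopf_lax t z <= t * (mdist z' z *
    ((p * (hopf_lax_rate s t z + eta)) `^ p^-1 + mdist z' z) `^ (p - 1)).
Proof.
move=> s0 st eta0; apply/ler_addgt0Pr => e e0.
have t0 : 0 < t by exact: le_lt_trans st.
(* The second bound is needed because [hopf_lax_near_cost] divides the error by [t - s]. *)
pose e' := Num.min e (eta * (t - s)).
have e'0 : 0 < e' by rewrite lt_min e0 mulr_gt0// subr_gt0.
have [w hw] := hopf_lax_near z (ltW t0) e'0.
have h1 := hopf_lax_le z' w (ltW t0).
have ee' : e' <= e by rewrite ge_min lexx.
have c1 : pcost z w <= hopf_lax_rate s t z + eta.
  apply: le_trans (hopf_lax_near_cost s0 st hw) _; rewrite lerD2l.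
  by rewrite ler_pdivrMr ?subr_gt0// ge_min lexx orbT.
set b0 := (p * _) `^ p^-1; set dl := mdist z' z.
have dl0 : 0 <= dl by exact: mdist_ge0.
have d0 : 0 <= mdist z w by exact: mdist_ge0.
have bb0 : mdist z w <= b0.
  have -> : mdist z w = (mdist z w `^ p) `^ p^-1.
    by rewrite -powRrM divff ?gt_eqF// powRr1.
  apply: ge0_ler_powR; rewrite ?nnegrE ?invr_ge0 ?powR_ge0 ?(ltW p_gt0)//.
    by rewrite mulr_ge0 ?(ltW p_gt0)// addr_ge0 ?(ltW eta0)// hopf_lax_rate_ge0.
  by move: c1; rewrite /pcost ler_pdivrMr// mulrC.
have c2 : pcost z' w - pcost z w <= dl * (b0 + dl) `^ (p - 1).
  apply: (@le_trans _ _ ((mdist z w + dl) `^ p / p - mdist z w `^ p / p)).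
    rewrite /pcost lerD2r ler_pM2r ?invr_gt0//.
    apply: ge0_ler_powR; rewrite ?nnegrE ?mdist_ge0 ?addr_ge0 ?(ltW p_gt0)//.
    by rewrite addrC; exact: metric_triangle.
  apply: le_trans (powR_diff_le p_gt1 d0 dl0) _; rewrite ler_wpM2l//.
  apply: ge0_ler_powR => //; rewrite ?nnegrE ?addr_ge0 ?powR_ge0//.
  by rewrite lerD2r.
have := ler_wpM2l (ltW t0) c2; rewrite mulrBr; lra.
Qed.

(** At distance at most 1, [hopf_lax_space] applies with [s = t / 2], where the rate is at most
    [2 * B / s]; at larger distances, the bound [B] on the function is enough. *)
Lemma hopf_lax_lipschitz t : 0 < t -> exists L : R,
  0 <= L /\ forall z z', `|hopf_lax t z - hopf_lax t z'| <= L * mdist z z'.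
Proof.
move=> t0; pose s := t / 2.
have s0 : 0 < s by rewrite divr_gt0.
have st : s < t by rewrite /s; lra.
pose K := t * ((p * (2 * B / s + 1)) `^ p^-1 + 1) `^ (p - 1).
have K0 : 0 <= K by rewrite mulr_ge0 ?powR_ge0// ltW.
have rate_le z : hopf_lax_rate s t z <= 2 * B / s.
  rewrite ler_pdivrMr ?subr_gt0// mulrC.
  by apply: hopf_lax_time => //; exact: ltW.
have half z z' : hopf_lax t z' - hopf_lax t z <= (K + 2 * B) * mdist z z'.
  have B0 : 0 <= B by exact: le_trans (normr_ge0 (psi z)) (psiB z).
  have d0 := mdist_ge0 z z'.
  have [d1|d1] := leP (mdist z z') 1; last first.
    have := hopf_lax_bound z (ltW t0); have := hopf_lax_bound z' (ltW t0).
    rewrite !ler_norml => /andP[_ h1] /andP[h2 _].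
    apply: (@le_trans _ _ (2 * B)); first by lra.
    apply: (@le_trans _ _ (2 * B * mdist z z')).
      by rewrite ler_peMr ?mulr_ge0// ltW.
    by rewrite ler_wpM2r// lerDr.
  apply: le_trans (hopf_lax_space z z' (ltW s0) st ltr01) _.
  apply: (@le_trans _ _ (K * mdist z z')).
    2: by rewrite ler_wpM2r// lerDl mulr_ge0.
  rewrite (metric_sym z' z) /K [X in _ <= X]mulrAC -mulrA.
  rewrite ler_wpM2l ?(ltW t0)// ler_wpM2l//.
  have r0 := hopf_lax_rate_ge0 z (ltW s0) st.
  apply: ge0_ler_powR => //; rewrite ?nnegrE ?addr_ge0 ?powR_ge0//.
  rewrite lerD//; apply: ge0_ler_powR; rewrite ?nnegrE ?invr_ge0 ?(ltW p_gt0)//.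
  - by rewrite mulr_ge0 ?(ltW p_gt0)// addr_ge0.
  - by rewrite mulr_ge0 ?(ltW p_gt0)// addr_ge0// divr_ge0 ?(ltW s0)// mulr_ge0 ?B0.
  - by rewrite ler_pM2l// lerD2r.
exists (Num.max 0 (K + 2 * B)); split; first by rewrite le_max lexx.
move=> z z'; have d0 := mdist_ge0 z z'.
apply: (@le_trans _ _ ((K + 2 * B) * mdist z z')).
  rewrite ler_norml; have := half z z'; have := half z' z; rewrite (metric_sym z' z).
  by move=> h1 h2; rewrite h1 andbT lerNl opprB.
by rewrite ler_wpM2r// le_max lexx orbT.
Qed.

End hopf_lax.

Section hopf_lax_gradient.
Context {disp : measure_display} {R : realType}.
Context {X : completeBorelMetricType disp R}.
Variables (p B : R) (psi : X -> R).
Hypothesis p_gt1 : 1 < p.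
Hypothesis psiB : forall w, `|psi w| <= B.

Let p_gt0 : 0 < p. Proof. exact: lt_trans p_gt1. Qed.

Lemma hopf_lax_bounded_lipschitz t : 0 < t -> bounded_lipschitz (hopf_lax p psi t).
Proof.
move=> t0; split.
  exists B; split; first exact: num_real.
  move=> x Bx z _ /=; rewrite (le_trans (hopf_lax_bound p_gt1 psiB z (ltW t0)))//.
  exact: ltW.
by have [L [_ hL]] := hopf_lax_lipschitz p_gt1 psiB t0; exists L.
Qed.

Lemma hopf_lax_continuous t : 0 < t -> continuous (hopf_lax p psi t).
Proof.
move=> t0; have [L [_ hL]] := hopf_lax_lipschitz p_gt1 psiB t0.
exact: lipschitz_continuous hL.
Qed.

(** [hopf_lax_space] is used with either point as the base point. For a neighbour [y] of [z], the
    rate at [y] is replaced by that at [z], by its continuity in space. *)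
Lemma hopf_lax_grad s t z : 0 < s -> s < t ->
  (grad (@mdist R X) (hopf_lax p psi t) z <=
   (t * (p * hopf_lax_rate p psi s t z) `^ (p^-1 * (p - 1)))%:E)%E.
Proof.
move=> s0 st; have t0 : 0 < t by exact: lt_trans st.
set E := hopf_lax_rate p psi s t z.
have E0 : 0 <= E by exact: (hopf_lax_rate_ge0 p_gt1 psiB z (ltW s0) st).
apply/lee_addgt0Pr => e e0; rewrite -EFinD.
have p10 : 0 < p - 1 by rewrite subr_gt0.
have [d d0 hd] := powR_upper_cont (powR_ge0 (p * E) p^-1) p10 (divr_gt0 e0 t0).
have pV0 : 0 < p^-1 by rewrite invr_gt0.
have pE0 : 0 <= p * E by rewrite mulr_ge0// ltW.
have [d' d'0 hd'] := powR_upper_cont pE0 pV0 (divr_gt0 d0 (@ltr0n R 2)).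
(* With this choice [p * (E + eta + eta)] is [p * E + d']. *)
pose eta := d' / (2 * p).
have eta0 : 0 < eta by rewrite divr_gt0// mulr_gt0.
have cE : continuous (hopf_lax_rate p psi s t).
  move=> y; apply: cvgM; last exact: cvg_cst.
  by apply: cvgB; apply: hopf_lax_continuous.
have /cvgrPdist_lt/(_ _ eta0)/nbhs_mdistP[r1 r10 hr1] := cE z.
pose r := Num.min (r1 / 2) (d / 2).
have r0 : 0 < r by rewrite lt_min !divr_gt0.
apply: (@grad_le _ _ _ _ _ _ r) => //.
  by rewrite addr_ge0 ?mulr_ge0 ?powR_ge0 ?(ltW t0) ?(ltW e0).
move=> y zy.
have zyd : mdist z y <= d / 2 by rewrite (le_trans zy)// ge_min lexx orbT.
have zyr : mdist z y < r1.
  by rewrite (le_lt_trans zy)// gt_min ltr_pdivrMr// ltr_pMr// ltr1n.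
have dzy := mdist_ge0 z y.
have hE := hr1 _ zyr; rewrite /= ltr_norml -/E in hE.
have key F : 0 <= F -> F <= E + eta ->
    t * (mdist z y * ((p * (F + eta)) `^ p^-1 + mdist z y) `^ (p - 1)) <=
    (t * (p * E) `^ (p^-1 * (p - 1)) + e) * mdist z y.
  move=> F0 FE.
  have pF0 : 0 <= p * (F + eta) by rewrite mulr_ge0 ?addr_ge0 ?(ltW p_gt0) ?(ltW eta0).
  have k1 : (p * (F + eta)) `^ p^-1 <= (p * E) `^ p^-1 + d / 2.
    apply: hd' => //; apply: (@le_trans _ _ (p * (E + eta + eta))).
      by rewrite ler_pM2l// lerD2r.
    have -> : p * (E + eta + eta) = p * E + d' by rewrite /eta; field; rewrite gt_eqF.
    by [].
  have k2 : ((p * (F + eta)) `^ p^-1 + mdist z y) `^ (p - 1) <=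
      ((p * E) `^ p^-1) `^ (p - 1) + e / t.
    apply: hd; first by rewrite addr_ge0 ?powR_ge0.
    by rewrite [d]splitr addrA lerD.
  rewrite -powRrM in k2.
  have -> : (t * (p * E) `^ (p^-1 * (p - 1)) + e) * mdist z y =
      t * (mdist z y * ((p * E) `^ (p^-1 * (p - 1)) + e / t)).
    by field; rewrite gt_eqF.
  by rewrite ler_wpM2l ?(ltW t0)// ler_wpM2l.
have h1 := hopf_lax_space p_gt1 psiB y z (ltW s0) st eta0.
have h2 := hopf_lax_space p_gt1 psiB z y (ltW s0) st eta0.
rewrite (metric_sym y z) in h2.
have Ey0 := hopf_lax_rate_ge0 p_gt1 psiB y (ltW s0) st.
case/andP: hE => hE1 hE2.
have Ey : hopf_lax_rate p psi s t y <= E + eta by move: hE1; clear; lra.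
have EE : E <= E + eta by rewrite lerDl ltW.
have k1 := le_trans h1 (key _ Ey0 Ey).
have k2 := le_trans h2 (key _ E0 EE).
by rewrite ler_norml k1 andbT lerNl opprB.
Qed.

(** A discrete Hamilton-Jacobi inequality. The exponent in [hopf_lax_grad] is [q^-1], so the [q]-th
    power is linear in the rate and can be integrated. *)
Lemma hopf_lax_grad_pow q s t z : p^-1 + q^-1 = 1 -> 0 < s -> s < t ->
  (grad (@mdist R X) (hopf_lax p psi t) z `^ q <=
   (t `^ q * (p * hopf_lax_rate p psi s t z))%:E)%E.
Proof.
move=> pq s0 st; have t0 : 0 < t by exact: lt_trans st.
have qE : q^-1 = p^-1 * (p - 1).
  by rewrite mulrBr mulVf ?gt_eqF// mulr1 -pq addrC addKr.
have q0 : 0 < q by rewrite -invr_gt0 qE mulr_gt0 ?invr_gt0// subr_gt0.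
set E := hopf_lax_rate p psi s t z.
have E0 : 0 <= E by exact: (hopf_lax_rate_ge0 p_gt1 psiB z (ltW s0) st).
have := hopf_lax_grad z s0 st; rewrite -/E -qE.
have pE0 : 0 <= p * E by rewrite mulr_ge0// ltW.
move=> /(@gt0_ler_poweR R q (ltW q0) _ _ _ _) h.
apply: le_trans (h _ _) _; rewrite ?in_itv /= ?leey ?andbT ?grad_ge0//.
  by rewrite lee_fin mulr_ge0 ?powR_ge0// ltW.
rewrite lee_fin (@powRM _ t ((p * E) `^ q^-1)) ?powR_ge0 ?(ltW t0)//.
by rewrite -powRrM mulVf ?gt_eqF// powRr1.
Qed.

End hopf_lax_gradient.

(** * Continuous induction and the decrease of a negative power *)

Section real_lemmas.
Context {R : realType}.
Implicit Types (s t h p : R).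

Definition eps_continuous (A : set R) (f : R -> R) :=
  forall x, A x -> forall e : R, 0 < e -> exists2 d : R, 0 < d &
    forall y, A y -> `|x - y| < d -> `|f x - f y| < e.

(** Continuous induction: the supremum of the times where [H] is at most [H 0] is such a time by
    continuity, and if it were less than 1 a step would lead beyond it. A step says nothing about
    the times that it jumps over. *)
Lemma le_end_of_steps (H : R -> R) : eps_continuous `[0, 1] H ->
  (forall t, 0 <= t < 1 -> exists t', [/\ t < t', t' <= 1 & H t' <= H t]) ->
  H 1 <= H 0.
Proof.
move=> cH step; pose S := [set t | 0 <= t <= 1 /\ H t <= H 0].
have S0 : S 0 by rewrite /S /= lexx ler01.
have hS : has_sup S.
  by split; [exists 0|exists 1 => t [/andP[]]].
pose s := sup S.
have s0 : 0 <= s by apply: (ub_le_sup hS.2).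
have s1 : s <= 1 by apply: (ge_sup hS.1) => t [/andP[]].
have s01 : s \in `[0, 1] by rewrite in_itv /= s0.
have Hs : H s <= H 0.
  rewrite leNgt; apply/negP => Hs.
  have [d d0 hd] := cH s s01 _ (ltac:(by rewrite subr_gt0) : 0 < H s - H 0).
  have [t [/andP[t0 t1] Ht] st] := sup_adherent d0 hS.
  have ts : t <= s by apply: (ub_le_sup hS.2); split => //; rewrite t0.
  have := hd t; rewrite /= in_itv /= t0 t1 => /(_ isT).
  rewrite ger0_norm ?subr_ge0// => /(_ ltac:(rewrite -/s in st; lra)).
  by rewrite ltr_norml; lra.
have [s_lt1|s1'] := ltP s 1; last by have -> : 1 = s by apply/eqP; rewrite eq_le s1'.
have [t' [st' t'1 Ht']] := step s ltac:(by rewrite s0).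
have : t' <= s.
  apply: (ub_le_sup hS.2); split; last exact: le_trans Hs.
  by rewrite t'1 (le_trans s0)// ltW.
by rewrite leNgt st'.
Qed.

(** A first-order expansion with explicit error. For r = s / (s + h), the tangent at 1 of r^(1-p)
    bounds the decrease below by (p - 1) h r^p s^(-p), and r^p >= 1 - p (1 - r) by convexity. *)
Lemma powR_time_coeff p s h : 1 < p -> 0 < s -> 0 <= h ->
  (p - 1) * h * (1 - p * (h / s)) * s `^ (- p) <= s `^ (1 - p) - (s + h) `^ (1 - p).
Proof.
move=> p1 s0 h0; have p0 : 0 < p by exact: lt_trans p1.
have sh0 : 0 < s + h by rewrite ltr_wpDr.
pose r := s / (s + h).
have r0 : 0 < r by rewrite divr_gt0.
have sE : s = (s + h) * r by rewrite /r mulrC divfK// gt_eqF.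
have e1 : s `^ (1 - p) = (s + h) `^ (1 - p) * r `^ (1 - p).
  by rewrite -powRM ?(ltW sh0) ?(ltW r0)// -sE.
have r1 : 1 - r = h / (s + h) by rewrite /r; field; rewrite gt_eqF.
have h1 := powR_inv_tangent p1 r0.
have h2 : 1 - p * (1 - r) <= r `^ p.
  have := powR_tangent p1 (ltW r0) ler01; rewrite !powR1 mulr1.
  rewrite -mulrBl ler_pdivrMr//; lra.
have e2 : r `^ p = s `^ p / (s + h) `^ p.
  rewrite {1}/r powRM ?(ltW s0) ?invr_ge0 ?(ltW sh0)//.
  by rewrite -powR_inv1 ?(ltW sh0)// -powRrM mulN1r powRN.
have e3 : (s + h) `^ (1 - p) = (s + h) / (s + h) `^ p.
  have -> : (s + h) `^ (1 - p) = (s + h) `^ 1 / (s + h) `^ p.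
    by apply: powRB; apply/implyP => _; rewrite gt_eqF.
  by rewrite powRr1// ltW.
have ps0 : 0 < s `^ p by exact: powR_gt0.
have psh0 : 0 < (s + h) `^ p by exact: powR_gt0.
apply: (@le_trans _ _ ((p - 1) * h * r `^ p * s `^ (- p))).
  rewrite ler_wpM2r ?powR_ge0// ler_wpM2l ?mulr_ge0 ?subr_ge0 ?(ltW p1)//.
  apply: le_trans h2; rewrite r1 lerD2l lerN2 ler_pM2l//.
  by rewrite ler_wpM2l// lef_pV2 ?posrE// lerDl.
have -> : s `^ (1 - p) - (s + h) `^ (1 - p) = (s + h) `^ (1 - p) * (r `^ (1 - p) - 1).
  by rewrite e1; ring.
apply: (@le_trans _ _ ((s + h) `^ (1 - p) * ((p - 1) * (1 - r)))); last first.
  by rewrite ler_wpM2l ?powR_ge0.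
rewrite e2 e3 powRN r1 le_eqVlt; apply/orP; left; apply/eqP.
by field; rewrite !gt_eqF.
Qed.

End real_lemmas.

Section geodesics.
Context {R : realType} {X : metricType R}.
Variables (rho : X -> X -> R).
Hypothesis rho_dist : is_distance rho.

(** The variation along the partition through [s] and [t] is at most [rho x y], which leaves no room
    for strictness in the triangle inequalities. *)
Lemma geodesic_split (gamma : R -> X) x y : gamma 0 = x -> gamma 1 = y ->
  curve_length rho 0 1 gamma = (rho x y)%:E ->
  forall s t, 0 <= s -> s <= t -> t <= 1 ->
    rho (gamma s) (gamma t) = rho x (gamma t) - rho x (gamma s).
Proof.
have [rho0 rhoE rhoC rhoD] := rho_dist => g0 g1 len s t.
(* Partitions are strictly increasing and end at 1, so [s = 0], [s = t] and [t = 1] are treated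
   apart. *)
rewrite le_eqVlt => /predU1P[<-|s0].
  by move=> _ _; rewrite g0 (rhoE x x).2// subr0.
rewrite le_eqVlt => /predU1P[<-|st].
  by move=> _; rewrite (rhoE _ _).2// subrr.
move=> t1; apply/eqP; rewrite eq_le; apply/andP; split; last first.
  by rewrite lerBlDl; exact: rhoD.
have var p : itv_partition 0 1 p -> curve_variation rho 0 1 gamma p <= rho x y.
  by move=> hp; rewrite -lee_fin -len; apply: ereal_sup_ubound; exists p.
have tri := rhoD x (gamma t) y.
move: t1; rewrite [t <= 1]le_eqVlt => /predU1P[t1|t1].
  move: st; rewrite t1 => st; have := var [:: s; 1].
  rewrite /itv_partition /= s0 st eqxx => /(_ (conj isT isT)).
  rewrite /curve_variation /= !big_nat_recl//= big_geq// g0 g1 addr0.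
  by rewrite lerBrDl.
have := var [:: s; t; 1]; rewrite /itv_partition /= s0 st t1 eqxx.
move=> /(_ (conj isT isT)).
rewrite /curve_variation /= !big_nat_recl//= big_geq// g0 g1 addr0; lra.
Qed.

End geodesics.

(** The final count of [hopf_lax_flow_step]: [kI] is the gain due to time, [I] the integral of the
    [q]-th power of the gradient, [a] the gradient after applying the operator, [D] the speed and
    [M] the bound D^p / p. *)
Lemma flow_step_arith {R : realType} (f1 g0 g1 kI a e' D h I qV M e : R) :
  f1 <= g1 - kI -> qV * h * (1 - e') * (I - e') <= kI ->
  g1 - g0 <= (a + e') * (D * h) -> 0 <= qV * h * (e' * e') ->
  D * a * h <= (M + qV * I) * h -> e' * (D + qV * I + qV + 1) * h <= e * h ->
  0 <= e' * h -> f1 - g0 <= (M + e) * h.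
Proof. lra. Qed.

(** * Growth of the averaged Hopf-Lax function over a short time and displacement *)

Section hopf_lax_flow.
Context {disp : measure_display} {R : realType}.
Context {X : completeBorelMetricType disp R}.
Variables (dt : X -> X -> R) (P : X -> probability X R).
Hypothesis dt_distance : is_distance dt.
Hypothesis feller : forall h : X -> R, bounded_measurable h -> continuous (Pop P h).

(** The gradient estimate made linear in the integral. It follows from the estimate for the exponent
    [p], and for every [p] from the one for [+oo], so both cases share the flow argument. *)
Definition young_estimate (p q : R) : Prop := forall g : X -> R,
  bounded_lipschitz g -> forall (x : X) (D : R), 0 <= D ->
  (D%:E * grad dt (Pop P g) x <=
   (D `^ p / p)%:E + q^-1%:E * \int[P x]_y (grad (@mdist R X) g y `^ q))%E.

Variables (p q B : R) (psi : X -> R).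
Hypothesis p_gt1 : 1 < p.
Hypothesis pq : p^-1 + q^-1 = 1.
Hypothesis psiB : forall w, `|psi w| <= B.
Hypothesis young_dt : young_estimate p q.

Let p_gt0 : 0 < p. Proof. exact: lt_trans p_gt1. Qed.

Lemma bounded_lipschitz_measurable (g : X -> R) : bounded_lipschitz g ->
  bounded_measurable g.
Proof.
move=> [[M [_ hM]] [L hL]]; split.
  exact/continuous_borel_measurable/lipschitz_continuous/hL.
by exists (M + 1) => x; apply: hM => //; rewrite ltrDl.
Qed.

Lemma bounded_lipschitz_grad (g : X -> R) : bounded_lipschitz g -> 0 < q ->
  exists G : X -> R, [/\ bounded_measurable G, forall z, 0 <= G z &
    forall z, (grad (@mdist R X) g z `^ q = (G z)%:E)%E].
Proof.
move=> [_ [L hL]] q0; have cg := lipschitz_continuous hL.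
pose L' := Num.max 0 L.
have hL' x y : `|g x - g y| <= L' * mdist x y.
  by rewrite (le_trans (hL x y))// ler_wpM2r ?mdist_ge0// le_max lexx orbT.
have L'0 : 0 <= L' by rewrite le_max lexx.
have gL z : (grad (@mdist R X) g z <= L'%:E)%E by exact: grad_le_lipschitz.
have gfin z : grad (@mdist R X) g z \is a fin_num.
  by rewrite ge0_fin_numE ?grad_ge0// (le_lt_trans (gL z)) ?ltry.
have GE z : (grad (@mdist R X) g z `^ q = (fine (grad (@mdist R X) g z) `^ q)%:E)%E.
  by rewrite -{1}(fineK (gfin z)).
exists (fun z => fine (grad (@mdist R X) g z) `^ q); split => //.
- split.
    apply: (@measurableT_comp _ _ _ _ _ _ (@powR R ^~ q)); first exact: measurable_powR.
    apply: (@measurableT_comp _ _ _ _ _ _ (@fine R)); first by [].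
    exact: grad_measurable.
  exists (L' `^ q) => z; rewrite ger0_norm ?powR_ge0//.
  apply: ge0_ler_powR; rewrite ?nnegrE ?(ltW q0)//.
    by rewrite fine_ge0 ?grad_ge0.
  by rewrite -lee_fin fineK.
- by move=> z; exact: powR_ge0.
Qed.

Let q_gt0 : 0 < q.
Proof.
rewrite -invr_gt0; have -> : q^-1 = 1 - p^-1 by rewrite -pq addrC addKr.
by rewrite subr_gt0 invf_lt1.
Qed.

Let qVE : q^-1 = (p - 1) / p.
Proof. by rewrite mulrBl divff ?gt_eqF// mul1r -pq addrC addKr. Qed.

(* With [t = s `^ (1 - p)], [hopf_lax p psi t] is the classical Hopf-Lax function
   [inf_w psi w + d(., w)^p / (p s^(p-1))] at time [s]. *)
Definition hopf_lax_flow (s : R) (x : X) : R :=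
  Pop P (hopf_lax p psi (s `^ (1 - p))) x.

(** At speed [D] the growth rate is at most D |grad P g| - P(|grad g|^q) / q up to [e], and
    [young_estimate] bounds this by D^p / p. *)
Lemma hopf_lax_flow_step s x0 D e : 0 < s -> 0 <= D -> 0 < e ->
  exists2 r : R, 0 < r & forall x1 h, 0 < h -> h < r -> mdist x0 x1 < r ->
    dt x0 x1 = D * h ->
    hopf_lax_flow (s + h) x1 - hopf_lax_flow s x0 <= (D `^ p / p + e) * h.
Proof.
move=> s0 D0 e0; pose t := s `^ (1 - p).
have t0 : 0 < t by exact: powR_gt0.
pose g := hopf_lax p psi t.
have blg : bounded_lipschitz g by exact: hopf_lax_bounded_lipschitz.
have bmg := bounded_lipschitz_measurable blg.
have [G [bG G0 GE]] := bounded_lipschitz_grad blg q_gt0.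
have IE x : (\int[P x]_y (grad (@mdist R X) g y `^ q) = (Pop P G x)%:E)%E.
  by rewrite /Pop bounded_integral_EFin//; apply: eq_integral => y _; rewrite GE.
have yg D1 : 0 <= D1 -> (D1%:E * grad dt (Pop P g) x0 <=
    (D1 `^ p / p + q^-1 * Pop P G x0)%:E)%E.
  by move=> D10; have := young_dt blg x0 D10; rewrite IE -EFinM -EFinD.
have afin : grad dt (Pop P g) x0 \is a fin_num.
  rewrite ge0_fin_numE ?grad_ge0//; have := yg 1 ler01; rewrite mul1e => h.
  by rewrite (le_lt_trans h) ?ltry.
pose a := fine (grad dt (Pop P g) x0).
have aE : grad dt (Pop P g) x0 = a%:E by rewrite fineK.
pose I := Pop P G x0.
have I0 : 0 <= I by rewrite -lee_fin -IE; apply: integral_ge0 => y _; exact: poweR_ge0.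
have Da : D * a <= D `^ p / p + q^-1 * I.
  by have := yg D D0; rewrite aE -EFinM lee_fin.
have qV0 : 0 < q^-1 by rewrite invr_gt0.
(* [c] dominates the coefficient of the error [e'] in the final count, and the bound 1/2 keeps
   [1 - e'] positive. *)
pose c := D + q^-1 * I + q^-1 + 1.
have c0 : 0 < c by rewrite /c ltr_wpDl// !addr_ge0// ?mulr_ge0// ltW.
pose e' := Num.min 2^-1 (e / c).
have e'0 : 0 < e' by rewrite lt_min invr_gt0 ltr0n divr_gt0.
have e'1 : e' < 1.
  by rewrite gt_min; apply/orP; left; rewrite invf_lt1 ?ltr1n.
have ce' : e' * c <= e by rewrite -ler_pdivlMr// ge_min lexx orbT.
have [r1 r10 hr1] : exists2 r : R, 0 < r &
    forall y, dt x0 y <= r -> `|Pop P g x0 - Pop P g y| <= (a + e') * dt x0 y.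
  by apply: grad_lt => //; rewrite aE lte_fin ltrDl.
have cG : continuous (Pop P G) by exact: feller.
have /cvgrPdist_lt/(_ _ e'0)/nbhs_mdistP[r2 r20 hr2] := cG x0.
(* The three radii ensure that the gradient bound at [x0] applies at distance [D * h], that
   [Pop P G] varies by less than [e'], and that [p * (h / s) <= e']. *)
pose r := Num.min (r1 / (D + 1)) (Num.min r2 (e' * s / p)).
have D10 : 0 < D + 1 by rewrite ltr_wpDl.
exists r; first by rewrite !lt_min r20 !divr_gt0// mulr_gt0.
move=> x1 h h0; rewrite !lt_min => /and3P[hr1' _ hrs] /and3P[_ xr2 _] dtE.
have dtr : dt x0 x1 <= r1.
  rewrite dtE; move: hr1'; rewrite ltr_pdivlMr// => hh.
  by apply: le_trans (ltW hh); rewrite mulrC ler_wpM2l ?(ltW h0)// lerDl.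
have k1 := hr1 _ dtr; rewrite dtE in k1.
have k2 := hr2 _ xr2; rewrite /= ltr_norml in k2.
have sh0 : 0 < s + h by rewrite addr_gt0.
pose t' := (s + h) `^ (1 - p).
have t'0 : 0 < t' by exact: powR_gt0.
have phs : p * (h / s) <= e'.
  by rewrite mulrA ler_pdivrMr// mulrC -ler_pdivlMr// ltW.
have coeff := powR_time_coeff p_gt1 s0 (ltW h0).
rewrite -/t -/t' in coeff.
have sp0 : 0 < s `^ (- p) by exact: powR_gt0.
have tq : t `^ q = s `^ (- p).
  rewrite /t -powRrM; congr (_ `^ _).
  have -> : q = p / (p - 1) by rewrite -[q]invrK qVE invf_div.
  by field; rewrite subr_eq0 gt_eqF.
have phe : 0 < 1 - p * (h / s) by rewrite subr_gt0 (le_lt_trans phs).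
have p10 : 0 < p - 1 by rewrite subr_gt0.
have tt' : t' < t.
  by rewrite -subr_gt0; apply: lt_le_trans coeff; rewrite !mulr_gt0.
(* [k] makes [hopf_lax_grad_pow] read: [k * G z] is at most the decrease at [z]. Since t^q = s^(-p),
   the powers of [s] cancel and [k] is at least [q^-1 * h] up to the factor [1 - e']. *)
pose k := (t - t') / (t `^ q * p).
have tq0 : 0 < t `^ q by exact: powR_gt0.
have k0 : 0 <= k by rewrite divr_ge0 ?mulr_ge0 ?subr_ge0 ?ltW// ?mulr_gt0.
have kge : q^-1 * h * (1 - e') <= k.
  rewrite /k ler_pdivlMr ?mulr_gt0//; apply: le_trans coeff.
  rewrite qVE tq.
  have -> : (p - 1) / p * h * (1 - e') * (s `^ (- p) * p) =
      (p - 1) * h * (1 - e') * s `^ (- p) by field; rewrite gt_eqF.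
  rewrite ler_wpM2r ?(ltW sp0)// ler_wpM2l ?mulr_ge0 ?(ltW p10) ?(ltW h0)//.
  by rewrite lerD2l lerN2.
have kG z : hopf_lax p psi t' z <= g z - k * G z.
  have := hopf_lax_grad_pow p_gt1 psiB z pq t'0 tt'; rewrite -/g GE lee_fin.
  rewrite /hopf_lax_rate -/g => hG.
  have := ler_wpM2l k0 hG.
  have -> : k * (t `^ q * (p * ((g z - hopf_lax p psi t' z) / (t - t')))) =
      g z - hopf_lax p psi t' z.
    by rewrite /k; field; rewrite !gt_eqF// subr_gt0.
  by rewrite !lerBrDr addrC.
have bm' : bounded_measurable (hopf_lax p psi t').
  exact/bounded_lipschitz_measurable/hopf_lax_bounded_lipschitz.
(* The increment is split at [Pop P g x1]: the gradient of [Pop P g] controls the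
   displacement, and the decrease in time compensates it by Young's inequality. *)
have k3 : hopf_lax_flow (s + h) x1 <= Pop P g x1 - k * Pop P G x1.
  rewrite /hopf_lax_flow /Pop -bounded_integralZ// -bounded_integralB//; last first.
    exact: bounded_measurableZ.
  apply: le_bounded_integral => //.
  by apply: bounded_measurableB => //; exact: bounded_measurableZ.
have I10 : 0 <= Pop P G x1.
  by apply: Rintegral_ge0 => y _; exact: G0.
have k4 : q^-1 * h * (1 - e') * (I - e') <= k * Pop P G x1.
  apply: (@le_trans _ _ (q^-1 * h * (1 - e') * Pop P G x1)).
    rewrite ler_wpM2l//; first by rewrite !mulr_ge0// ?subr_ge0 ltW.
    by case/andP: k2 => _ k2; rewrite lerBlDr -lerBlDl ltW.
  by rewrite ler_wpM2r.
have k5 : Pop P g x1 - Pop P g x0 <= (a + e') * (D * h).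
  by apply: le_trans k1; rewrite -normrN opprB ler_norm.
rewrite {2}/hopf_lax_flow -/t -/g.
have k6 : 0 <= q^-1 * h * (e' * e') by rewrite !mulr_ge0// ltW.
have k7 := ler_wpM2r (ltW h0) Da.
have k8 := ler_wpM2r (ltW h0) ce'.
have k9 : 0 <= e' * h by rewrite mulr_ge0// ltW.
exact: (flow_step_arith k3 k4 k5 k6 k7 k8 k9).
Qed.

End hopf_lax_flow.

(** * The dual inequality at a pair of points *)

Section dual_pointwise.
Context {disp : measure_display} {R : realType}.
Context {X : completeBorelMetricType disp R}.
Variables (dt : X -> X -> R) (P : X -> probability X R).
Hypothesis dt_distance : is_distance dt.
Hypothesis dt_continuous : continuous (fun z : X * X => dt z.1 z.2).
Hypothesis dt_geodesic : geodesic_distance dt.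
Hypothesis feller : forall h : X -> R, bounded_measurable h -> continuous (Pop P h).
Variables (p q : R).
Hypothesis p_gt1 : 1 < p.
Hypothesis pq : p^-1 + q^-1 = 1.
Hypothesis young_dt : young_estimate dt P p q.

Let p_gt0 : 0 < p. Proof. exact: lt_trans p_gt1. Qed.

Lemma continuous_dtr y : continuous (dt y).
Proof.
move=> w; have cdt := @dt_continuous (y, w).
have cyw : (y, u) @[u --> w] --> (y, w) by apply: cvg_pair => //=; exact: cvg_cst.
exact: (cvg_comp _ _ cyw cdt).
Qed.

Lemma continuous_powR_pos (a s : R) : 0 < s -> u `^ a @[u --> s] --> s `^ a.
Proof.
move=> s0; have : {near s, (fun u => expR (a * ln u)) =1 (fun u => u `^ a)}.
  near=> u; rewrite /powR gt_eqF//; near: u; exact: lt_nbhsr.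
move=> /near_eq_cvg /cvg_trans; apply.
rewrite /powR gt_eqF//; apply: continuous_cvg; first exact: continuous_expR.
by apply: cvgM; [exact: cvg_cst|exact: continuous_ln].
Unshelve. all: end_near. Qed.

(** For parameters at least 1, the bound of [hopf_lax_time] is uniform. Classical times at most 1
    correspond to such parameters. *)
Lemma hopf_lax_near_time (psi : X -> R) (B t t' : R) z :
  (forall w, `|psi w| <= B) -> 1 <= t -> 1 <= t' ->
  `|hopf_lax p psi t z - hopf_lax p psi t' z| <= 2 * B * `|t - t'|.
Proof.
move=> psiB; wlog tt' : t t' / t' <= t => [hw t1 t'1|t1 t'1].
  have [tt'|/ltW t't] := leP t' t; first exact: hw.
  by rewrite distrC [in X in _ <= X]distrC; exact: hw.
have t'0 : 0 < t' by exact: lt_le_trans t'1.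
rewrite !ger0_norm ?subr_ge0//; last by apply: (hopf_lax_mono p_gt1 psiB) => //; exact: ltW.
apply: le_trans (hopf_lax_time p_gt1 psiB z t'0 tt') _.
rewrite mulrC ler_wpM2r ?subr_ge0// ler_pdivrMr// ler_peMr// mulr_ge0//.
exact: le_trans (normr_ge0 _) (psiB z).
Qed.

(** The hypothesis says that [- phi] is below the Hopf-Lax function at time 1. It remains to compare
    the average of the latter at [x] with that of [psi] at [y], by following the flow from [y] to
    [x]. *)
Lemma dual_pointwise_pcost (phi psi : X -> R) x y :
  bounded_measurable phi -> bounded_measurable psi ->
  (forall z w, 0 <= phi z + psi w + pcost p z w) ->
  0 <= Pop P phi x + Pop P psi y + dt x y `^ p / p.
Proof.
move=> bphi bpsi hdual; have [dt0 dtE dtC dtD] := dt_distance.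
have [D0|Dpos] := eqVneq (dt x y) 0.
  have xy := (dtE x y).1 D0; rewrite D0 powR0 ?gt_eqF// mul0r addr0 -xy.
  rewrite /Pop -bounded_integralD//; apply: Rintegral_ge0 => z _.
  by have := hdual z z; rewrite pcostxx// addr0.
pose D := dt x y.
have D0 : 0 < D by rewrite lt_neqAle eq_sym Dpos dt0.
have [mpsi [B psiB]] := bpsi.
have B0 : 0 <= B by exact: le_trans (normr_ge0 _) (psiB x).
have [gamma [cgamma g0 g1] len] := dt_geodesic y x.
have lenS := geodesic_split dt_distance g0 g1 len.
pose l t := dt y (gamma t).
have l0 : l 0 = 0 by rewrite /l g0; apply/dtE.
have l1 : l 1 = D by rewrite /l g1 dtC.
have lmono s t : 0 <= s -> s <= t -> t <= 1 -> l s <= l t.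
  by move=> s0 st t1; rewrite -subr_ge0 -lenS.
have lD t : 0 <= t -> t <= 1 -> 0 <= l t <= D.
  by move=> t0 t1; rewrite /l dt0 -l1; exact: lmono.
(* The classical time runs from [s0] to 1, as s^(1-p) blows up at 0. The distance [D] is then
   covered at speed [D / (1 - s0)], and [s0] will tend to 0. *)
have key s0 : 0 < s0 < 1 ->
    Pop P (hopf_lax p psi 1) x <= Pop P psi y + (D / (1 - s0)) `^ p / p.
  move=> /andP[s00 s01]; have s0' : 0 < 1 - s0 by rewrite subr_gt0.
  pose D' := D / (1 - s0).
  have D'0 : 0 < D' by rewrite divr_gt0.
  (* Time is read off the distance already covered, since the parametrization of [gamma] is
     arbitrary; the speed is then exactly [D']. *)
  pose S t := s0 + l t / D'.
  have S0 : S 0 = s0 by rewrite /S l0 mul0r addr0.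
  have S1 : S 1 = 1 by rewrite /S l1 /D'; field; rewrite !gt_eqF.
  have Sge t : s0 <= S t by rewrite /S lerDl divr_ge0 ?dt0 ?(ltW D'0).
  have Spos t : 0 < S t by exact: lt_le_trans (Sge t).
  have Sle t : 0 <= t -> t <= 1 -> S t <= 1.
    by move=> t0 t1; rewrite -S1 /S lerD2l ler_pM2r ?invr_gt0//; exact: lmono.
  pose tau t := S t `^ (1 - p).
  have tau1 t : 0 <= t -> t <= 1 -> 1 <= tau t.
    move=> t0 t1; have h := powR_inv_tangent p_gt1 (Spos t).
    have : 0 <= (p - 1) * (1 - S t).
      by rewrite mulr_ge0// subr_ge0 ?(ltW p_gt1)// Sle.
    by move=> h'; have := le_trans h' h; rewrite subr_ge0.
  have cgammaP (t : R) : 0 <= t <= 1 ->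
      gamma u @[u --> within `[0, 1] (nbhs t)] --> gamma t.
    by move=> t01; move/subspace_continuousP : cgamma; apply; rewrite /= in_itv.
  have cl (t : R) : 0 <= t <= 1 -> l u @[u --> within `[0, 1] (nbhs t)] --> l t.
    move=> t01; have cdy := @continuous_dtr y (gamma t).
    exact: (cvg_comp _ _ (cgammaP t t01) cdy).
  have cS (t : R) : 0 <= t <= 1 -> S u @[u --> within `[0, 1] (nbhs t)] --> S t.
    move=> t01; apply: cvgD; first exact: cvg_cst.
    by apply: cvgM; [exact: cl|exact: cvg_cst].
  have ctau (t : R) : 0 <= t <= 1 -> tau u @[u --> within `[0, 1] (nbhs t)] --> tau t.
    move=> t01; have cp := @continuous_powR_pos (1 - p) _ (Spos t).
    exact: (cvg_comp _ _ (cS t t01) cp).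
  pose F t := hopf_lax_flow P p psi (S t) (gamma t).
  have bmHL t : 0 < t -> bounded_measurable (hopf_lax p psi t).
    by move=> t0; exact/bounded_lipschitz_measurable/hopf_lax_bounded_lipschitz.
  have tau0 t : 0 < tau t by exact: powR_gt0.
  (* The strong Feller property gives continuity in the point at a fixed time; the dependence on
     time is uniform in the point by [hopf_lax_near_time]. *)
  have cF (t : R) : 0 <= t <= 1 -> F u @[u --> within `[0, 1] (nbhs t)] --> F t.
    move=> t01; have cP := feller (bmHL _ (tau0 t)).
    have cP' : Pop P (hopf_lax p psi (tau t)) (gamma u)
        @[u --> within `[0, 1] (nbhs t)] --> F t.
      exact: (cvg_comp _ _ (cgammaP t t01) (cP (gamma t))).
    apply/cvgrPdist_lt => e e0.
    have e2 : 0 < e / 2 by rewrite divr_gt0.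
    have B1 : 0 < 2 * B + 1 by rewrite ltr_wpDl// mulr_ge0.
    have eB : 0 < e / 2 / (2 * B + 1) by rewrite divr_gt0.
    have n1 : \forall u \near within `[0, 1] (nbhs t),
        `|F t - Pop P (hopf_lax p psi (tau t)) (gamma u)| < e / 2.
      by move/cvgrPdist_lt : cP'; exact.
    have n2 : \forall u \near within `[0, 1] (nbhs t),
        `|tau t - tau u| < e / 2 / (2 * B + 1).
      by move/cvgrPdist_lt : (ctau t t01); exact.
    have n3 : \forall u \near within `[0, 1] (nbhs t), `[0, 1]%classic u.
      exact: withinT.
    near=> u.
    have u01 : 0 <= u <= 1.
      suff : `[0, 1]%classic u by rewrite /= in_itv.
      by near: u.
    have k1 : `|F t - Pop P (hopf_lax p psi (tau t)) (gamma u)| < e / 2 by near: u.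
    have k2 : `|tau t - tau u| < e / 2 / (2 * B + 1) by near: u.
    have k3 : `|Pop P (hopf_lax p psi (tau t)) (gamma u) - F u| <=
        2 * B * `|tau t - tau u|.
      rewrite /F /hopf_lax_flow -/(tau u) /Pop -bounded_integralB; [|exact: bmHL..].
      apply: bounded_integral_le_norm.
        by apply: bounded_measurableB; exact: bmHL.
      move=> z; apply: hopf_lax_near_time => //.
        by case/andP: t01 => *; exact: tau1.
      by case/andP: u01 => *; exact: tau1.
    have k4 : 2 * B * `|tau t - tau u| <= e / 2.
      apply: (@le_trans _ _ ((2 * B + 1) * `|tau t - tau u|)).
        by rewrite ler_wpM2r// lerDl.
      by move: k2; rewrite ltr_pdivlMr// mulrC => /ltW.
    have k5 := le_lt_trans (ler_distD (Pop P (hopf_lax p psi (tau t)) (gamma u)) (F t) (F u))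
      (ltr_leD k1 (le_trans k3 k4)).
    by rewrite -splitr in k5.
  pose M := D' `^ p / p.
  have M0 : 0 <= M by rewrite divr_ge0 ?powR_ge0 ?(ltW p_gt0).
  have main e : 0 < e -> F 1 - F 0 <= (M + e) * (1 - s0).
    move=> e0; pose H t := F t - (M + e) * S t.
    suff : H 1 <= H 0 by rewrite /H S0 S1 mulrBr mulr1; lra.
    apply: le_end_of_steps => [t t01 eps eps0|t /andP[t0 t1]].
      have {}t01 : 0 <= t <= 1 by move: t01; rewrite /= in_itv.
      have cH : H u @[u --> within `[0, 1] (nbhs t)] --> H t.
        apply: cvgB; first exact: cF.
        by apply: cvgM; [exact: cvg_cst|exact: cS].
      move/cvgrPdist_lt : cH => /(_ _ eps0)/nbhs_ballP[d /= d0 hd].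
      by exists d => // u u01 tu; exact: hd.
    (* The geodesic may pause. If [l] takes the same value later, the point is the same and [H] does
       not change; otherwise the distance increases strictly and the flow step applies. *)
    have [[t' [tt' t'1 lt']]|nl] := pselect (exists t', [/\ t < t', t' <= 1 & l t' = l t]).
      exists t'; split => //.
      have gtt' : gamma t = gamma t'.
        by apply/dtE; rewrite lenS ?(ltW tt')// -/(l t) -/(l t') lt' subrr.
      by rewrite /H /F /S lt' gtt'.
    have t01 : 0 <= t <= 1 by rewrite t0 ltW.
    have [r r0 hr] := hopf_lax_flow_step dt_distance feller p_gt1 pq psiB young_dt
      (gamma t) (Spos t) (ltW D'0) e0.
    have n1 : \forall u \near within `[0, 1] (nbhs t), mdist (gamma t) (gamma u) < r.
      by apply: (cgammaP t t01 [set w | mdist (gamma t) w < r]); apply/nbhs_mdistP; exists r.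
    have rD : 0 < r * D' by rewrite mulr_gt0.
    have n2 : \forall u \near within `[0, 1] (nbhs t), `|l t - l u| < r * D'.
      by move/cvgrPdist_lt : (cl t t01); exact.
    have n12 : nbhs t [set u | `[0, 1]%classic u ->
        mdist (gamma t) (gamma u) < r /\ `|l t - l u| < r * D'] by exact: filterI n1 n2.
    have /nbhs_ballP[d /= d0 hd] := n12.
    pose t' := Num.min 1 (t + d / 2).
    have tt' : t < t' by rewrite lt_min t1 ltrDl divr_gt0.
    have t'1 : t' <= 1 by rewrite ge_min lexx.
    have t'd : t' - t < d.
      rewrite ltrBlDl (@le_lt_trans _ _ (t + d / 2)) ?ge_min ?lexx ?orbT//.
      by rewrite ltrD2l ltr_pdivrMr// ltr_pMr// ltr1n.
    have [k1 k2] : mdist (gamma t) (gamma t') < r /\ `|l t - l t'| < r * D'.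
      apply: hd; first by rewrite /ball /= distrC ger0_norm// subr_ge0 ltW.
      by rewrite /= in_itv /= t'1 (le_trans t0)// ltW.
    have ltl : l t < l t'.
      rewrite lt_neqAle lmono ?(ltW tt')// andbT; apply/eqP => ll.
      by apply: nl; exists t'.
    exists t'; split => //.
    pose h := (l t' - l t) / D'.
    have h0 : 0 < h by rewrite divr_gt0// subr_gt0.
    have St' : S t' = S t + h by rewrite /S /h; field; rewrite gt_eqF.
    have := hr (gamma t') h h0; rewrite -St' => /(_ _ k1).
    rewrite lenS ?(ltW tt')// -/(l t) -/(l t').
    have -> : l t' - l t = D' * h by rewrite /h mulrC divfK// gt_eqF.
    have hr' : h < r.
      by rewrite /h ltr_pdivrMr// -(gtr0_norm (x := l t' - l t)) ?subr_gt0// distrC.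
    move=> /(_ hr' erefl); rewrite -/(F t') -/(F t) -/M /H St' mulrDr; lra.
  have F1 : F 1 = Pop P (hopf_lax p psi 1) x.
    by rewrite /F /hopf_lax_flow S1 powR1 g1.
  have F0 : F 0 <= Pop P psi y.
    rewrite /F /hopf_lax_flow g0 -/(tau 0); apply: le_bounded_integral => //.
      exact: bmHL.
    by move=> z; apply: (hopf_lax_le_psi p_gt1 psiB); exact: ltW.
  rewrite -F1; apply: (@le_trans _ _ (F 0 + M)); last by rewrite lerD2r.
  apply/ler_addgt0Pr => e e0; have := main e e0.
  have : (M + e) * (1 - s0) <= M + e.
    by rewrite ler_piMr ?addr_ge0 ?(ltW e0)// lerBlDr lerDl ltW.
  lra.
have HL1 : Pop P (hopf_lax p psi 1) x <= Pop P psi y + D `^ p / p.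
  apply/ler_addgt0Pr => e e0.
  have [d d0 hd] := powR_upper_cont (ltW D0) p_gt0 (mulr_gt0 e0 p_gt0).
  have Dd : 0 < D + d by rewrite addr_gt0.
  (* This [s0] turns the speed [D / (1 - s0)] into [D + d]. *)
  have := key (d / (D + d)); rewrite divr_gt0//= ltr_pdivrMr// mul1r ltrDr => /(_ D0).
  have -> : D / (1 - d / (D + d)) = D + d.
    by field; rewrite gt_eqF//= addrK gt_eqF.
  have := hd (D + d) (ltW Dd) (lexx _).
  rewrite -(ler_pM2r (x := p^-1)) ?invr_gt0// mulrDl mulfK ?gt_eqF//.
  by move=> h1 h2; apply: le_trans h2 _; rewrite -addrA lerD2l.
have bHL : bounded_measurable (hopf_lax p psi 1).
  exact/bounded_lipschitz_measurable/hopf_lax_bounded_lipschitz.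
have : - Pop P phi x <= Pop P (hopf_lax p psi 1) x.
  have -> : - Pop P phi x = \int[P x]_z (- phi z).
    by rewrite /Pop -mulN1r -bounded_integralZ//; apply: eq_Rintegral => z _; rewrite mulN1r.
  apply: le_bounded_integral => //; first exact: bounded_measurableN.
  move=> z; apply: (hopf_lax_ge p_gt1 psiB) => // w; rewrite mul1r.
  by have := hdual z w; lra.
by rewrite -/D; lra.
Unshelve. all: end_near.
Qed.

End dual_pointwise.

(** * From gradient estimates to Wasserstein controls *)

Section coupling_integrals.
Context {disp : measure_display} {R : realType}.
Context {X : completeBorelMetricType disp R}.
Implicit Types (mu nu : probability X R) (pi : probability (X * X)%type R).

Lemma bounded_measurable_fst (f : X -> R) : bounded_measurable f ->
  bounded_measurable (fun z : X * X => f z.1).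
Proof.
move=> [mf [M hM]]; split; last by exists M => z; exact: hM.
exact: (measurableT_comp mf measurable_fst).
Qed.

Lemma bounded_measurable_snd (f : X -> R) : bounded_measurable f ->
  bounded_measurable (fun z : X * X => f z.2).
Proof.
move=> [mf [M hM]]; split; last by exists M => z; exact: hM.
exact: (measurableT_comp mf measurable_snd).
Qed.

Lemma coupling_integral_fst mu (nu : set X -> \bar R) pi (f : X -> R) :
  coupling mu nu pi -> bounded_measurable f ->
  \int[pi]_z f z.1 = \int[mu]_x f x.
Proof.
move=> cp bf; rewrite /Rintegral; congr fine.
transitivity (\int[pushforward pi fst]_x (f x)%:E)%E.
  rewrite integral_pushforward//=; first by case: bf => /measurable_EFinP.
  exact: (bounded_measurable_integrable pi (bounded_measurable_fst bf)).
apply: eq_measure_integral => A mA _ /=.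
rewrite -(cp A mA).1 /pushforward; congr (pi _).
by apply/seteqP; split=> [[x y] //=|[x y] []].
Qed.

Lemma coupling_integral_snd (mu : set X -> \bar R) nu pi (f : X -> R) :
  coupling mu nu pi -> bounded_measurable f ->
  \int[pi]_z f z.2 = \int[nu]_x f x.
Proof.
move=> cp bf; rewrite /Rintegral; congr fine.
transitivity (\int[pushforward pi snd]_x (f x)%:E)%E.
  rewrite integral_pushforward//=; first by case: bf => /measurable_EFinP.
  exact: (bounded_measurable_integrable pi (bounded_measurable_snd bf)).
apply: eq_measure_integral => A mA _ /=.
rewrite -(cp A mA).2 /pushforward; congr (pi _).
by apply/seteqP; split=> [[x y] //=|[x y] []].
Qed.

End coupling_integrals.

Section plan_transfer.
Context {disp : measure_display} {R : realType}.
Context {X : completeBorelMetricType disp R}.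
Variables (v : {measure set X -> \bar R}) (P : X -> probability X R).
Hypothesis sX : separable_space X.
Hypothesis cd : continuous_density v P.

(* Duality is applied to the images of [mu] and [nu] themselves, which avoids a
   measurable selection of optimal plans between the kernels. *)
Lemma plan_transfer (mu nu : probability X R) (pi0 : probability (X * X)%type R)
    (c : X -> X -> R) (e : X * X -> \bar R) (C d : R) :
  (forall x y, 0 <= c x y) -> 0 <= C ->
  measurable_fun [set: X * X] e -> (forall z, 0 <= e z)%E ->
  coupling mu nu pi0 -> (\int[pi0]_z e z <= C%:E)%E ->
  (forall (phi psi : X -> R) (t : R), bounded_measurable phi ->
    bounded_measurable psi -> 0 <= t ->
    (forall x y, 0 <= phi x + psi y + t * c x y) ->
    forall x y, ((- (Pop P phi x + Pop P psi y))%:E <= t%:E * e (x, y))%E) ->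
  0 < d ->
  exists pi : probability (X * X)%type R, coupling (Pstar P mu) (Pstar P nu) pi /\
    forall h : X * X -> \bar R, measurable_fun [set: X * X] h ->
      (forall z, (0 <= h z)%E) ->
      (forall x y x' y', mdist x x' < d -> mdist y y' < d ->
         (h (x, y) <= (c x' y')%:E)%E) ->
      (\int[pi]_z h z <= C%:E)%E.
Proof.
move=> c0 C0 me e0 cp eC hP d0.
have [mu' [mu'E mu'I]] := Pstar_probability cd mu.
have [nu' [nu'E nu'I]] := Pstar_probability cd nu.
have [|pi [cpi hpi]] := @kantorovich_coupling _ _ _ mu' nu' c C d sX c0 C0 _ d0.
  move=> phi psi t bphi bpsi t0 hdual.
  have bP1 := Pop_bounded_measurable cd bphi.
  have bP2 := Pop_bounded_measurable cd bpsi.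
  rewrite mu'I// nu'I// -(coupling_integral_fst cp bP1) -(coupling_integral_snd cp bP2).
  have b1 := bounded_measurable_fst bP1; have b2 := bounded_measurable_snd bP2.
  rewrite -bounded_integralD//; set f := fun z : X * X => Pop P phi z.1 + Pop P psi z.2.
  have bf : bounded_measurable f by exact: bounded_measurableD.
  have bN := bounded_measurableN bf.
  (* The positive part allows a comparison with the possibly infinite cost [e] by monotonicity for
     nonnegative functions. *)
  have bfp : bounded_measurable (fun z => Num.max (- f z) 0).
    case: bN => mN [M hM]; split.
      by apply: measurable_maxr => //; exact: measurable_cst.
    exists M => z; rewrite ger0_norm ?le_max ?lexx ?orbT// ge_max.
    by rewrite (le_trans (ler_norm _) (hM z)) (le_trans (normr_ge0 _) (hM z)).
  suff : \int[pi0]_z Num.max (- f z) 0 <= t * C.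
    have : \int[pi0]_z (- f z) <= \int[pi0]_z Num.max (- f z) 0.
      by apply: le_bounded_integral => // z; rewrite le_max lexx.
    have -> : \int[pi0]_z (- f z) = - \int[pi0]_z f z.
      by rewrite -mulN1r -bounded_integralZ//; apply: eq_Rintegral => z _; rewrite mulN1r.
    lra.
  rewrite -lee_fin bounded_integral_EFin// EFinM.
  apply: (@le_trans _ _ (t%:E * \int[pi0]_z e z)%E); last first.
    by rewrite lee_wpmul2l// lee_fin.
  rewrite -ge0_integralZl_EFin//; apply: ge0_le_integral => //.
  - by move=> z _; rewrite lee_fin le_max lexx orbT.
  - by case: bfp => /measurable_EFinP.
  - by apply: emeasurable_funM => //; exact: measurable_cst.
  - move=> [x y] _; rewrite EFin_max ge_max; apply/andP; split.
      exact: (hP phi psi t bphi bpsi t0 hdual x y).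
    by rewrite mule_ge0// lee_fin.
exists pi; split=> // A mA; have [h1 h2] := cpi A mA.
by rewrite h1 h2 mu'E// nu'E.
Qed.

End plan_transfer.

Section wasserstein_bounds.
Context {disp : measure_display} {R : realType}.
Context {X : completeBorelMetricType disp R}.
Local Open Scope ereal_scope.

Lemma wasserstein_lb (rho : X -> X -> R) p (mu nu : set X -> \bar R) pi :
  coupling mu nu pi -> wasserstein rho p mu nu <= 'N[pi]_p[(fun z => (rho z.1 z.2)%:E)].
Proof. by move=> cp; apply: ereal_inf_lbound; exists pi. Qed.

Lemma measurable_mdist (x0 : X) : separable_space X ->
  measurable_fun [set: X * X] (fun z : X * X => mdist z.1 z.2).
Proof. by move=> sX; apply: (continuous_product_measurable x0 sX); exact: continuous_mdist. Qed.

(* [mdist] minus twice the mesh of the partition behind [kantorovich_coupling] *)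
Definition shrunk_dist (d : R) (z : X * X) : R :=
  (Num.max (mdist z.1 z.2 - 2 * d) 0)%R.

Lemma shrunk_dist_le d x y x' y' : (mdist x x' < d -> mdist y y' < d ->
  shrunk_dist d (x, y) <= mdist x' y')%R.
Proof.
move=> xx' yy'; rewrite /shrunk_dist /= ge_max mdist_ge0 andbT.
have h1 := metric_triangle x x' y; have h2 := metric_triangle x' y' y.
rewrite (metric_sym y' y) in h2; lra.
Qed.

(** Minkowski's inequality gives back the [2 * d] that [shrunk_dist] removed. *)
Lemma Lnorm_mdist_le (x0 : X) (pi : probability (X * X)%type R) (p d C : R) :
  separable_space X -> (1 <= p)%R -> (0 <= d)%R -> (0 <= C)%R ->
  \int[pi]_z (shrunk_dist d z `^ p)%:E <= (C `^ p)%:E ->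
  'N[pi]_p%:E[(fun z => (mdist z.1 z.2)%:E)] <= (C + 2 * d)%:E.
Proof.
move=> sX p1 d0 C0 hC; have p0 : (0 < p)%R by exact: lt_le_trans p1.
have pV0 : (0 <= p^-1)%R by rewrite invr_ge0 ltW.
have mm := measurable_mdist x0 sX.
have ms : measurable_fun [set: X * X] (shrunk_dist d).
  apply: measurable_maxr; last exact: measurable_cst.
  by apply: measurable_funB => //; exact: measurable_cst.
have s0 z : (0 <= shrunk_dist d z)%R by rewrite /shrunk_dist le_max lexx orbT.
have mcst : measurable_fun [set: X * X] (cst (2 * d)%R) by exact: measurable_cst.
apply: (@le_trans _ _ ('N[pi]_p%:E[EFin \o (shrunk_dist d \+ cst (2 * d))%R])).
  rewrite unlock; apply: gt0_ler_poweR; first exact: pV0.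
  - by rewrite in_itv /= leey andbT integral_ge0// => z _; exact: poweR_ge0.
  - by rewrite in_itv /= leey andbT integral_ge0// => z _; exact: poweR_ge0.
  apply: ge0_le_integral => //.
  - by move=> z _; exact: poweR_ge0.
  - apply/measurable_EFinP; apply: (@measurableT_comp _ _ _ _ _ _ (@powR R ^~ p)).
      exact: measurable_powR.
    exact: measurableT_comp.
  - apply/measurable_EFinP; apply: (@measurableT_comp _ _ _ _ _ _ (@powR R ^~ p)).
      exact: measurable_powR.
    by apply: measurableT_comp => //; exact: measurable_funD.
  - move=> z _; rewrite lee_fin; apply: ge0_ler_powR; rewrite ?nnegrE ?(ltW p0)//=.
    rewrite !ger0_norm ?mdist_ge0 ?addr_ge0 ?mulr_ge0//.
    by rewrite /shrunk_dist -lerBlDr le_max lexx.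
apply: (le_trans (minkowski_EFin pi ms mcst p1)).
rewrite EFinD; apply: leeD.
  rewrite unlock.
  have -> : C%:E = ((C `^ p)%:E) `^ p^-1.
    by rewrite poweR_EFin -powRrM divff ?gt_eqF// powRr1.
  apply: gt0_ler_poweR; first exact: pV0.
  - by rewrite in_itv /= leey andbT integral_ge0// => z _; exact: poweR_ge0.
  - by rewrite in_itv /= leey andbT lee_fin powR_ge0.
  apply: le_trans hC; rewrite le_eqVlt; apply/orP; left; apply/eqP.
  by apply: eq_integral => z _ /=; rewrite ger0_norm.
rewrite unlock (eq_integral (cst ((2 * d) `^ p)%:E)).
  rewrite integral_cst// probability_measure_setT mule1 poweR_EFin -powRrM divff ?gt_eqF//.
  by rewrite powRr1// mulr_ge0.
by move=> z _ /=; rewrite ger0_norm// mulr_ge0.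
Qed.

End wasserstein_bounds.

(** * From local Lipschitz constants to increments along curves *)

Section lipschitz_along_curves.
Context {R : realType} {X : metricType R}.
Variables (rho : X -> X -> R).
Hypothesis rho_dist : is_distance rho.
Hypothesis rho_cont : forall x, continuous (rho x).

(** A recursive form of [curve_variation], convenient for appending a point to a partition. *)
Fixpoint chain_length (gamma : R -> X) (s : R) (p : seq R) : R :=
  if p is t :: p' then rho (gamma s) (gamma t) + chain_length gamma t p' else 0.

Lemma curve_variationE gamma s t p :
  curve_variation rho s t gamma p = chain_length gamma s p.
Proof.
elim: p s => [|u p IH] s; first by rewrite /curve_variation big_geq.
by rewrite /curve_variation [size _]/= big_nat_recl//= -IH.
Qed.

Lemma chain_length_rcons gamma s p t : chain_length gamma s (rcons p t) =
  chain_length gamma s p + rho (gamma (last s p)) (gamma t).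
Proof. by elim: p s => [|u p IH] s /=; rewrite ?addr0 ?add0r// IH addrA. Qed.

(** The radius on which the local bound holds depends on the point, so a suitable partition is built
    by continuous induction. The slack [e] is needed because the local bound holds only with
    constants greater than [K]. *)
Lemma lipschitz_of_grad (f : X -> R) (gamma : R -> X) x y (K l : R) :
  0 <= K -> (forall z, (grad rho f z <= K%:E)%E) -> joins gamma x y ->
  (curve_length rho 0 1 gamma <= l%:E)%E -> `|f x - f y| <= K * l.
Proof.
have [rho0 rhoE rhoC rhoD] := rho_dist => K0 hK [cg g0 g1] len.
have l0 : 0 <= l.
  rewrite -lee_fin; apply: le_trans len; apply: ereal_sup_ge.
  exists (curve_variation rho 0 1 gamma [:: 1])%:E.
    by exists [:: 1] => //=; split; rewrite /= ?ltr01.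
  by rewrite curve_variationE /= addr0 lee_fin.
suff main e : 0 < e -> `|f x - f y| <= (K + e) * l.
  apply/ler_addgt0Pr => e e0.
  have l1 : 0 < l + 1 by rewrite ltr_wpDl.
  have := main (e / (l + 1)) (divr_gt0 e0 l1) => h; apply: le_trans h _.
  rewrite mulrDl lerD2l mulrAC ler_pdivrMr// ler_pM2l//; lra.
move=> e0; pose K' := K + e.
have K'0 : 0 <= K' by rewrite addr_ge0// ltW.
have loc (t : R) : 0 <= t <= 1 -> exists2 d : R, 0 < d & forall u, 0 <= u <= 1 ->
    `|t - u| < d -> `|f (gamma t) - f (gamma u)| <= K' * rho (gamma t) (gamma u).
  move=> t01; have [r r0 hr] : exists2 r : R, 0 < r & forall z,
      rho (gamma t) z <= r -> `|f (gamma t) - f z| <= K' * rho (gamma t) z.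
    by apply: grad_lt => //; apply: le_lt_trans (hK _) _; rewrite lte_fin ltrDl.
  have cgt : gamma u @[u --> within `[0, 1] (nbhs t)] --> gamma t.
    by move/subspace_continuousP : cg; apply; rewrite /= in_itv.
  have cr := cvg_comp _ _ cgt (@rho_cont (gamma t) (gamma t)).
  rewrite (rhoE _ _).2// in cr.
  move/cvgrPdist_lt : cr => /(_ _ r0)/nbhs_ballP[d /= d0 hd].
  exists d => // u u01 tu; apply: hr.
  have := hd u tu; rewrite /= in_itv /= => /(_ u01).
  by rewrite sub0r normrN ger0_norm// => /ltW.
pose S := [set t | 0 <= t <= 1 /\ exists p, [/\ path <%R 0 p, last 0 p = t &
  `|f (gamma 0) - f (gamma t)| <= K' * chain_length gamma 0 p]].
have S0 : S 0.
  split; first by rewrite lexx ler01.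
  by exists [::]; split => //=; rewrite subrr normr0 mulr0.
have hS : has_sup S by split; [exists 0|exists 1 => t [/andP[]]].
pose s := sup S.
have s0 : 0 <= s by apply: (ub_le_sup hS.2).
have s1 : s <= 1 by apply: (ge_sup hS.1) => t [/andP[]].
have s01 : 0 <= s <= 1 by rewrite s0.
have ext t u : S t -> t < u -> u <= 1 ->
    `|f (gamma t) - f (gamma u)| <= K' * rho (gamma t) (gamma u) -> S u.
  move=> [/andP[t0 _] [p [pp lp fp]]] tu u1 fu.
  split; first by rewrite u1 (le_trans t0)// ltW.
  exists (rcons p u); split; first by rewrite rcons_path pp lp.
    by rewrite last_rcons.
  rewrite chain_length_rcons lp mulrDr.
  by apply: le_trans (ler_distD (f (gamma t)) _ _) _; exact: lerD.
have [d d0 hd] := loc s s01.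
(* The local estimate centred at [s] is used backwards, from points of [S] just below [s]; it then
   also leads beyond [s]. *)
have Ss : S s.
  have [t St st] := sup_adherent d0 hS.
  have ts : t <= s by exact: (ub_le_sup hS.2).
  move: (ts); rewrite le_eqVlt => /predU1P[<-//|ts'].
  apply: (ext t) => //; rewrite distrC rhoC; apply: hd; first by case: St.
  by rewrite ger0_norm ?subr_ge0// ltrBlDr -ltrBlDl.
have [s_lt1|s_ge1] := ltP s 1.
  pose u := Num.min 1 (s + d / 2).
  have su : s < u by rewrite lt_min s_lt1 ltrDl divr_gt0.
  have u1 : u <= 1 by rewrite ge_min lexx.
  have : S u.
    apply: (ext s) => //; apply: hd; first by rewrite u1 (le_trans s0)// ltW.
    rewrite distrC ger0_norm ?subr_ge0 ?(ltW su)// ltrBlDl.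
    rewrite (@le_lt_trans _ _ (s + d / 2)) ?ge_min ?lexx ?orbT//.
    by rewrite ltrD2l ltr_pdivrMr// ltr_pMr// ltr1n.
  by move/(ub_le_sup hS.2); rewrite -/s leNgt su.
have s_eq1 : s = 1 by apply/eqP; rewrite eq_le s1.
move: Ss; rewrite s_eq1 => -[_ [p [pp lp]]]; rewrite g0 g1 => /le_trans; apply.
rewrite ler_wpM2l// -lee_fin; apply: le_trans len; apply: ereal_sup_ubound.
exists p; last by rewrite curve_variationE.
by split; rewrite ?lp.
Qed.

End lipschitz_along_curves.

Section gradient_to_pointwise.
Context {disp : measure_display} {R : realType}.
Context {X : completeBorelMetricType disp R}.
Variables (dt : X -> X -> R) (P : X -> probability X R).
Hypothesis dt_distance : is_distance dt.
Hypothesis dt_continuous : continuous (fun z : X * X => dt z.1 z.2).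
Hypothesis dt_geodesic : geodesic_distance dt.
Hypothesis feller : forall h : X -> R, bounded_measurable h -> continuous (Pop P h).

(** Dividing by [t * p] gives the cost [pcost]. For [t = 0] this is impossible, and a small positive
    multiplier is used instead. *)
Lemma dual_pointwise (p q t : R) (phi psi : X -> R) : 1 < p -> p^-1 + q^-1 = 1 ->
  young_estimate dt P p q -> 0 <= t ->
  bounded_measurable phi -> bounded_measurable psi ->
  (forall z w, 0 <= phi z + psi w + t * mdist z w `^ p) ->
  forall x y, 0 <= Pop P phi x + Pop P psi y + t * dt x y `^ p.
Proof.
move=> p1 pq yg t0 bphi bpsi hdual x y; have p0 : 0 < p by exact: lt_trans p1.
have main u : 0 < u -> (forall z w, 0 <= phi z + psi w + u * mdist z w `^ p) ->
    0 <= Pop P phi x + Pop P psi y + u * dt x y `^ p.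
  move=> u0 hu; have c0 : 0 < (u * p)^-1 by rewrite invr_gt0 mulr_gt0.
  have E a b d : a / (u * p) + b / (u * p) + d / p = (a + b + u * d) / (u * p) :> R.
    by field; rewrite !gt_eqF.
  have := @dual_pointwise_pcost _ _ _ dt P dt_distance dt_continuous dt_geodesic
    feller p q p1 pq yg (fun z => (u * p)^-1 * phi z) (fun z => (u * p)^-1 * psi z)
    x y (bounded_measurableZ _ bphi) (bounded_measurableZ _ bpsi).
  rewrite /Pop !bounded_integralZ// ![(u * p)^-1 * _]mulrC E pmulr_lge0//.
  apply=> z w; rewrite ![(u * p)^-1 * _]mulrC /pcost E.
  by rewrite mulr_ge0// ltW.
move: t0; rewrite le_eqVlt => /predU1P[t0|t0]; last exact: main.
rewrite -t0 mul0r addr0; apply/ler_addgt0Pr => e e0.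
have d0 : 0 < dt x y `^ p + 1 by rewrite ltr_wpDl ?powR_ge0.
have u0 : 0 < e / (dt x y `^ p + 1) by rewrite divr_gt0.
have := main _ u0; have : e / (dt x y `^ p + 1) * dt x y `^ p <= e.
  by rewrite mulrAC ler_pdivrMr// ler_pM2l// lerDl.
move=> h1 h2; apply: le_trans (h2 _) _; last by rewrite lerD2l.
move=> z w; apply: le_trans (hdual z w) _.
by rewrite -t0 mul0r addr0 lerDl mulr_ge0 ?powR_ge0// ltW.
Qed.

(** As in Kantorovich-Rubinstein duality, the inf-convolution [u] of [psi] with the cost is
    [t]-Lipschitz and lies between [- phi] and [psi]. A single function then suffices, with no
    flow. *)
Lemma dual_pointwise1 (t : R) (phi psi : X -> R) :
  (forall f, bounded_lipschitz f ->
     (grad_norm dt (Pop P f) <= grad_norm (@mdist R X) f)%E) ->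
  0 <= t -> bounded_measurable phi -> bounded_measurable psi ->
  (forall z w, 0 <= phi z + psi w + t * mdist z w) ->
  forall x y, 0 <= Pop P phi x + Pop P psi y + t * dt x y.
Proof.
move=> ge t0 bphi bpsi hdual x y; have [_ [M hM]] := bphi; have [_ [B hB]] := bpsi.
have psi_ge w : - B <= psi w by have := hB w; rewrite ler_norml => /andP[].
have psi_le w : psi w <= B by have := hB w; rewrite ler_norml => /andP[].
pose u z := inf [set psi w + t * mdist z w | w in [set: X]].
have hu z : has_inf [set psi w + t * mdist z w | w in [set: X]].
  split; first by exists (psi z + t * mdist z z), z.
  exists (- B) => _ [w _ <-]; rewrite (le_trans (psi_ge w))// lerDl.
  by rewrite mulr_ge0// mdist_ge0.
have ule z w : u z <= psi w + t * mdist z w by apply: ge_inf; [exact: (hu z).2|exists w].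
have uge z r : (forall w, r <= psi w + t * mdist z w) -> r <= u z.
  by move=> h; apply: lb_le_inf; [exact: (hu z).1|move=> _ [w _ <-]].
have upsi z : u z <= psi z by have := ule z z; rewrite mdistxx mulr0 addr0.
have uphi z : - phi z <= u z by apply: (uge) => w; have := hdual z w; lra.
have half z z' : u z - u z' <= t * mdist z z'.
  rewrite lerBlDr -lerBlDl; apply: (uge) => w; rewrite lerBlDl.
  apply: le_trans (ule z w) _; rewrite addrCA -mulrDr lerD2l ler_wpM2l//.
  exact: metric_triangle.
have ulip z z' : `|u z - u z'| <= t * mdist z z'.
  by rewrite ler_norml half andbT lerNl opprB metric_sym.
have bu : bounded_lipschitz u.
  split; last by exists t.
  exists B; split; first exact: num_real.
  move=> r Br z _ /=; apply: le_trans (ltW Br); rewrite ler_norml.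
  rewrite (le_trans (upsi z))// andbT; apply: (uge) => w.
  by rewrite (le_trans (psi_ge w))// lerDl mulr_ge0// mdist_ge0.
have bmu := bounded_lipschitz_measurable bu.
have gP z : (grad dt (Pop P u) z <= t%:E)%E.
  apply: (@le_trans _ _ (grad_norm dt (Pop P u))).
    by apply: ereal_sup_ubound; exists z.
  apply: le_trans (ge _ bu) _; apply: ge_ereal_sup => _ [w _ <-].
  exact: grad_le_lipschitz.
have [gamma jg len] := dt_geodesic x y.
have cdt := continuous_dtr dt_continuous.
have len' : (curve_length dt 0 1 gamma <= (dt x y)%:E)%E by rewrite len.
have := lipschitz_of_grad dt_distance cdt t0 gP jg len'.
have P1 : - Pop P phi x <= Pop P u x.
  have -> : - Pop P phi x = \int[P x]_z (- phi z).
    by rewrite /Pop -mulN1r -bounded_integralZ//; apply: eq_Rintegral => z _; rewrite mulN1r.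
  by apply: le_bounded_integral => //; exact: bounded_measurableN.
have P2 : Pop P u y <= Pop P psi y by exact: le_bounded_integral.
by rewrite ler_norml => /andP[_ h]; lra.
Qed.

(** The gap between [m] and [m'] makes the ratio [dt x y / m'] less than 1, so its powers tend to 0
    and the cost term vanishes. *)
Lemma dual_pointwise_infty (t m m' : R) (phi psi : X -> R) :
  (forall p q, 1 < p -> p^-1 + q^-1 = 1 -> young_estimate dt P p q) ->
  0 <= t -> 0 <= m -> m < m' -> bounded_measurable phi -> bounded_measurable psi ->
  (forall z w, 0 <= phi z + psi w + t * (m' < mdist z w)%R%:R) ->
  forall x y, dt x y <= m -> 0 <= Pop P phi x + Pop P psi y.
Proof.
move=> yg t0 m0 mm' bphi bpsi hdual x y xym.
have [dt0 _ _ _] := dt_distance.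
have m'0 : 0 < m' by exact: le_lt_trans mm'.
pose r := dt x y / m'.
have r0 : 0 <= r by rewrite divr_ge0// ltW.
have r1 : r < 1 by rewrite ltr_pdivrMr// mul1r (le_lt_trans xym).
(* The indicator of [m' < d] is at most [(d / m') `^ p], and [p] tends to
   infinity. *)
have main n : 0 <= Pop P phi x + Pop P psi y + t * r ^+ n.+2.
  pose p : R := n.+2%:R.
  have p1 : 1 < p by rewrite ltr1n.
  have p0 : 0 < p by exact: lt_trans p1.
  pose q := p / (p - 1).
  have pq : p^-1 + q^-1 = 1.
    by rewrite /q invf_div; field; rewrite gt_eqF.
  have m'p : 0 < m' `^ p by exact: powR_gt0.
  have tm : 0 <= t / m' `^ p by rewrite divr_ge0// ltW.
  have := dual_pointwise p1 pq (yg p q p1 pq) tm bphi bpsi _ x y.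
  have -> : t / m' `^ p * dt x y `^ p = t * r ^+ n.+2.
    rewrite -(powR_mulrn _ r0) /r powRM// ?invr_ge0 ?(ltW m'0)//.
    by rewrite -(powR_inv1 (ltW m'0)) -powRrM mulN1r powRN mulrA mulrAC.
  apply=> z w; apply: le_trans (hdual z w) _; rewrite lerD2l -mulrA ler_wpM2l//.
  have [zw|zw] := ltP m' (mdist z w); last by rewrite mulr_ge0 ?invr_ge0 ?powR_ge0.
  rewrite mulrC ler_pdivlMr// mul1r.
  by apply: ge0_ler_powR; rewrite ?nnegrE ?mdist_ge0 ?(ltW p0) ?(ltW m'0) ?(ltW zw).
have cr : (Pop P phi x + Pop P psi y + t * r ^+ n.+2) @[n --> \oo] -->
    (Pop P phi x + Pop P psi y + t * 0).
  apply: cvgD; first exact: cvg_cst.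
  apply: cvgM; first exact: cvg_cst.
  have : r ^+ n @[n --> \oo] --> 0 by apply: cvg_expr; rewrite ger0_norm.
  by move=> h; rewrite -(cvg_shiftn 2) in h; under eq_fun do rewrite -addn2.
rewrite mulr0 addr0 in cr.
rewrite -(cvg_lim (@Rhausdorff R) cr).
apply: limr_ge; first by apply/cvg_ex; eexists; exact: cr.
exact: nearW.
Qed.

Lemma young_of_gradient (p q : R) : 1 < p -> p^-1 + q^-1 = 1 ->
  (forall f, bounded_lipschitz f -> forall x, (grad dt (Pop P f) x <=
     (\int[P x]_y (grad (@mdist R X) f y `^ q)) `^ q^-1)%E) ->
  young_estimate dt P p q.
Proof.
move=> p1 pq ge g bg x D D0.
have q0 : 0 < q.
  rewrite -invr_gt0; have -> : q^-1 = 1 - p^-1 by rewrite -pq addrC addKr.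
  by rewrite subr_gt0 invf_lt1// (lt_trans ltr01).
have [G [bG G0 GE]] := bounded_lipschitz_grad bg q0.
have IE : (\int[P x]_y (grad (@mdist R X) g y `^ q) = (Pop P G x)%:E)%E.
  by rewrite /Pop bounded_integral_EFin//; apply: eq_integral => y _; rewrite GE.
have I0 : 0 <= Pop P G x by apply: Rintegral_ge0 => y _; exact: G0.
have := ge g bg x; rewrite IE poweR_EFin => h.
have D0' : (0 <= D%:E)%E by rewrite lee_fin.
apply: le_trans (lee_wpmul2l D0' h) _.
rewrite -EFinM -EFinM -EFinD lee_fin.
apply: le_trans (young p1 pq D0 (powR_ge0 _ _)) _.
by rewrite -powRrM mulVf ?gt_eqF// powRr1// [_ / q]mulrC.
Qed.

(** Young's inequality is applied under the integral, pointwise, which leaves the exponent [p]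
    free. *)
Lemma young_of_gradient_infty (p q : R) : 1 < p -> p^-1 + q^-1 = 1 ->
  (forall f, bounded_lipschitz f -> forall x, (grad dt (Pop P f) x <=
     (\int[P x]_y (grad (@mdist R X) f y `^ 1)) `^ 1^-1)%E) ->
  young_estimate dt P p q.
Proof.
move=> p1 pq ge g bg x D D0.
have p0 : 0 < p by exact: lt_trans p1.
have q0 : 0 < q.
  rewrite -invr_gt0; have -> : q^-1 = 1 - p^-1 by rewrite -pq addrC addKr.
  by rewrite subr_gt0 invf_lt1.
have [G [bG G0 GE]] := bounded_lipschitz_grad bg q0.
have [G1 [bG1 G10 G1E]] := bounded_lipschitz_grad bg ltr01.
have GG1 z : G z = G1 z `^ q.
  by apply: EFin_inj; rewrite -GE -poweR_EFin -G1E poweRe1 ?grad_ge0.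
have IE : (\int[P x]_y (grad (@mdist R X) g y `^ q) = (Pop P G x)%:E)%E.
  by rewrite /Pop bounded_integral_EFin//; apply: eq_integral => y _; rewrite GE.
have I1E : (\int[P x]_y (grad (@mdist R X) g y `^ 1) = (Pop P G1 x)%:E)%E.
  by rewrite /Pop bounded_integral_EFin//; apply: eq_integral => y _; rewrite G1E.
have I10 : 0 <= Pop P G1 x by apply: Rintegral_ge0 => y _; exact: G10.
have := ge g bg x; rewrite IE I1E poweR_EFin invr1 powRr1// => h.
have D0' : (0 <= D%:E)%E by rewrite lee_fin.
apply: le_trans (lee_wpmul2l D0' h) _.
rewrite -EFinM -EFinM -EFinD lee_fin.
have bc := @bounded_measurable_cst _ X R (D `^ p / p).
have bZ := bounded_measurableZ q^-1 bG.
rewrite -(probability_Rintegral_cst (P x) (D `^ p / p)) /Pop -!bounded_integralZ//.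
rewrite -bounded_integralD//; apply: le_bounded_integral => //.
- exact: bounded_measurableZ.
- exact: bounded_measurableD.
- by move=> z; rewrite GG1 [q^-1 * _]mulrC; exact: young.
Qed.

End gradient_to_pointwise.

Section gradient_to_wasserstein.
Context {disp : measure_display} {R : realType}.
Context {X : completeBorelMetricType disp R}.
Variables (dt : X -> X -> R) (v : {measure set X -> \bar R}).
Variable (P : X -> probability X R).
Hypothesis separableX : separable_space X.
Hypothesis dt_distance : is_distance dt.
Hypothesis dt_continuous : continuous (fun z : X * X => dt z.1 z.2).
Hypothesis dt_geodesic : geodesic_distance dt.
Hypothesis P_density : continuous_density v P.

Let feller : forall h : X -> R, bounded_measurable h -> continuous (Pop P h).
Proof. exact: strong_feller P_density. Qed.

Let measurable_dt (x0 : X) : measurable_fun [set: X * X] (fun z : X * X => dt z.1 z.2).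
Proof. exact: (continuous_product_measurable x0 separableX). Qed.

Lemma probability_nonempty (mu : probability X R) : exists x0 : X, True.
Proof.
apply: contrapT => h; have := probability_setT mu.
have -> : [set: X] = set0 by apply/seteqP; split => // x _; apply: h; exists x.
by rewrite measure0 => /eqP; rewrite eq_sym onee_eq0.
Qed.

Lemma hoelder_conjugate_fin (r : R) : 1 < r ->
  r^-1 + (fine (hoelder_conjugate r%:E))^-1 = 1.
Proof.
move=> r1; have r0 : 0 < r by exact: lt_trans r1.
rewrite /hoelder_conjugate /= eqe gt_eqF// inver subr_eq0 gt_eqF//=.
by rewrite invf_div; field; rewrite gt_eqF.
Qed.

Lemma wasserstein_of_pointwise (r : R) (mu nu : probability X R)
    (pi0 : probability (X * X)%type R) : 1 <= r ->
  (forall (t : R) (phi psi : X -> R), 0 <= t ->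
    bounded_measurable phi -> bounded_measurable psi ->
    (forall z w, 0 <= phi z + psi w + t * mdist z w `^ r) ->
    forall x y, 0 <= Pop P phi x + Pop P psi y + t * dt x y `^ r) ->
  coupling mu nu pi0 ->
  (wasserstein (@mdist R X) r%:E (Pstar P mu) (Pstar P nu)
    <= 'N[pi0]_r%:E[(fun z => (dt z.1 z.2)%:E)])%E.
Proof.
move=> r1 hP cp; have r0 : 0 < r by exact: lt_le_trans r1.
have [dt0 _ _ _] := dt_distance.
have [x0 _] := probability_nonempty mu.
set N := 'N[pi0]_r%:E[_]%E.
have [->|Nfin] := eqVneq N +oo%E; first by rewrite leey.
have N0 : (0 <= N)%E by exact: Lnorm_ge0.
have NE : N = (fine N)%:E by rewrite fineK// ge0_fin_numE// ltey.
set C := fine N in NE.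
have C0 : 0 <= C by rewrite fine_ge0.
have mE : measurable_fun [set: X * X] (fun z : X * X => dt z.1 z.2 `^ r).
  apply: (@measurableT_comp _ _ _ _ _ _ (@powR R ^~ r)); first exact: measurable_powR.
  exact: measurable_dt.
have intE : (\int[pi0]_z (dt z.1 z.2 `^ r)%:E <= (C `^ r)%:E)%E.
  rewrite -poweR_EFin -NE (poweR_Lnorm _ _ (lt0r_neq0 r0)) le_eqVlt; apply/orP; left; apply/eqP.
  by apply: eq_integral => z _ /=; rewrite ger0_norm.
rewrite NE; apply/lee_addgt0Pr => e e0; rewrite -EFinD.
have d0 : 0 < e / 2 by rewrite divr_gt0.
have [||||||||pi [cpi hpi]] := @plan_transfer _ _ _ v P separableX P_density mu nu pi0
  (fun x y => mdist x y `^ r) (fun z => (dt z.1 z.2 `^ r)%:E) (C `^ r) (e / 2).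
- by move=> x y; exact: powR_ge0.
- exact: powR_ge0.
- exact/measurable_EFinP.
- by move=> z; rewrite lee_fin powR_ge0.
- exact: cp.
- exact: intE.
- move=> phi psi t bphi bpsi t0 hdual x y; rewrite -EFinM lee_fin.
  by have := hP t phi psi t0 bphi bpsi hdual x y; lra.
- exact: d0.
apply: le_trans (wasserstein_lb _ _ cpi) _.
have -> : e = 2 * (e / 2) by rewrite mulrC divfK.
apply: (Lnorm_mdist_le x0) => //; first exact: ltW.
apply: hpi.
- apply/measurable_EFinP; apply: (@measurableT_comp _ _ _ _ _ _ (@powR R ^~ r)).
    exact: measurable_powR.
  apply: measurable_maxr; last exact: measurable_cst.
  by apply: measurable_funB; [exact: measurable_mdist|exact: measurable_cst].
- by move=> z; rewrite lee_fin powR_ge0.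
- move=> x y x' y' xx' yy'; rewrite lee_fin; apply: ge0_ler_powR.
  + exact: ltW.
  + by rewrite nnegrE le_max lexx orbT.
  + by rewrite nnegrE mdist_ge0.
  + exact: shrunk_dist_le.
Qed.

(** An essential bound is the statement that an indicator has integral 0, so duality is used with
    total cost 0. *)
Lemma wasserstein_of_pointwise_infty (mu nu : probability X R)
    (pi0 : probability (X * X)%type R) :
  (forall (t m m' : R) (phi psi : X -> R), 0 <= t -> 0 <= m -> m < m' ->
    bounded_measurable phi -> bounded_measurable psi ->
    (forall z w, 0 <= phi z + psi w + t * (m' < mdist z w)%R%:R) ->
    forall x y, dt x y <= m -> 0 <= Pop P phi x + Pop P psi y) ->
  coupling mu nu pi0 ->
  (wasserstein (@mdist R X) +oo (Pstar P mu) (Pstar P nu)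
    <= 'N[pi0]_+oo[(fun z => (dt z.1 z.2)%:E)])%E.
Proof.
move=> hP cp.
have [dt0 _ _ _] := dt_distance.
have [x0 _] := probability_nonempty mu.
set N := 'N[pi0]_+oo[_]%E.
have [->|Nfin] := eqVneq N +oo%E; first by rewrite leey.
have N0 : (0 <= N)%E by exact: Lnorm_ge0.
have NE : N = (fine N)%:E by rewrite fineK// ge0_fin_numE// ltey.
set m := fine N in NE.
have m0 : 0 <= m by rewrite fine_ge0.
have ae_m : {ae pi0, forall z, (dt z.1 z.2 <= m)%R}.
  have : (N <= m%:E)%E by rewrite NE.
  rewrite /N unlock; case: ifPn => [_ /ess_supP|]; last first.
    by rewrite probability_measure_setT lte01.
  apply: filterS => z /=; rewrite lee_fin; exact: le_trans (ler_norm _).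
rewrite NE; apply/lee_addgt0Pr => e e0; rewrite -EFinD.
have d0 : 0 < e / 3 by rewrite divr_gt0.
(* One third of [e] separates [m] from [m']; the other two absorb the mesh in each variable. *)
pose m' := m + e / 3.
have mm' : m < m' by rewrite ltrDl.
pose far := [set z : X * X | m < dt z.1 z.2].
have mfar : measurable far.
  rewrite [far](_ : _ = (fun z : X * X => dt z.1 z.2) @^-1` `]m, +oo[); last first.
    by apply/seteqP; split=> z; rewrite /far /= in_itv /= andbT.
  by rewrite -[X in measurable X]setTI; apply: (measurable_dt x0).
(* As infinity times 0 is 0, this cost vanishes off the null set [far]; on [far] it makes the dual
   inequality trivial for every [t > 0]. *)
pose ee (z : X * X) : \bar R := (+oo * (\1_far z)%:E)%E.
have mee : measurable_fun [set: X * X] ee.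
  apply: emeasurable_funM; first exact: measurable_cst.
  exact/measurable_EFinP/measurable_indic.
have ee0 z : (0 <= ee z)%E by rewrite mule_ge0// lee_fin.
have int_ee : (\int[pi0]_z ee z = 0)%E.
  rewrite -(integral0 pi0 setT); apply: ge0_ae_eq_integral => //.
  apply: filterS ae_m => z zm _; rewrite /ee indicE memNset ?mule0//.
  by rewrite /far /=; apply/negP; rewrite -leNgt.
have [||||||||pi [cpi hpi]] := @plan_transfer _ _ _ v P separableX P_density mu nu pi0
  (fun x y => (m' < mdist x y)%R%:R) ee 0 (e / 3).
- by move=> x y; exact: ler0n.
- exact: lexx.
- exact: mee.
- exact: ee0.
- exact: cp.
- by rewrite int_ee.
- move=> phi psi t bphi bpsi t0 hdual x y.
  have [xy|xy] := leP (dt x y) m.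
    apply: (@le_trans _ _ 0%E); last by rewrite mule_ge0// lee_fin.
    by rewrite lee_fin oppr_le0; exact: (hP t m m').
  rewrite /ee indicE mem_set// mule1.
  (* For [t = 0] the infinite cost is multiplied by 0. But then the sum of the potentials is
     nonnegative at every pair of points, and it is integrated in one variable after the other. *)
  move: (t0); rewrite le_eqVlt => /predU1P[t00|tpos]; last by rewrite gt0_muley ?lte_fin// leey.
  rewrite -t00 mul0e lee_fin oppr_le0.
  have h1 w : 0 <= Pop P phi x + psi w.
    have bc := @bounded_measurable_cst _ X R (psi w).
    have <- : \int[P x]_z (phi z + psi w) = Pop P phi x + psi w.
      by rewrite bounded_integralD// probability_Rintegral_cst.
    by apply: Rintegral_ge0 => z _; have := hdual z w; rewrite -t00 mul0r addr0.
  have bc := @bounded_measurable_cst _ X R (Pop P phi x).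
  have <- : \int[P y]_w (Pop P phi x + psi w) = Pop P phi x + Pop P psi y.
    by rewrite bounded_integralD// probability_Rintegral_cst.
  by apply: Rintegral_ge0 => w _; exact: h1.
- exact: d0.
apply: le_trans (wasserstein_lb _ _ cpi) _.
pose far' := [set z : X * X | m + e < mdist z.1 z.2].
have mfar' : measurable far'.
  rewrite [far'](_ : _ = (fun z : X * X => mdist z.1 z.2) @^-1` `]m + e, +oo[); last first.
    by apply/seteqP; split=> z; rewrite /far' /= in_itv /= andbT.
  by rewrite -[X in measurable X]setTI; apply: (measurable_mdist x0 separableX).
have : (\int[pi]_z (\1_far' z)%:E <= 0%:E)%E.
  apply: hpi => [|z|x y x' y' xx' yy'].
  - exact/measurable_EFinP/measurable_indic.
  - by rewrite lee_fin.
  - rewrite indicE; have [xy|xy] := boolP ((x, y) \in far'); last by rewrite lee_fin ler0n.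
    rewrite lee_fin ler_nat lt0b.
    have h1 := metric_triangle x x' y; have h2 := metric_triangle x' y' y.
    rewrite (metric_sym y' y) in h2.
    by move: xy; rewrite inE /far' /= /m'; lra.
rewrite integral_indic// setIT => far0.
rewrite unlock; case: ifPn => _; last by rewrite lee_fin addr_ge0// ltW.
apply/ess_supP; exists far'; split => //.
  by apply/eqP; rewrite eq_le far0 measure_ge0.
move=> z /= h; rewrite /far' /= ltNge; apply/negP => zm; apply: h.
by rewrite lee_fin ger0_norm// mdist_ge0.
Qed.

Lemma gradient_to_wasserstein (p : \bar R) : (1 <= p)%E ->
  gradient_estimate dt P p -> wasserstein_control dt P p.
Proof.
move=> p1 [ge gep1] mu nu; apply: le_ereal_inf_tmp => _ [pi0 cp <-].
case: p p1 ge gep1 => [r||//]; rewrite ?lee_fin => r1 ge ge1.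
  apply: wasserstein_of_pointwise => // t phi psi t0 bphi bpsi hdual x y.
  move: r1; rewrite le_eqVlt => /predU1P[r1|r1].
    rewrite -r1 powRr1; last by case: dt_distance.
    apply: (dual_pointwise1 dt_distance dt_continuous dt_geodesic) => //.
      by apply: ge1; rewrite -r1.
    by move=> z w; have := hdual z w; rewrite -r1 powRr1// mdist_ge0.
  have pq := hoelder_conjugate_fin r1.
  apply: (dual_pointwise dt_distance dt_continuous dt_geodesic feller r1 pq) => //.
  by apply: young_of_gradient => // f bf z; apply: ge => //; rewrite lte_fin.
apply: wasserstein_of_pointwise_infty => // t m m' phi psi t0 m0 mm' bphi bpsi hdual x y.
apply: (dual_pointwise_infty dt_distance dt_continuous dt_geodesic feller _
  t0 m0 mm' bphi bpsi hdual).
move=> p q p1 pq; apply: young_of_gradient_infty => // f bf z.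
by have := ge (ltry 1) f bf z; rewrite hoelder_conjugatey.
Qed.

End gradient_to_wasserstein.

(** * From Wasserstein controls to gradient estimates *)

Section wasserstein_to_gradient.
Context {disp : measure_display} {R : realType}.
Context {X : completeBorelMetricType disp R}.
Variables (dt : X -> X -> R) (v : {measure set X -> \bar R}).
Variable (P : X -> probability X R).
Hypothesis separableX : separable_space X.
Hypothesis lengthX : length_space X.
Hypothesis dt_distance : is_distance dt.
Hypothesis dt_continuous : continuous (fun z : X * X => dt z.1 z.2).
Hypothesis P_density : continuous_density v P.

Let measurable_dt (x0 : X) : measurable_fun [set: X * X] (fun z : X * X => dt z.1 z.2).
Proof. exact: (continuous_product_measurable x0 separableX). Qed.

Lemma dirac_wasserstein_le (p : \bar R) x y : (1 <= p)%E ->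
  (wasserstein dt p (\d_x : probability X R) (\d_y : probability X R) <= (dt x y)%:E)%E.
Proof.
move=> p1; pose pi : probability (X * X)%type R := \d_((x, y)).
have [dt0 _ _ _] := dt_distance.
have cp : coupling (\d_x : probability X R) (\d_y : probability X R) pi.
  move=> A mA; rewrite /pi /= !diracE; split; congr ((nat_of_bool _)%:R%:E).
    by apply/idP/idP; rewrite !inE => // -[].
  by apply/idP/idP; rewrite !inE => // -[].
apply: le_trans (wasserstein_lb _ _ cp) _.
have mdt := measurable_dt x.
case: p p1 => [r||//]; rewrite ?lee_fin => r1; rewrite unlock.
  have r0 : 0 < r by exact: lt_le_trans r1.
  rewrite integral_dirac//.
    rewrite diracT mul1e /= ger0_norm// lee_fin -powRrM divff ?gt_eqF//.
    by rewrite powRr1.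
  apply/measurable_EFinP; apply: (@measurableT_comp _ _ _ _ _ _ (@powR R ^~ r)).
    exact: measurable_powR.
  exact: measurableT_comp.
case: ifPn => _; last by rewrite lee_fin.
pose far := [set z : X * X | dt x y < dt z.1 z.2].
have mfar : measurable far.
  rewrite [far](_ : _ = (fun z : X * X => dt z.1 z.2) @^-1` `]dt x y, +oo[); last first.
    by apply/seteqP; split=> z; rewrite /far /= in_itv /= andbT.
  by rewrite -[X in measurable X]setTI; apply: (measurable_dt x).
apply/ess_supP; exists far; split => //.
  by rewrite /pi /= diracE memNset// /far /= ltxx.
move=> z /= h; rewrite /far /= ltNge; apply/negP => zm; apply: h.
by rewrite lee_fin ger0_norm.
Qed.

Lemma kernel_plan (p : \bar R) x y (e : R) : (1 <= p)%E ->
  wasserstein_control dt P p -> 0 < e ->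
  exists pi : probability (X * X)%type R, coupling (P x) (P y) pi /\
    ('N[pi]_p[(fun z => (mdist z.1 z.2)%:E)] <= (dt x y + e)%:E)%E.
Proof.
move=> p1 wc e0; have h1 := wc (\d_x : probability X R) (\d_y : probability X R).
have := le_lt_trans (le_trans h1 (dirac_wasserstein_le x y p1)) 
  (ltac:(by rewrite lte_fin ltrDl) : ((dt x y)%:E < (dt x y + e)%:E)%E).
move=> /ereal_inf_lt[_ [pi cp <-] hN]; exists pi; split; last exact: ltW.
have PE z A : measurable A -> Pstar P (\d_z : probability X R) A = P z A.
  move=> mA; rewrite /Pstar integral_dirac//; last exact: transition_measurable P_density _ mA.
  by rewrite diracT mul1e.
by move=> A mA; have [-> ->] := cp A mA; rewrite !PE.
Qed.

Lemma coupling_diff_le x y (pi : probability (X * X)%type R) (f : X -> R)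
    (h : X * X -> \bar R) : coupling (P x) (P y) pi -> bounded_measurable f ->
  measurable_fun [set: X * X] h -> (forall z, 0 <= h z)%E ->
  {ae pi, forall z, ((`|f z.1 - f z.2|%R)%:E <= h z)%E} ->
  ((`|Pop P f x - Pop P f y|%R)%:E <= \int[pi]_z h z)%E.
Proof.
move=> cp bf mh h0 fh.
have b1 := bounded_measurable_fst bf; have b2 := bounded_measurable_snd bf.
have bB := bounded_measurableB b1 b2.
rewrite /Pop -(coupling_integral_fst cp bf) -(coupling_integral_snd cp bf).
rewrite -bounded_integralB//.
have bN : bounded_measurable (fun z : X * X => `|f z.1 - f z.2|).
  case: bB => mB [M hM]; split; first exact: measurableT_comp.
  by exists M => z; rewrite normr_id.
apply: (@le_trans _ _ (\int[pi]_z (`|f z.1 - f z.2|%R)%:E)%E).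
  rewrite -bounded_integral_EFin// lee_fin.
  by apply: le_normr_Rintegral => //; exact: (bounded_measurable_integrable pi bB).
apply: ae_ge0_le_integral => //.
  by case: bN => /measurable_EFinP.
by apply: filterS fh => z hz _.
Qed.

(** The local bound is integrated along curves whose length is almost the distance, which exist in a
    length space. *)
Lemma grad_lipschitz (f : X -> R) (K : R) : 0 <= K ->
  (forall z, (grad (@mdist R X) f z <= K%:E)%E) ->
  forall z w, `|f z - f w| <= K * mdist z w.
Proof.
move=> K0 hK z w; apply/ler_addgt0Pr => e e0.
have K1 : 0 < K + 1 by rewrite ltr_wpDl.
have : (mdist z w < mdist z w + e / (K + 1))%R by rewrite ltrDl divr_gt0.
rewrite -lte_fin [X in (X < _)%E]lengthX => /ereal_inf_lt[_ [gamma jg <-] len].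
have cm x : continuous (@mdist R X x).
  exact: (@continuous_dtr _ _ _ (@mdist R X) (@continuous_mdist _ _ _) x).
apply: le_trans (lipschitz_of_grad (@mdist_distance _ _ _) cm K0 hK jg (ltW len)) _.
rewrite mulrDr lerD2l mulrCA -[X in _ <= X]mulr1 ler_pM2l//.
by rewrite ler_pdivrMr// mul1r lerDl.
Qed.

Lemma grad_norm_control (f : X -> R) : wasserstein_control dt P 1 ->
  bounded_lipschitz f -> (grad_norm dt (Pop P f) <= grad_norm (@mdist R X) f)%E.
Proof.
move=> wc bl; have [_ [L hL]] := bl; have bf := bounded_lipschitz_measurable bl.
have [->|Kfin] := eqVneq (grad_norm (@mdist R X) f) +oo%E; first by rewrite leey.
apply: ge_ereal_sup => _ [x _ <-].
have gle z : (grad (@mdist R X) f z <= grad_norm (@mdist R X) f)%E.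
  by apply: ereal_sup_ubound; exists z.
have K0 : (0 <= grad_norm (@mdist R X) f)%E by apply: le_trans (gle x); exact: grad_ge0.
have KE : grad_norm (@mdist R X) f = (fine (grad_norm (@mdist R X) f))%:E.
  by rewrite fineK// ge0_fin_numE// ltey.
set K := fine _ in KE; rewrite KE in gle *.
have {}K0 : 0 <= K by rewrite fine_ge0.
have fK := grad_lipschitz K0 gle.
apply: (@grad_le _ _ _ _ _ _ 1) => // y _; apply/ler_addgt0Pr => e e0.
have K1 : 0 < K + 1 by rewrite ltr_wpDl.
have [pi [cp Npi]] := kernel_plan x y (lexx 1%E) wc (divr_gt0 e0 K1).
rewrite -lee_fin.
have mm : measurable_fun [set: X * X] (fun z : X * X => (mdist z.1 z.2)%:E).
  by apply/measurable_EFinP; exact: (measurable_mdist x separableX).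
have m0 z : (0 <= (mdist z.1 z.2)%:E :> \bar R)%E by rewrite lee_fin mdist_ge0.
have := @coupling_diff_le x y pi f (fun z => K%:E * (mdist z.1 z.2)%:E)%E cp bf.
move=> /(_ _ _ _)/le_trans; apply.
- by apply: emeasurable_funM => //; exact: measurable_cst.
- by move=> z; rewrite mule_ge0// lee_fin.
- by apply: aeW => z /=; rewrite -EFinM lee_fin.
rewrite ge0_integralZl_EFin//.
have K0' : (0 <= K%:E)%E by rewrite lee_fin.
rewrite Lnorm1 in Npi.
have Npi' : (\int[pi]_z (mdist z.1 z.2)%:E <= (dt x y + e / (K + 1))%:E)%E.
  apply: le_trans Npi; rewrite le_eqVlt; apply/orP; left; apply/eqP.
  by apply: eq_integral => z _; rewrite gee0_abs.
apply: le_trans (lee_wpmul2l K0' Npi') _.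
rewrite -EFinM lee_fin mulrDr lerD2l mulrCA -[X in _ <= X]mulr1 ler_pM2l//.
by rewrite ler_pdivrMr// mul1r lerDl.
Qed.

Section local_quotients.
Variables (f : X -> R) (q : R).
Hypothesis bl : bounded_lipschitz f.
Hypothesis q_gt0 : 0 < q.

Let cf : continuous f.
Proof. by have [_ [L hL]] := bl; exact: lipschitz_continuous hL. Qed.

Let lipschitz_const : exists2 L : R, 0 <= L & forall x y, `|f x - f y| <= L * mdist x y.
Proof.
have [_ [L hL]] := bl; exists (Num.max 0 L); first by rewrite le_max lexx.
move=> x y; rewrite (le_trans (hL x y))// ler_wpM2r ?mdist_ge0//.
by rewrite le_max lexx orbT.
Qed.

Definition local_quotient (r : R) (z : X) : R := fine (open_quotient_sup f r z).

Lemma local_quotient_ge0 r z : 0 <= local_quotient r z.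
Proof. by rewrite fine_ge0// open_quotient_sup_ge0. Qed.

Lemma open_quotient_supE r z : open_quotient_sup f r z = (local_quotient r z)%:E.
Proof.
have [L L0 hL] := lipschitz_const.
rewrite fineK// ge0_fin_numE ?open_quotient_sup_ge0//.
apply: (@le_lt_trans _ _ L%:E); last exact: ltry.
apply: ge_ereal_sup => _ [->|[y /= /andP[y0 _] <-]]; first by rewrite lee_fin.
by rewrite lee_fin normrM normfV (gtr0_norm y0) ler_pdivrMr.
Qed.

Lemma local_quotient_bounded : exists L : R, forall r z, local_quotient r z <= L.
Proof.
have [L L0 hL] := lipschitz_const; exists L => r z.
rewrite -lee_fin -open_quotient_supE.
apply: ge_ereal_sup => _ [->|[y /= /andP[y0 _] <-]]; first by rewrite lee_fin.
by rewrite lee_fin normrM normfV (gtr0_norm y0) ler_pdivrMr.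
Qed.

Lemma le_local_quotient r z w : mdist z w < r ->
  `|f z - f w| <= local_quotient r z * mdist z w.
Proof.
move=> zw; have := mdist_ge0 z w; rewrite le_eqVlt => /predU1P[/esym zw0|zw0].
  by rewrite zw0 mulr0 (mdist_positivity _ _ zw0) subrr normr0.
rewrite -ler_pdivrMr// -(gtr0_norm zw0) -normfV -normrM -lee_fin -open_quotient_supE.
apply: ereal_sup_ubound; right; exists w => //=.
by rewrite zw0.
Qed.

Lemma local_quotient_powR_bounded_measurable r :
  bounded_measurable (fun z => local_quotient r z `^ q).
Proof.
have [L hL] := local_quotient_bounded; split.
  apply: (@measurableT_comp _ _ _ _ _ _ (@powR R ^~ q)); first exact: measurable_powR.
  apply: (@measurableT_comp _ _ _ _ _ _ (@fine R)); first by [].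
  exact: open_quotient_sup_measurable.
exists (L `^ q) => z; rewrite ger0_norm ?powR_ge0//.
have h0 := local_quotient_ge0 r z.
apply: ge0_ler_powR; rewrite ?nnegrE ?(ltW q_gt0)//.
exact: le_trans h0 (hL r z).
Qed.

(** The scale tends to 0 under the fixed measure [P x]; a Lipschitz constant of [f] provides the
    dominating function. *)
Lemma grad_le_of_local_quotients x :
  (forall n, (grad dt (Pop P f) x <=
    (Pop P (fun z => local_quotient n.+1%:R^-1 z `^ q) x `^ q^-1)%:E)%E) ->
  (grad dt (Pop P f) x <= (\int[P x]_y (grad (@mdist R X) f y `^ q)) `^ q^-1)%E.
Proof.
move=> hn; have [G [bG G0 GE]] := bounded_lipschitz_grad bl q_gt0.
have IE : (\int[P x]_y (grad (@mdist R X) f y `^ q) = (Pop P G x)%:E)%E.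
  by rewrite /Pop bounded_integral_EFin//; apply: eq_integral => y _; rewrite GE.
have bQ n := local_quotient_powR_bounded_measurable n.+1%:R^-1.
have gfin : grad dt (Pop P f) x \is a fin_num.
  by rewrite ge0_fin_numE ?grad_ge0// (le_lt_trans (hn 0%N)) ?ltry.
have g0 : 0 <= fine (grad dt (Pop P f) x) by rewrite fine_ge0// grad_ge0.
rewrite IE poweR_EFin -(fineK gfin) lee_fin.
have ptw z : local_quotient n.+1%:R^-1 z `^ q @[n --> \oo] --> G z.
  have := @open_quotient_sup_cvg _ _ _ f z.
  have grfin : grad (@mdist R X) f z \is a fin_num.
    have [L L0 hL] := lipschitz_const.
    by rewrite ge0_fin_numE ?grad_ge0// (le_lt_trans (grad_le_lipschitz z L0 hL)) ?ltry.
  rewrite -(fineK grfin) => /fine_cvg cq.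
  have gr0 : 0 <= fine (grad (@mdist R X) f z) by rewrite fine_ge0// grad_ge0.
  have GzE : G z = fine (grad (@mdist R X) f z) `^ q.
    by apply: EFin_inj; rewrite -GE -poweR_EFin fineK.
  have ge_grad n : fine (grad (@mdist R X) f z) <= local_quotient n.+1%:R^-1 z.
    rewrite -lee_fin fineK// -open_quotient_supE.
    have n0 : (0 < n.+1%:R^-1 / 2 :> R) by rewrite divr_gt0// invr_gt0.
    apply: le_trans (grad_le_quotient _ f z n0) _.
    apply: difference_quotient_sup_le_open.
    by rewrite ltr_pdivrMr// ltr_pMr ?invr_gt0// ltr1n.
  rewrite GzE; apply/cvgrPdist_le => e e0.
  have [d d0 hd] := powR_upper_cont gr0 q_gt0 e0.
  move/cvgrPdist_lt : cq => /(_ _ d0); apply: filterS => n /=.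
  rewrite -/(local_quotient _ _) distrC ger0_norm ?subr_ge0// => hnd.
  have h0 := local_quotient_ge0 n.+1%:R^-1 z.
  rewrite distrC ger0_norm; last first.
    by rewrite subr_ge0; apply: ge0_ler_powR; rewrite ?nnegrE ?(ltW q_gt0).
  by rewrite lerBlDl; apply: hd => //; rewrite -lerBlDl ltW.
have [L hL] := local_quotient_bounded.
have cI : (\int[P x]_y (local_quotient n.+1%:R^-1 y `^ q)%:E)%E @[n --> \oo] -->
    (\int[P x]_y (G y)%:E)%E.
  apply: (@dominated_cvg _ _ _ (P x) _ measurableT
    (fun n y => (local_quotient n.+1%:R^-1 y `^ q)%:E) (EFin \o G) (cst (L `^ q)%:E)) => //=.
  - by move=> n; case: (bQ n) => /measurable_EFinP.
  - by move=> y _; apply: cvg_EFin; [exact: nearW|exact: ptw].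
  - exact: (bounded_measurable_integrable (P x) (@bounded_measurable_cst _ X R (L `^ q))).
  - move=> n y _; rewrite lee_fin ger0_norm ?powR_ge0//.
    have h0 := local_quotient_ge0 n.+1%:R^-1 y.
    apply: ge0_ler_powR; rewrite ?nnegrE ?(ltW q_gt0)//.
    exact: le_trans h0 (hL _ y).
have gq : ((fine (grad dt (Pop P f) x) `^ q)%:E <= \int[P x]_y (G y)%:E)%E.
  rewrite -(cvg_lim (@ereal_hausdorff R) cI).
  apply: lime_ge; first by apply/cvg_ex; eexists; exact: cI.
  apply: nearW => n; rewrite -bounded_integral_EFin// lee_fin.
  have A0 : 0 <= \int[P x]_y (local_quotient n.+1%:R^-1 y `^ q).
    by apply: Rintegral_ge0 => y _; exact: powR_ge0.
  have := hn n; rewrite -(fineK gfin) lee_fin /Pop.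
  move: (Rintegral _ _ _) A0 => A A0 h.
  rewrite -[X in _ <= X](powRr1 A0) -(mulVf (lt0r_neq0 q_gt0)) powRrM.
  by apply: ge0_ler_powR; rewrite ?nnegrE ?powR_ge0 ?(ltW q_gt0).
rewrite -[X in X <= _](powRr1 g0) -(divff (lt0r_neq0 q_gt0)) powRrM.
apply: ge0_ler_powR; rewrite ?nnegrE ?powR_ge0 ?invr_ge0 ?(ltW q_gt0)//.
  by apply: Rintegral_ge0 => y _; exact: G0.
by rewrite -lee_fin /Pop bounded_integral_EFin.
Qed.

End local_quotients.

End wasserstein_to_gradient.

Section wasserstein_to_gradient_gt1.
Context {disp : measure_display} {R : realType}.
Context {X : completeBorelMetricType disp R}.
Variables (dt : X -> X -> R) (v : {measure set X -> \bar R}).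
Variable (P : X -> probability X R).
Hypothesis separableX : separable_space X.
Hypothesis dt_distance : is_distance dt.
Hypothesis dt_continuous : continuous (fun z : X * X => dt z.1 z.2).
Hypothesis P_density : continuous_density v P.
Variable f : X -> R.
Hypothesis bl : bounded_lipschitz f.

Let bf : bounded_measurable f.
Proof. exact: bounded_lipschitz_measurable. Qed.

Let lipschitz_const : exists2 L : R, 0 <= L & forall x y, `|f x - f y| <= L * mdist x y.
Proof.
have [_ [L hL]] := bl; exists (Num.max 0 L); first by rewrite le_max lexx.
move=> x y; rewrite (le_trans (hL x y))// ler_wpM2r ?mdist_ge0//.
by rewrite le_max lexx orbT.
Qed.

Let measurable_local_quotient rad : measurable_fun [set: X] (local_quotient f rad).
Proof.
apply: (@measurableT_comp _ _ _ _ _ _ (@fine R)); first by [].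
apply: open_quotient_sup_measurable.
by have [L _ hL] := lipschitz_const; exact: lipschitz_continuous hL.
Qed.

(** Pairs closer than [rad] are handled by the local quotient and Hoelder's inequality. For the
    others, the distance is at most its [r]-th power divided by rad^(r-1), which yields a term
    superlinear in [dt x y]. *)
Lemma difference_le_local_quotient (r q rad L : R) x y : 1 < r -> r^-1 + q^-1 = 1 ->
  wasserstein_control dt P r%:E -> 0 < rad -> 0 <= L ->
  (forall x y, `|f x - f y| <= L * mdist x y) ->
  `|Pop P f x - Pop P f y| <=
    Pop P (fun z => local_quotient f rad z `^ q) x `^ q^-1 * dt x y +
    L / rad `^ (r - 1) * dt x y `^ r.
Proof.
move=> r1 rq wc rad0 L0 hL; have r0 : 0 < r by exact: lt_trans r1.
have q0 : 0 < q.
  rewrite -invr_gt0; have -> : q^-1 = 1 - r^-1 by rewrite -rq addrC addKr.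
  by rewrite subr_gt0 invf_lt1.
have [dt0 _ _ _] := dt_distance.
have bQ := local_quotient_powR_bounded_measurable bl q0 rad.
set A := Pop P (fun z => local_quotient f rad z `^ q) x.
have A0 : 0 <= A by apply: Rintegral_ge0 => z _; exact: powR_ge0.
set c := L / _; have c0 : 0 <= c by rewrite divr_ge0 ?powR_ge0.
apply/ler_addgt0Pr => e e0.
have Ac : 0 < A `^ q^-1 + c + 1 by rewrite ltr_wpDl// addr_ge0 ?powR_ge0.
pose e1 := e / (A `^ q^-1 + c + 1).
have e10 : 0 < e1 by rewrite divr_gt0.
have [d d0 hd] := powR_upper_cont (dt0 x y) r0 e10.
pose e2 := Num.min d e1.
have e20 : 0 < e2 by rewrite lt_min d0.
have e2d : e2 <= d by rewrite ge_min lexx.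
have e2e : e2 <= e1 by rewrite ge_min lexx orbT.
have r1E : (1 <= r%:E)%E by rewrite lee_fin ltW.
have [pi [cp hN]] := kernel_plan separableX dt_distance dt_continuous P_density x y r1E wc e20.
have mm := measurable_mdist x separableX.
have mQ : measurable_fun [set: X * X] (fun z : X * X => local_quotient f rad z.1).
  exact: (measurableT_comp (measurable_local_quotient rad) measurable_fst).
have mr : measurable_fun [set: X * X] (fun z : X * X => mdist z.1 z.2 `^ r).
  by apply: (@measurableT_comp _ _ _ _ _ _ (@powR R ^~ r)) => //; exact: measurable_powR.
have LQ0 z : 0 <= local_quotient f rad z by exact: local_quotient_ge0.
have NE : ('N[pi]_r%:E[(fun z => (mdist z.1 z.2)%:E)] `^ r =
    \int[pi]_z (mdist z.1 z.2 `^ r)%:E)%E.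
  rewrite (poweR_Lnorm _ _ (lt0r_neq0 r0)); apply: eq_integral => z _ /=.
  by rewrite ger0_norm ?mdist_ge0.
have I2 : (\int[pi]_z (mdist z.1 z.2 `^ r)%:E <= ((dt x y + e2) `^ r)%:E)%E.
  rewrite -NE -poweR_EFin; apply: gt0_ler_poweR => //; first exact: ltW.
    by rewrite in_itv /= leey andbT Lnorm_ge0.
  by rewrite in_itv /= leey andbT lee_fin addr_ge0// ltW.
have I1 : (\int[pi]_z (local_quotient f rad z.1 * mdist z.1 z.2)%:E <=
    (A `^ q^-1 * (dt x y + e2))%:E)%E.
  have := hoelder pi mQ mm q0 r0; rewrite addrC => /(_ rq).
  have -> : ('N[pi]_q%:E[(fun z => (local_quotient f rad z.1)%:E)] = (A `^ q^-1)%:E)%E.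
    rewrite unlock -poweR_EFin; congr (_ `^ _)%E.
    rewrite /A /Pop -(coupling_integral_fst cp bQ) bounded_integral_EFin; last first.
      exact: (bounded_measurable_fst bQ).
    by apply: eq_integral => z _ /=; rewrite ger0_norm.
  rewrite Lnorm1 => h; rewrite EFinM.
  apply: (@le_trans _ _ ((A `^ q^-1)%:E * 'N[pi]_r%:E[(fun z => (mdist z.1 z.2)%:E)])%E).
    apply: le_trans h; rewrite le_eqVlt; apply/orP; left; apply/eqP.
    by apply: eq_integral => z _ /=; rewrite ger0_norm// mulr_ge0 ?mdist_ge0.
  by rewrite lee_wpmul2l// lee_fin powR_ge0.
have main : `|Pop P f x - Pop P f y| <= A `^ q^-1 * (dt x y + e2) + c * (dt x y + e2) `^ r.
  rewrite -lee_fin EFinD.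
  pose h (z : X * X) : \bar R :=
    ((local_quotient f rad z.1 * mdist z.1 z.2)%:E + c%:E * (mdist z.1 z.2 `^ r)%:E)%E.
  apply: (@le_trans _ _ (\int[pi]_z h z)%E).
    apply: coupling_diff_le => //.
    - apply: emeasurable_funD.
        by apply/measurable_EFinP; exact: measurable_funM.
      by apply: emeasurable_funM; [exact: measurable_cst|exact/measurable_EFinP].
    - move=> z; rewrite /h -EFinM -EFinD lee_fin.
      by apply: addr_ge0; apply: mulr_ge0; rewrite ?powR_ge0 ?mdist_ge0.
    - apply: aeW => -[z w] /=; rewrite /h -EFinM -EFinD lee_fin /=.
      have [zw|zw] := ltP (mdist z w) rad.
        apply: le_trans (le_local_quotient bl zw) _.
        by rewrite lerDl mulr_ge0 ?powR_ge0.
      apply: le_trans (hL z w) _; rewrite -[X in X <= _]add0r lerD ?mulr_ge0 ?mdist_ge0//.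
      rewrite /c -(mulr_powRB1 (mdist_ge0 z w) r0).
      have -> : L / rad `^ (r - 1) * (mdist z w * mdist z w `^ (r - 1)) =
          L * mdist z w * (mdist z w `^ (r - 1) / rad `^ (r - 1)) by ring.
      rewrite ler_peMr ?mulr_ge0 ?mdist_ge0// ler_pdivlMr ?powR_gt0// mul1r.
      apply: ge0_ler_powR; rewrite ?nnegrE ?mdist_ge0 ?(ltW rad0)//.
      by rewrite subr_ge0 ltW.
  rewrite /h ge0_integralD//; first last.
  - by apply: emeasurable_funM; [exact: measurable_cst|exact/measurable_EFinP].
  - by move=> z _; rewrite -EFinM lee_fin mulr_ge0 ?powR_ge0.
  - by apply/measurable_EFinP; exact: measurable_funM.
  - by move=> z _; rewrite lee_fin mulr_ge0 ?mdist_ge0.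
  apply: leeD => //; rewrite ge0_integralZl_EFin//; first last.
  - exact/measurable_EFinP.
  - by move=> z _; rewrite lee_fin powR_ge0.
  rewrite (EFinM c); apply: lee_wpmul2l; first by rewrite lee_fin.
  exact: I2.
have hd2 : (dt x y + e2) `^ r <= dt x y `^ r + e1.
  by apply: hd; [rewrite addr_ge0// ltW|rewrite lerD2l].
apply: le_trans main _.
apply: (@le_trans _ _ (A `^ q^-1 * (dt x y + e1) + c * (dt x y `^ r + e1))).
  by rewrite lerD// ler_wpM2l ?powR_ge0// lerD2l.
have -> : A `^ q^-1 * (dt x y + e1) + c * (dt x y `^ r + e1) =
  A `^ q^-1 * dt x y + c * dt x y `^ r + (A `^ q^-1 + c) * e1 by ring.
rewrite lerD2l /e1 mulrA ler_pdivrMr// mulrC ler_pM2l//.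
by rewrite lerDl.
Qed.

Lemma gradient_of_control_fin (r q : R) x : 1 < r -> r^-1 + q^-1 = 1 ->
  wasserstein_control dt P r%:E ->
  (grad dt (Pop P f) x <= (\int[P x]_y (grad (@mdist R X) f y `^ q)) `^ q^-1)%E.
Proof.
move=> r1 rq wc; have r0 : 0 < r by exact: lt_trans r1.
have q0 : 0 < q.
  rewrite -invr_gt0; have -> : q^-1 = 1 - r^-1 by rewrite -rq addrC addKr.
  by rewrite subr_gt0 invf_lt1.
have [dt0 _ _ _] := dt_distance; have [L L0 hL] := lipschitz_const.
apply: (grad_le_of_local_quotients bl q0) => n.
have rad0 : 0 < n.+1%:R^-1 :> R by rewrite invr_gt0.
set rad := n.+1%:R^-1 in rad0 *; set A := Pop P _ x.
apply/lee_addgt0Pr => e e0; rewrite -EFinD.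
pose c := L / rad `^ (r - 1).
have c0 : 0 <= c by rewrite divr_ge0 ?powR_ge0.
have c1 : 0 < c + 1 by rewrite ltr_wpDl.
have r10 : 0 < r - 1 by rewrite subr_gt0.
have [d d0 hd] := powR_upper_cont (lexx 0) r10 (divr_gt0 e0 c1).
apply: (@grad_le _ _ _ _ _ _ d) => //; first by rewrite addr_ge0 ?powR_ge0// ltW.
move=> y xyd; apply: le_trans (difference_le_local_quotient x y r1 rq wc rad0 L0 hL) _.
rewrite mulrDl lerD2l -/c -(mulr_powRB1 (dt0 x y) r0) mulrCA mulrC ler_wpM2r//.
have := hd (dt x y) (dt0 x y); rewrite add0r => /(_ xyd).
rewrite powR0 ?gt_eqF// add0r => h; apply: le_trans (ler_wpM2l c0 h) _.
by rewrite mulrCA -[X in _ <= X]mulr1 ler_pM2l// ler_pdivrMr// mul1r lerDl.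
Qed.

(** An almost optimal plan is concentrated on pairs at distance little more than [dt x y]. Once this
    is below [rad], only the local quotient matters and no remainder appears. *)
Lemma gradient_of_control_infty x : wasserstein_control dt P +oo ->
  (grad dt (Pop P f) x <= (\int[P x]_y (grad (@mdist R X) f y `^ 1)) `^ 1^-1)%E.
Proof.
move=> wc; have [dt0 _ _ _] := dt_distance.
apply: (grad_le_of_local_quotients bl ltr01) => n.
have rad0 : 0 < n.+1%:R^-1 :> R by rewrite invr_gt0.
set rad := n.+1%:R^-1 in rad0 *.
have bQ := local_quotient_powR_bounded_measurable bl ltr01 rad.
set A := Pop P _ x; have A0 : 0 <= A by apply: Rintegral_ge0 => z _; exact: powR_ge0.
rewrite invr1 powRr1//.
apply: (@grad_le _ _ _ _ _ _ (rad / 2)) => //; first by rewrite divr_gt0.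
move=> y xyd; apply/ler_addgt0Pr => e e0.
have A1 : 0 < A + 1 by rewrite ltr_wpDl.
pose e1 := Num.min (rad / 3) (e / (A + 1)).
have e10 : 0 < e1 by rewrite lt_min !divr_gt0.
have e1r : dt x y + e1 < rad.
  have : e1 <= rad / 3 by rewrite ge_min lexx.
  by move: xyd rad0; lra.
have [pi [cp hN]] := kernel_plan separableX dt_distance dt_continuous P_density x y
  (leey 1%E) wc e10.
have ae_d : {ae pi, forall z, (mdist z.1 z.2 <= dt x y + e1)%R}.
  move: hN; rewrite unlock; case: ifPn => [_ /ess_supP|]; last first.
    by rewrite probability_measure_setT lte01.
  by apply: filterS => z /=; rewrite lee_fin; exact: le_trans (ler_norm _).
have bQ1 := bounded_measurable_fst bQ.
have k0 : 0 <= dt x y + e1 by rewrite addr_ge0// ltW.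
have main : `|Pop P f x - Pop P f y| <= (dt x y + e1) * A.
  rewrite -lee_fin /A /Pop -(coupling_integral_fst cp bQ) -bounded_integralZ//.
  have bZ := bounded_measurableZ (dt x y + e1) bQ1.
  rewrite bounded_integral_EFin//.
  apply: coupling_diff_le => //.
  - by case: bZ => /measurable_EFinP.
  - by move=> z; rewrite lee_fin mulr_ge0 ?powR_ge0.
  - apply: filterS ae_d => -[z w] /= zw; rewrite lee_fin.
    have LQ0 : 0 <= local_quotient f rad z by exact: local_quotient_ge0.
    rewrite powRr1//; apply: le_trans (le_local_quotient bl (le_lt_trans zw e1r)) _.
    by rewrite mulrC ler_wpM2r.
apply: le_trans main _; rewrite mulrDl mulrC lerD2l.
apply: (@le_trans _ _ (e / (A + 1) * A)).
  by rewrite ler_wpM2r// ge_min lexx orbT.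
by rewrite mulrAC ler_pdivrMr// ler_pM2l// lerDl.
Qed.

End wasserstein_to_gradient_gt1.

Theorem theorem2p2 (disp : measure_display) (R : realType)
    (X : completeBorelMetricType disp R)
    (separableX : separable_space X)
    (properX : proper_space X)
    (lengthX : length_space X)
    (dt : X -> X -> R)
    (dt_distance : is_distance dt)
    (dt_continuous : continuous (fun z : X * X => dt z.1 z.2))
    (dt_geodesic : geodesic_distance dt)
    (P : X -> probability X R)
    (P_continuous : weakly_continuous P)
    (v : {measure set X -> \bar R})
    (v_radon : radon v)
    (v_doubling : local_volume_doubling v)
    (v_poincare : local_poincare v)
    (P_density : continuous_density v P)
    (p : \bar R) (p_ge1 : (1 <= p)%E) :
  wasserstein_control dt P p <-> gradient_estimate dt P p.
Proof.
split=> [wc|]; last exact: (gradient_to_wasserstein separableX dt_distance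
  dt_continuous dt_geodesic P_density).
split=> [|p1 f bl]; last first.
  rewrite p1 in wc.
  exact: (grad_norm_control separableX lengthX dt_distance dt_continuous P_density).
case: p p_ge1 wc => [r| |//] _ wc p_gt1 q f bl x; last first.
  by rewrite /q hoelder_conjugatey; exact: (gradient_of_control_infty separableX
    dt_distance dt_continuous P_density).
rewrite lte_fin in p_gt1.
exact: (gradient_of_control_fin separableX dt_distance dt_continuous P_density bl
  x p_gt1 (hoelder_conjugate_fin p_gt1)).
Qed.
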